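(* Let $V_1$ and $V_2$ be two finite dimensional complex vector spaces, and put $G=\mathrm{GL}(V_1)\times\mathrm{GL}(V_2)$ and $\hat G=\mathrm{GL}\big(V_1\oplus(V_1\otimes V_2)\oplus V_2\big)$. Consider the morphism $\varphi:G\to\hat G$, $(g_1,g_2)\mapsto\varphi_{g_1,g_2}$, where $$\varphi_{g_1,g_2}\Big(u_1+\sum_i v_1^{(i)}\otimes v_2^{(i)}+u_2\Big)=g_1(u_1)+\sum_i g_1(v_1^{(i)})\otimes g_2(v_2^{(i)})+g_2(u_2)$$ for $u_1,v_1^{(i)}\in V_1$ and $u_2,v_2^{(i)}\in V_2$. Then the Aguiar coefficients are the branching coefficients for this situation: for every partition $\nu$ with $\ell(\nu)\le\dim\big(V_1\oplus(V_1\otimes V_2)\oplus V_2\big)$, one has $$\mathbb{S}^\nu\big(V_1\oplus(V_1\otimes V_2)\oplus V_2\big)\simeq\bigoplus_{\lambda,\mu}\left(\mathbb{S}^\lambda V_1\otimes\mathbb{S}^\mu V_2\right)^{\oplus a_{\lambda,\mu}^\nu}$$ as representations of $\mathrm{GL}(V_1)\times\mathrm{GL}(V_2)$ (acting on the left-hand side via $\varphi$), where the sum is over all pairs of partitions $(\lambda,\mu)$ with $\ell(\lambda)\le\dim V_1$ and $\ell(\mu)\le\dim V_2$.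
   Context: All representations are complex. A partition $\lambda=(\lambda_1\ge\dots\ge\lambda_n>0)$ is a finite non-increasing sequence of positive integers (possibly empty); $|\lambda|$ is the sum of its parts, $\ell(\lambda)$ its number of parts. For a partition $\lambda$ of $k$, $M_\lambda$ denotes the irreducible complex representation of the symmetric group $\mathfrak{S}_k$ corresponding to $\lambda$ (Specht module). For a finite dimensional complex vector space $V$ and a partition $\lambda$ with $\ell(\lambda)\le\dim V$, $\mathbb{S}^\lambda V$ is the irreducible polynomial representation of $\mathrm{GL}(V)$ corresponding to $\lambda$ (Schur functor). For $a,b\ge0$ let $\iota_{a,b}:\mathfrak{S}_a\times\mathfrak{S}_b\hookrightarrow\mathfrak{S}_{a+b}$ be the standard embedding ($\mathfrak{S}_a$ permutes $\{1,\dots,a\}$, $\mathfrak{S}_b$ permutes $\{a+1,\dots,a+b\}$). Heisenberg product: let $V$, $W$ be representations of $\mathfrak{S}_k$, $\mathfrak{S}_l$. For $i\in\{\max(k,l),\dots,k+l\}$ put $H_i=\mathfrak{S}_{i-l}\times\mathfrak{S}_{k+l-i}\times\mathfrak{S}_{i-k}$, embedded in $\mathfrak{S}_k\times\mathfrak{S}_l$ by $(\sigma,\tau,\rho)\mapsto(\iota_{i-l,k+l-i}(\sigma,\tau),\iota_{k+l-i,i-k}(\tau,\rho))$ and in $\mathfrak{S}_i$ by $(\sigma,\tau,\rho)\mapsto\iota_{i-l,l}(\sigma,\iota_{k+l-i,i-k}(\tau,\rho))$. Then $(V\sharp W)_i=\mathrm{Ind}_{H_i}^{\mathfrak{S}_i}\mathrm{Res}^{\mathfrak{S}_k\times\mathfrak{S}_l}_{H_i}(V\otimes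 W)$ and $V\sharp W=\bigoplus_{i=\max(k,l)}^{k+l}(V\sharp W)_i$. Aguiar coefficients: for $\lambda\vdash k$, $\mu\vdash l$ the non-negative integers $a_{\lambda,\mu}^\nu$ are the multiplicities in $M_\lambda\sharp M_\mu=\bigoplus_{i=\max(k,l)}^{k+l}\bigoplus_{\nu\vdash i}M_\nu^{\oplus a_{\lambda,\mu}^\nu}$; by convention $a_{\lambda,\mu}^\nu=0$ if $|\nu|\notin\{\max(|\lambda|,|\mu|),\dots,|\lambda|+|\mu|\}$. *)

(* Defs.v *)
From HB Require Import structures.
From mathcomp Require Import all_boot all_order all_algebra all_fingroup.
From mathcomp Require Import boolp classical_sets.

Set Implicit Arguments.
Unset Strict Implicit.
Unset Printing Implicit Defensive.

Import GRing.Theory.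

Local Open Scope ring_scope.

Record rep (F : fieldType) (G : groupType) := Rep {
  rep_space :> vectType F;
  rep_act : G -> 'End(rep_space);
  rep_act1 : rep_act 1%g = \1%VF;
  rep_actM : forall g h, rep_act (g * h)%g = (rep_act g \o rep_act h)%VF }.

Arguments Rep {F G}.
Arguments rep_act {F G} U g : rename.

Definition rep_iso (F : fieldType) (G : groupType) (U V : rep F G) : Prop :=
  exists2 f : 'Hom(U, V),
    bijective f & forall g u, f (rep_act U g u) = rep_act V g (f u).

Section Restriction.

Variables (F : fieldType) (G H : groupType) (f : {multiplicative H -> G}).
Variable U : rep F G.

Fact res_act1 : rep_act U (f 1%g) = \1%VF.
Proof.
have -> : f 1%g = 1%g; last exact: rep_act1.
by apply: (@mulgI _ (f 1%g)); rewrite -gmulfM !mulg1.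
Qed.

Fact res_actM g h :
  rep_act U (f (g * h)%g) = (rep_act U (f g) \o rep_act U (f h))%VF.
Proof. by rewrite gmulfM rep_actM. Qed.

Definition res_rep : rep F H :=
  Rep U (fun h => rep_act U (f h)) res_act1 res_actM.

End Restriction.

Section Subrepresentation.

Variables (F : fieldType) (G : groupType) (U : rep F G) (S : {vspace U}).

Definition stable := forall g u, u \in S -> rep_act U g u \in S.

Hypothesis stableS : stable.

Definition sub_act (g : G) : 'End(subvs_of S) :=
  linfun (vsproj S \o rep_act U g \o vsval).

Lemma sub_actE g u : vsval (sub_act g u) = rep_act U g (vsval u).
Proof. by rewrite lfunE /= vsprojK // stableS // subvsP. Qed.

Fact sub_act1 : sub_act 1%g = \1%VF.
Proof.
by apply/lfunP => u; apply: val_inj; rewrite /= sub_actE rep_act1 !id_lfunE.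
Qed.

Fact sub_actM g h : sub_act (g * h)%g = (sub_act g \o sub_act h)%VF.
Proof.
apply/lfunP => u; apply: val_inj.
by rewrite /= comp_lfunE !sub_actE rep_actM comp_lfunE.
Qed.

Definition sub_rep : rep F G := Rep (subvs_of S) sub_act sub_act1 sub_actM.

End Subrepresentation.

Section DirectSum.

Variables (F : fieldType) (G : groupType).

Fact zero_actM (g h : G) : (\1 = \1 \o \1 :> 'End('rV[F]_0))%VF.
Proof. by rewrite comp_lfun1l. Qed.

Definition zero_rep : rep F G := Rep 'rV[F]_0 (fun=> \1%VF) erefl zero_actM.

Variables U V : rep F G.

Definition dsum_fun (f : 'End(U)) (g : 'End(V)) (u : U * V) : U * V :=
  (f u.1, g u.2).

Fact dsum_fun_linear f g : linear (dsum_fun f g).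
Proof. by move=> a u v; rewrite /dsum_fun !linearP. Qed.
HB.instance Definition _ f g := GRing.isLinear.Build F _ _ _ (dsum_fun f g)
  (dsum_fun_linear f g).

Definition dsum_act (g : G) : 'End((U * V)%type) :=
  linfun (dsum_fun (rep_act U g) (rep_act V g)).

Fact dsum_act1 : dsum_act 1%g = \1%VF.
Proof.
apply/lfunP => -[u v].
by rewrite [LHS]lfunE /= /dsum_fun !rep_act1 !id_lfunE.
Qed.

Fact dsum_actM g h : dsum_act (g * h)%g = (dsum_act g \o dsum_act h)%VF.
Proof.
apply/lfunP => -[u v]; rewrite comp_lfunE.
by rewrite !lfunE /= /dsum_fun !rep_actM !comp_lfunE.
Qed.

Definition dsum_rep : rep F G :=
  Rep (U * V)%type dsum_act dsum_act1 dsum_actM.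

End DirectSum.

Arguments zero_rep {F G}.

Declare Scope rep_scope.
Bind Scope rep_scope with rep.
Delimit Scope rep_scope with rep.

Reserved Notation "\bigoplus_ i U"
  (at level 41, i at level 0, U at level 41).
Reserved Notation "\bigoplus_ ( i | P ) U"
  (at level 41, i at level 50, U at level 41).
Reserved Notation "\bigoplus_ ( i : t | P ) U"
  (at level 41, i at level 50, U at level 41).
Reserved Notation "\bigoplus_ ( i < n ) U"
  (at level 41, i, n at level 50, U at level 41).

Notation "\bigoplus_ i U" := (\big[@dsum_rep _ _/zero_rep]_i U) : rep_scope.
Notation "\bigoplus_ ( i | P ) U" :=
  (\big[@dsum_rep _ _/zero_rep]_(i | P%B) U) : rep_scope.
Notation "\bigoplus_ ( i : t | P ) U" :=
  (\big[@dsum_rep _ _/zero_rep]_(i : t | P%B) U) (only parsing) : rep_scope.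
Notation "\bigoplus_ ( i < n ) U" :=
  (\big[@dsum_rep _ _/zero_rep]_(i < n) U) : rep_scope.

Section Tensor.

Variable F : fieldType.

(* [V] tensor [W], with the coordinate of [e_i (x) f_j] at position [(i, j)],
   [e] and [f] being the bases [vbasis] of [V] and [W]. *)
Definition tens (V W : vectType F) : vectType F :=
  'M[F]_(\dim {:V}, \dim {:W}).

Definition tensv (V W : vectType F) (v : V) (w : W) : tens V W :=
  \matrix_(i, j) (coord (vbasis {:V}) i v * coord (vbasis {:W}) j w).

Variables V W : vectType F.

Lemma tensv_sumZ (I J : finType) (a : I -> F) (v : I -> V) (b : J -> F)
    (w : J -> W) :
  tensv (\sum_i a i *: v i) (\sum_j b j *: w j) =
  \sum_i \sum_j (a i * b j) *: tensv (v i) (w j).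
Proof.
apply/matrixP => p q; rewrite mxE !linear_sum summxE mulr_suml.
apply: eq_bigr => i _; rewrite summxE mulr_sumr; apply: eq_bigr => j _.
by rewrite !mxE !linearZ /= mulrACA.
Qed.

Lemma tens_sum (t : tens V W) :
  t = \sum_i \sum_j t i j *: tensv (vbasis {:V})`_i (vbasis {:W})`_j.
Proof.
rewrite [t in LHS]matrix_sum_delta; apply: eq_bigr => i _.
apply: eq_bigr => j _; congr (_ *: _); apply/matrixP => p q.
rewrite !mxE !coord_free ?(basis_free (vbasisP _)) // -natrM mulnb.
by rewrite (eq_sym p) (eq_sym q).
Qed.

Definition tens_fun (g : 'End(V)) (h : 'End(W)) (t : tens V W) : tens V W :=
  \sum_i \sum_j t i j *: tensv (g (vbasis {:V})`_i) (h (vbasis {:W})`_j).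

Fact tens_fun_linear g h : linear (tens_fun g h).
Proof.
move=> a t u; rewrite /tens_fun scaler_sumr -big_split; apply: eq_bigr => i _.
rewrite scaler_sumr -big_split; apply: eq_bigr => j _.
by rewrite !mxE scalerDl scalerA.
Qed.
HB.instance Definition _ g h := GRing.isLinear.Build F _ _ _ (tens_fun g h)
  (tens_fun_linear g h).

Definition tensf g h : 'End(tens V W) := linfun (tens_fun g h).

Lemma tensfE g h v w : tensf g h (tensv v w) = tensv (g v) (h w).
Proof.
have lin_vbasis (U : vectType F) (f : 'End(U)) u :
    f u = \sum_i coord (vbasis {:U}) i u *: f (vbasis {:U})`_i.
  rewrite {1}(coord_vbasis (memvf u)) linear_sum.
  by apply: eq_bigr => i _; rewrite linearZ.
rewrite lfunE (lin_vbasis _ g) (lin_vbasis _ h) tensv_sumZ.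
by apply: eq_bigr => i _; apply: eq_bigr => j _; rewrite mxE.
Qed.

Lemma tens_eq (f f' : 'End(tens V W)) :
  (forall v w, f (tensv v w) = f' (tensv v w)) -> f = f'.
Proof.
move=> eq_f; apply/lfunP => t; rewrite (tens_sum t) !linear_sum.
apply: eq_bigr => i _; rewrite !linear_sum; apply: eq_bigr => j _.
by rewrite !linearZ /= eq_f.
Qed.

Lemma tensf1 : tensf \1 \1 = \1%VF.
Proof. by apply: tens_eq => v w; rewrite tensfE !id_lfunE. Qed.

Lemma tensfM g h g' h' :
  tensf (g \o g') (h \o h') = (tensf g h \o tensf g' h')%VF.
Proof. by apply: tens_eq => v w; rewrite comp_lfunE !tensfE !comp_lfunE. Qed.

End Tensor.

Section ExternalTensor.

Variables (F : fieldType) (G H : groupType) (U : rep F G) (V : rep F H).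

Definition etens_act (x : G * H) : 'End(tens U V) :=
  tensf (rep_act U x.1) (rep_act V x.2).

Fact etens_act1 : etens_act 1%g = \1%VF.
Proof. by rewrite /etens_act !rep_act1 tensf1. Qed.

Fact etens_actM x y : etens_act (x * y)%g = (etens_act x \o etens_act y)%VF.
Proof. by rewrite /etens_act !rep_actM tensfM. Qed.

Definition etens_rep : rep F (G * H)%type :=
  Rep (tens U V) etens_act etens_act1 etens_actM.

End ExternalTensor.

(* Induction along [f : H -> G], as the space of [H]-equivariant functions
   [G -> U] under right translation. *)
Section Induction.

Variables (F : fieldType) (H G : finGroupType) (f : {multiplicative H -> G}).
Variable U : rep F H.

Definition equiv_defect h x (phi : {ffun G -> U}) : U :=
  phi (f h * x)%g - rep_act U h (phi x).

Fact equiv_defect_linear h x : linear (equiv_defect h x).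
Proof.
move=> a u v; rewrite /equiv_defect !ffunE linearP /=.
by rewrite scalerBr opprD addrACA.
Qed.
HB.instance Definition _ h x :=
  GRing.isLinear.Build F _ _ _ (equiv_defect h x) (equiv_defect_linear h x).

Definition ind_space : {vspace {ffun G -> U}} :=
  (\bigcap_(h : H) \bigcap_(x : G) lker (linfun (equiv_defect h x)))%VS.

Lemma ind_spaceP (phi : {ffun G -> U}) :
  reflect (forall h x, phi (f h * x)%g = rep_act U h (phi x))
          (phi \in ind_space).
Proof.
rewrite memvE; apply: (iffP subv_bigcapP) => [Dphi h x | Dphi h _].
  have /subv_bigcapP /(_ x isT) := Dphi h isT.
  by rewrite -memvE memv_ker lfunE subr_eq0 => /eqP.
apply/subv_bigcapP => x _.
by rewrite -memvE memv_ker lfunE subr_eq0; apply/eqP.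
Qed.

Definition transl (g : G) (phi : {ffun G -> U}) : {ffun G -> U} :=
  [ffun x => phi (x * g)%g].

Fact transl_linear g : linear (transl g).
Proof. by move=> a u v; apply/ffunP => x; rewrite !ffunE. Qed.
HB.instance Definition _ g :=
  GRing.isLinear.Build F _ _ _ (transl g) (transl_linear g).

Definition transl_act (g : G) : 'End({ffun G -> U}) := linfun (transl g).

Fact transl_act1 : transl_act 1%g = \1%VF.
Proof.
apply/lfunP => u; rewrite [LHS]lfunE id_lfunE; apply/ffunP => x.
by rewrite ffunE mulg1.
Qed.

Fact transl_actM g h : transl_act (g * h)%g = (transl_act g \o transl_act h)%VF.
Proof.
apply/lfunP => u; rewrite comp_lfunE !lfunE.
by apply/ffunP => x; rewrite !ffunE mulgA.
Qed.

Definition transl_rep : rep F G :=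
  Rep {ffun G -> U} transl_act transl_act1 transl_actM.

Fact ind_stable : @stable _ _ transl_rep ind_space.
Proof.
move=> g u /ind_spaceP Du; apply/ind_spaceP => h x.
by rewrite lfunE /= !ffunE -mulgA Du.
Qed.

Definition ind_rep : rep F G := sub_rep ind_stable.

End Induction.

Section GL.

Variables (F : fieldType) (V : vectType F).

Record GL := MkGL { glval :> 'End(V); glP : lker glval == 0%VS }.

HB.instance Definition _ := [isSub for glval].
HB.instance Definition _ := [Choice of GL by <:].

Fact gl_one_subproof : lker (\1%VF : 'End(V)) == 0%VS.
Proof. by apply/lker0P => u v; rewrite !id_lfunE. Qed.

Fact gl_mul_subproof (g h : GL) : lker (g \o h)%VF == 0%VS.
Proof.
apply/lker0P => u v; rewrite !comp_lfunE.
by move/(lker0P (glP g))/(lker0P (glP h)).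
Qed.

Fact gl_inv_subproof (g : GL) : lker (g^-1)%VF == 0%VS.
Proof. by apply/lker0P; apply: can_inj (lker0_lfunVK (glP g)). Qed.

Definition gl_one := MkGL gl_one_subproof.
Definition gl_mul g h := MkGL (gl_mul_subproof g h).
Definition gl_inv g := MkGL (gl_inv_subproof g).

Fact gl_mulA : associative gl_mul.
Proof. by move=> f g h; apply: val_inj; apply: comp_lfunA. Qed.
Fact gl_mul1g : left_id gl_one gl_mul.
Proof. by move=> g; apply: val_inj; apply: comp_lfun1l. Qed.
Fact gl_mulg1 : right_id gl_one gl_mul.
Proof. by move=> g; apply: val_inj; apply: comp_lfun1r. Qed.
Fact gl_mulVg : left_inverse gl_one gl_inv gl_mul.
Proof. by move=> g; apply: val_inj; apply: lker0_compVf (glP g). Qed.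
Fact gl_mulgV : right_inverse gl_one gl_inv gl_mul.
Proof. by move=> g; apply: val_inj; apply: lker0_compfV (glP g). Qed.

HB.instance Definition _ :=
  isGroup.Build GL gl_mulA gl_mul1g gl_mulg1 gl_mulVg gl_mulgV.

End GL.

Definition is_intpart (n : nat) (s : seq nat) :=
  [&& sorted geq s, 0%N \notin s & sumn s == n].

Record intpart (n : nat) := IntPart
  { intpart_val :> seq nat; intpartP : is_intpart n intpart_val }.

HB.instance Definition _ n := [isSub for @intpart_val n].
HB.instance Definition _ n := [Countable of intpart n by <:].

Definition intpart_enum n : seq (intpart n) :=
  undup (pmap insub [seq map val (val s) | s : {bseq n of 'I_n.+1}]).

Fact size_intpart n (la : intpart n) : (size la <= n)%N.
Proof.
case: la => s /= /and3P[_ s0 /eqP <-]; elim: s s0 => //= x s IHs.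
rewrite inE negb_or eq_sym -lt0n => /andP[x0 /IHs].
by rewrite -add1n; apply: leq_add.
Qed.

Fact part_le n (la : intpart n) x : x \in (la : seq nat) -> (x <= n)%N.
Proof.
case: la => s /= /and3P[_ _ /eqP <-]; elim: s => //= y s IHs.
rewrite inE => /orP[/eqP -> | /IHs]; first exact: leq_addr.
by move/leq_trans; apply; apply: leq_addl.
Qed.

Fact intpart_enumP n : Finite.axiom (intpart_enum n).
Proof.
move=> la; rewrite count_uniq_mem ?undup_uniq // mem_undup mem_pmap_sub.
suff -> : val la \in [seq map val (val s) | s : {bseq n of 'I_n.+1}] by [].
have sz : (size (map (@inord n) la) <= n)%N by rewrite size_map size_intpart.
apply/mapP; exists (Bseq sz); first by rewrite mem_enum.
rewrite /= -map_comp -[LHS]map_id; apply/eq_in_map => x xla.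
by rewrite /= inordK // ltnS (part_le xla).
Qed.

HB.instance Definition _ n := isFinite.Build (intpart n) (@intpart_enumP n).

Section GroupAlgebra.

Variables (F : fieldType) (G : finGroupType).

Local Notation galg := {ffun G -> F^o}.

Definition galg_elt (g : G) : galg := [ffun x => (x == g)%:R].

Definition galg_act (U : rep F G) (c : galg) : 'End(U) :=
  \sum_g c g *: rep_act U g.

Definition regular_fun (g : G) (c : galg) : galg := [ffun x => c (g^-1 * x)%g].

Fact regular_fun_linear g : linear (regular_fun g).
Proof. by move=> a u v; apply/ffunP => x; rewrite !ffunE. Qed.
HB.instance Definition _ g :=
  GRing.isLinear.Build F _ _ _ (regular_fun g) (regular_fun_linear g).

Definition regular_act (g : G) : 'End(galg) := linfun (regular_fun g).

Fact regular_act1 : regular_act 1%g = \1%VF.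
Proof.
apply/lfunP => u; rewrite [LHS]lfunE id_lfunE; apply/ffunP => x.
by rewrite ffunE invg1 mul1g.
Qed.

Fact regular_actM g h :
  regular_act (g * h)%g = (regular_act g \o regular_act h)%VF.
Proof.
apply/lfunP => u; rewrite comp_lfunE !lfunE; apply/ffunP => x.
by rewrite !ffunE invMg mulgA.
Qed.

Definition regular_rep : rep F G :=
  Rep galg regular_act regular_act1 regular_actM.

Lemma regular_elt g h :
  rep_act regular_rep g (galg_elt h) = galg_elt (g * h)%g.
Proof.
rewrite lfunE; apply/ffunP => x; rewrite !ffunE.
by rewrite -(inj_eq (mulgI g)) mulKVg.
Qed.

Definition cyclic_space (U : rep F G) (u : U) : {vspace U} :=
  <<[seq rep_act U g u | g : G]>>%VS.

Fact cyclic_stable (U : rep F G) (u : U) : stable (cyclic_space u).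
Proof.
move=> g v /(memv_img (rep_act U g)); rewrite limg_span; apply/subvP.
apply/span_subvP => _ /mapP[_ /mapP[h _ ->] ->]; apply: memv_span.
by apply/mapP; exists (g * h)%g; rewrite ?mem_enum // rep_actM comp_lfunE.
Qed.

Definition cyclic_rep (U : rep F G) (u : U) : rep F G :=
  sub_rep (@cyclic_stable U u).

End GroupAlgebra.

Section Specht.

Variables (F : fieldType) (n : nat) (la : intpart n).

(* The tableau of shape [la] filled row by row with 0, ..., n-1. *)
Definition tab_row (x : 'I_n) := reshape_index la x.
Definition tab_col (x : 'I_n) := reshape_offset la x.

Definition row_stab := [set s : 'S_n | [forall x, tab_row (s x) == tab_row x]].
Definition col_stab := [set s : 'S_n | [forall x, tab_col (s x) == tab_col x]].

(* In ['S_n], [q * p] is the map [p \o q]: this is Young's symmetrizer, i.e.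
   the row symmetrizer times the column antisymmetrizer when the group algebra
   is formed with respect to the composition of maps. *)
Definition young_symm : {ffun 'S_n -> F^o} :=
  \sum_(p in row_stab) \sum_(q in col_stab)
     (-1) ^+ odd_perm q *: galg_elt F (q * p)%g.

(* The left ideal generated by [young_symm], for MathComp's product. Under
   [s |-> s^-1], which exchanges MathComp's product and the composition of
   maps, it becomes the left ideal generated by (column antisymmetrizer) o
   (row symmetrizer), i.e. the span of the polytabloids of shape [la]. *)
Definition specht : rep F 'S_n :=
  @cyclic_rep F 'S_n (regular_rep F 'S_n) young_symm.

End Specht.

Section TensorPower.

Variables (F : fieldType) (V : vectType F) (n : nat).

Local Notation e := (vbasis {:V}).
Local Notation index := {ffun 'I_n -> 'I_(\dim {:V})}.

(* The [n]-th tensor power of [V], with the coordinate of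
   [e_(f 0) (x) ... (x) e_(f (n - 1))] at position [f]. *)
Definition tpow : vectType F := {ffun index -> F^o}.

Definition tpowv (v : 'I_n -> V) : tpow :=
  [ffun f : index => \prod_i coord e (f i) (v i)].

Lemma tpowv_sumZ (J : finType) (a : 'I_n -> J -> F) (v : 'I_n -> J -> V) :
  tpowv (fun i => \sum_j a i j *: v i j) =
  \sum_(f : {ffun 'I_n -> J}) (\prod_i a i (f i)) *: tpowv (fun i => v i (f i)).
Proof.
apply/ffunP => k; rewrite ffunE sum_ffunE.
under eq_bigr do rewrite linear_sum.
rewrite bigA_distr_bigA; apply: eq_bigr => f _.
rewrite !ffunE; apply: etrans (big_split _ _ _ _ _).
by apply: eq_bigr => i _; rewrite linearZ.
Qed.

Lemma tpow_sum (t : tpow) :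
  t = \sum_(f : index) t f *: tpowv (fun i => e`_(f i)).
Proof.
apply/ffunP => k; rewrite sum_ffunE (bigD1 k) //= big1 ?addr0 => [|f f'k].
  rewrite !ffunE big1 => [|i _]; first exact/esym/mulr1.
  by rewrite coord_free ?(basis_free (vbasisP _)) ?eqxx.
rewrite !ffunE; have [i f'ki] : exists i, f i != k i.
  apply/existsP; rewrite -negb_forall; apply: contra f'k => /forallP fk.
  by apply/eqP/ffunP => i; apply/eqP.
rewrite (bigD1 i) //= coord_free ?(basis_free (vbasisP _)) //.
by rewrite (negPf f'ki) mul0r scaler0.
Qed.

Definition tpow_fun (g : 'End(V)) (t : tpow) : tpow :=
  \sum_(f : index) t f *: tpowv (fun i => g e`_(f i)).

Fact tpow_fun_linear g : linear (tpow_fun g).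
Proof.
move=> a t u; rewrite /tpow_fun scaler_sumr -big_split; apply: eq_bigr => f _.
by rewrite !ffunE scalerDl scalerA.
Qed.
HB.instance Definition _ g :=
  GRing.isLinear.Build F _ _ _ (tpow_fun g) (tpow_fun_linear g).

Definition tpowf (g : 'End(V)) : 'End(tpow) := linfun (tpow_fun g).

Lemma tpowfE g v : tpowf g (tpowv v) = tpowv (fun i => g (v i)).
Proof.
rewrite lfunE /= /tpow_fun; transitivity
  (tpowv (fun i => \sum_j coord e j (v i) *: g e`_j)).
  by rewrite tpowv_sumZ; apply: eq_bigr => f _; rewrite ffunE.
congr tpowv; apply/funext => i; rewrite [in RHS](coord_vbasis (memvf (v i))).
by rewrite linear_sum; apply: eq_bigr => j _; rewrite linearZ.
Qed.

Lemma tpow_eq (f f' : 'End(tpow)) :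
  (forall v, f (tpowv v) = f' (tpowv v)) -> f = f'.
Proof.
move=> eq_f; apply/lfunP => t; rewrite (tpow_sum t) !linear_sum.
by apply: eq_bigr => i _; rewrite !linearZ /= eq_f.
Qed.

Definition gl_tpow_act (g : GL V) : 'End(tpow) := tpowf g.

Fact gl_tpow_act1 : gl_tpow_act 1%g = \1%VF.
Proof.
apply: tpow_eq => v; rewrite tpowfE id_lfunE; congr tpowv.
by apply/funext => i; rewrite id_lfunE.
Qed.

Fact gl_tpow_actM g h :
  gl_tpow_act (g * h)%g = (gl_tpow_act g \o gl_tpow_act h)%VF.
Proof.
apply: tpow_eq => v; rewrite comp_lfunE !tpowfE; congr tpowv.
by apply/funext => i; rewrite comp_lfunE.
Qed.

Definition gl_tpow_rep : rep F (GL V) :=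
  Rep tpow gl_tpow_act gl_tpow_act1 gl_tpow_actM.

Definition perm_fun (s : 'S_n) (t : tpow) : tpow :=
  [ffun f : index => t [ffun i => f ((s^-1)%g i)]].

Fact perm_fun_linear s : linear (perm_fun s).
Proof. by move=> a u v; apply/ffunP => x; rewrite !ffunE. Qed.
HB.instance Definition _ s :=
  GRing.isLinear.Build F _ _ _ (perm_fun s) (perm_fun_linear s).

Definition perm_tpow_act (s : 'S_n) : 'End(tpow) := linfun (perm_fun s).

Lemma perm_tpow_actE s v : perm_tpow_act s (tpowv v) = tpowv (fun i => v (s i)).
Proof.
rewrite lfunE; apply/ffunP => f; rewrite !ffunE (reindex_inj (@perm_inj _ s)).
by apply: eq_bigr => i _; rewrite ffunE permK.
Qed.

Fact perm_tpow_act1 : perm_tpow_act 1%g = \1%VF.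
Proof.
apply: tpow_eq => v; rewrite perm_tpow_actE id_lfunE; congr tpowv.
by apply/funext => i; rewrite perm1.
Qed.

Fact perm_tpow_actM s t :
  perm_tpow_act (s * t)%g = (perm_tpow_act s \o perm_tpow_act t)%VF.
Proof.
apply: tpow_eq => v; rewrite comp_lfunE !perm_tpow_actE; congr tpowv.
by apply/funext => i; rewrite permM.
Qed.

Definition perm_tpow_rep : rep F 'S_n :=
  Rep tpow perm_tpow_act perm_tpow_act1 perm_tpow_actM.

Lemma gl_perm_comm g s :
  (gl_tpow_act g \o perm_tpow_act s = perm_tpow_act s \o gl_tpow_act g)%VF.
Proof.
apply: tpow_eq => v.
by rewrite !comp_lfunE perm_tpow_actE !tpowfE perm_tpow_actE.
Qed.

Variable la : intpart n.

(* Weyl's construction: the image of Young's symmetrizer. *)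
Definition schur_space : {vspace tpow} :=
  limg (galg_act perm_tpow_rep (young_symm F la)).

Fact schur_stable : @stable _ _ gl_tpow_rep schur_space.
Proof.
move=> g _ /memv_imgP[t _ ->]; apply/memv_imgP; exists (gl_tpow_act g t).
  exact: memvf.
rewrite !sum_lfunE linear_sum; apply: eq_bigr => s _.
by rewrite !scale_lfunE linearZ /= -!comp_lfunE gl_perm_comm.
Qed.

Definition schur : rep F (GL V) := sub_rep schur_stable.

End TensorPower.

Section StandardEmbedding.

Local Open Scope nat_scope.

Variables a b : nat.

Definition perm_sum_fun (s : 'S_a) (t : 'S_b) (x : 'I_(a + b)) : 'I_(a + b) :=
  match fintype.split x with
  | inl i => lshift b (s i)
  | inr j => rshift a (t j)
  end.

Fact perm_sum_inj s t : injective (perm_sum_fun s t).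
Proof.
move=> x y; rewrite /perm_sum_fun.
case: (split_ordP x) => i ->; case: (split_ordP y) => j -> /eqP;
  rewrite ?eq_lshift ?eq_rshift ?eq_lrshift ?eq_rlshift // => /eqP.
  by move/perm_inj => ->.
by move/perm_inj => ->.
Qed.

Definition perm_sum (st : 'S_a * 'S_b) : 'S_(a + b) :=
  perm (@perm_sum_inj st.1 st.2).

Fact perm_sumM : {morph perm_sum : x y / (x * y)%g}.
Proof.
move=> x y; apply/permP => i; rewrite permM !permE /perm_sum_fun.
case: (split_ordP i) => j _.
  by rewrite (unsplitK (inl _)) permM.
by rewrite (unsplitK (inr _)) permM.
Qed.

Variables (n : nat) (e : a + b = n).

Definition iota_emb (st : 'S_a * 'S_b) : 'S_n := cast_perm e (perm_sum st).

Fact iota_embM : {morph iota_emb : x y / (x * y)%g}.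
Proof.
by move=> x y; rewrite /iota_emb perm_sumM; case: _ / e; rewrite !cast_perm_id.
Qed.

End StandardEmbedding.

Section HeisenbergProduct.

Local Open Scope nat_scope.

Variables (F : fieldType) (k l i : nat).
Hypothesis kli : maxn k l <= i <= k + l.

Fact heis_eqk : (i - l) + (k + l - i) = k.
Proof.
have /andP[] := kli; rewrite geq_max => /andP[_ li] ikl.
by rewrite addnC addnBA // subnK // addnK.
Qed.

Fact heis_eql : (k + l - i) + (i - k) = l.
Proof.
have /andP[] := kli; rewrite geq_max => /andP[ki _] ikl.
by rewrite addnBA // subnK // addKn.
Qed.

Fact heis_eqi : (i - l) + l = i.
Proof. by have /andP[] := kli; rewrite geq_max => /andP[_ /subnK]. Qed.

Local Notation H := ('S_(i - l) * 'S_(k + l - i) * 'S_(i - k))%type.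

Definition heis_to_kl (h : H) : 'S_k * 'S_l :=
  let: (s, t, r) := h in
  (iota_emb heis_eqk (s, t), iota_emb heis_eql (t, r)).

Definition heis_to_i (h : H) : 'S_i :=
  let: (s, t, r) := h in
  iota_emb heis_eqi (s, iota_emb heis_eql (t, r)).

Fact heis_to_klM : {morph heis_to_kl : x y / (x * y)%g}.
Proof.
by move=> [[s t] r] [[s' t'] r']; congr (_, _);
  apply: (iota_embM _ (_, _) (_, _)).
Qed.
HB.instance Definition _ :=
  isMultiplicative.Build H ('S_k * 'S_l)%type heis_to_kl heis_to_klM.

Fact heis_to_iM : {morph heis_to_i : x y / (x * y)%g}.
Proof.
move=> [[s t] r] [[s' t'] r']; apply: etrans (iota_embM _ (_, _) (_, _)).
by congr (iota_emb _ (_, _)); apply: (iota_embM _ (_, _) (_, _)).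
Qed.
HB.instance Definition _ :=
  isMultiplicative.Build H 'S_i heis_to_i heis_to_iM.

Definition heisenberg (V : rep F 'S_k) (W : rep F 'S_l) : rep F 'S_i :=
  @ind_rep F H 'S_i heis_to_i (res_rep heis_to_kl (etens_rep V W)).

End HeisenbergProduct.

Section Aguiar.

Local Open Scope nat_scope.

Variable F : fieldType.

Definition is_mult (i : nat) (U : rep F 'S_i) (m : {ffun intpart i -> nat}) :=
  rep_iso U (\bigoplus_nu \bigoplus_(j < m nu) specht F nu)%rep.

Definition specht_mult (i : nat) (U : rep F 'S_i) : {ffun intpart i -> nat} :=
  xget [ffun=> 0%N] [set m | is_mult U m]%classic.

Definition aguiar (k l i : nat) (la : intpart k) (mu : intpart l)
    (nu : intpart i) : nat :=
  match @idP (maxn k l <= i <= k + l) with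
  | ReflectT kli =>
      specht_mult (heisenberg kli (specht F la) (specht F mu)) nu
  | ReflectF _ => 0
  end.

Lemma aguiar_out k l i (la : intpart k) (mu : intpart l) (nu : intpart i) :
  ~~ (maxn k l <= i <= k + l) -> aguiar la mu nu = 0%N.
Proof. by rewrite /aguiar; case: {-}_ / idP => // kli; rewrite kli. Qed.

(* Hence in a direct sum over all pairs [(la, mu)] with multiplicities
   [aguiar la mu nu], only the sizes [k, l <= i] contribute. *)
Lemma aguiar_neq0 k l i (la : intpart k) (mu : intpart l) (nu : intpart i) :
  aguiar la mu nu != 0 -> (k <= i) && (l <= i).
Proof.
rewrite -geq_max; apply: contra_neqT => ki.
by rewrite aguiar_out // negb_and ki.
Qed.

End Aguiar.

Section Phi.

Variables (F : fieldType) (V1 V2 : vectType F).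

Definition Vhat : vectType F := (V1 * tens V1 V2 * V2)%type.

Definition phi_fun (g1 : GL V1) (g2 : GL V2) (u : Vhat) : Vhat :=
  (g1 u.1.1, tensf g1 g2 u.1.2, g2 u.2).

Fact phi_fun_linear g1 g2 : linear (phi_fun g1 g2).
Proof. by move=> a u v; rewrite /phi_fun !linearP. Qed.
HB.instance Definition _ g1 g2 :=
  GRing.isLinear.Build F _ _ _ (phi_fun g1 g2) (phi_fun_linear g1 g2).

Fact phi_subproof (g : GL V1 * GL V2) :
  lker (linfun (phi_fun g.1 g.2)) == 0%VS.
Proof.
have tensVf: cancel (tensf g.1 g.2) (tensf (g.1^-1)%VF (g.2^-1)%VF).
  move=> t; rewrite -comp_lfunE -tensfM.
  by rewrite !(lker0_compVf (glP _)) tensf1 id_lfunE.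
apply/lker0P => -[[u t] v] [[u' t'] v']; rewrite !lfunE => -[].
by move=> /(lker0P (glP _)) -> /(can_inj tensVf) -> /(lker0P (glP _)) ->.
Qed.

Definition phi (g : GL V1 * GL V2) : GL Vhat := MkGL (phi_subproof g).

Lemma phiE g1 g2 (u1 : V1) m (v : 'I_m -> V1) (w : 'I_m -> V2) (u2 : V2) :
  phi (g1, g2) (u1, \sum_i tensv (v i) (w i), u2) =
  (g1 u1, \sum_i tensv (g1 (v i)) (g2 (w i)), g2 u2).
Proof.
rewrite lfunE /= /phi_fun; congr (_, _, _).
by rewrite linear_sum; apply: eq_bigr => i _; apply: tensfE.
Qed.

Fact phiM : {morph phi : g h / (g * h)%g}.
Proof.
move=> g h; apply: val_inj; apply/lfunP => -[[u t] v].
rewrite /= comp_lfunE !lfunE /= /phi_fun /=.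
by rewrite tensfM !comp_lfunE.
Qed.
HB.instance Definition _ :=
  isMultiplicative.Build (GL V1 * GL V2)%type (GL Vhat) phi phiM.

End Phi.

(* Main.v *)
Require Import Defs.
From HB Require Import structures.
From mathcomp Require Import all_boot all_order all_algebra all_fingroup.
From mathcomp Require Import boolp reals complex zify.
From mathcomp Require classical_sets.

(** The Schur functor [schur V nu] is the image of the Young symmetrizer [c nu] on
    the [n]-th tensor power of [V]. For any representation [X] of the symmetric
    group, the image of [c nu] on [X] is the multiplicity space of [specht nu] in
    [X]: it has one dimension for each copy of [specht nu], and depends
    functorially on [X]. So the theorem amounts to a decomposition of the tensor
    power of the total space [V = V1 + V1 (x) V2 + V2] under the commuting actions
    of the symmetric group and of [GL V1 * GL V2].

    Expand the tensor power into words of length [n] in the three summands, and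
    group the words according to the number [k] of letters involving [V1] and the
    number [l] of letters involving [V2]. A permutation makes the first [k] letters
    involve [V1] and the last [l] ones involve [V2]; such standard words span a copy
    of the product of the [k]-th tensor power of [V1] and the [l]-th one of [V2],
    stable under the subgroup by which the Heisenberg product is defined. The part
    of bidegree [(k, l)] is therefore the representation induced from this product
    ([word_proj], [to_from_ind]), that is, the Heisenberg product of the two
    tensor powers. By Schur-Weyl duality the [k]-th tensor power of [V1] is the sum
    over [la] of [specht la (x) schur V1 la], and similarly for [V2]; so the part of
    bidegree [(k, l)] is the sum over [la] and [mu] of the Heisenberg product of
    [specht la] and [specht mu], tensored with [schur V1 la (x) schur V2 mu]
    ([sum_heis]). Its image under [c nu] contains [schur V1 la (x) schur V2 mu] as
    many times as [specht nu] occurs in this Heisenberg product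
    ([pairing_retract], [specht_multE]), which is the Aguiar coefficient. When
    [la] has more parts than [V1] has dimensions, [c la] kills the tensor power
    ([young_tpow_eq0]).

    The representation theory of the symmetric group that is used reduces to three
    properties of the symmetrizers: [c la * z * c la] is a multiple of [c la]
    ([young_sandwich]), [c la * z * c mu] vanishes for distinct shapes
    ([young_orth]), and the square of [c la] is nonzero ([young_norm_neq0]). They
    make the conjugation averages of the symmetrizers linearly independent class
    functions. There being no more conjugacy classes than partitions, these
    averages span the class functions; writing [1] as their combination
    ([young_complete]) gives explicit mutually inverse maps between any
    representation [X] and the sum over [la] of [specht la] tensored with the
    image of [c la] on [X] ([unspin_spin], [sum_spin_unspin]).

    All the decompositions are given by orthogonal idempotents of the tensor power
    which add up to the projection onto [schur V nu], and the isomorphism with the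
    iterated direct sum follows from [retract_sum] and [retract_iso]. *)

Set Implicit Arguments.
Unset Strict Implicit.
Unset Printing Implicit Defensive.

Import Order.TTheory GRing.Theory Num.Theory.

Local Open Scope ring_scope.

(** * The group algebra and its action *)

Section GroupAlgebraRing.

Variables (F : fieldType) (G : finGroupType).

(** A copy of [{ffun G -> F^o}] carrying convolution instead of the pointwise
    product. *)
Definition galg : Type := {ffun G -> F^o}.

HB.instance Definition _ := Vector.on galg.

Implicit Types x y z : galg.

Definition gmul x y : galg := [ffun g => \sum_h x h * y (h^-1 * g)%g].

Definition gone : galg := galg_elt F 1%g.

Fact gmulA : associative gmul.
Proof.
move=> x y z; apply/ffunP => g; rewrite !ffunE.
under eq_bigr do rewrite ffunE mulr_sumr.
under [RHS]eq_bigr do rewrite ffunE mulr_suml.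
rewrite [RHS]exchange_big /=; apply: eq_bigr => h _.
rewrite [RHS](reindex_inj (mulgI h)) /=; apply: eq_bigr => k _.
by rewrite mulKg mulrA invMg mulgA.
Qed.

Fact gmul1x : left_id gone gmul.
Proof.
move=> x; apply/ffunP => g; rewrite !ffunE (bigD1 1%g) //= big1.
  by rewrite !ffunE eqxx invg1 !mul1g addr0 mul1r.
by move=> h /negPf h1; rewrite ffunE h1 mul0r.
Qed.

Fact gmulx1 : right_id gone gmul.
Proof.
move=> x; apply/ffunP => g; rewrite !ffunE (bigD1 g) //= big1.
  by rewrite !ffunE mulVg eqxx addr0 mulr1.
move=> h h1; rewrite ffunE -eq_mulVg1 (negPf h1) mulr0 //.
Qed.

Fact gmulDl : left_distributive gmul +%R.
Proof.
move=> x y z; apply/ffunP => g; rewrite !ffunE -big_split /=.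
by apply: eq_bigr => h _; rewrite ffunE mulrDl.
Qed.

Fact gmulDr : right_distributive gmul +%R.
Proof.
move=> x y z; apply/ffunP => g; rewrite !ffunE -big_split /=.
by apply: eq_bigr => h _; rewrite ffunE mulrDr.
Qed.

Fact gone_neq0 : gone != 0.
Proof.
apply/eqP => /ffunP /(_ 1%g); rewrite !ffunE eqxx => /eqP.
by rewrite oner_eq0.
Qed.

HB.instance Definition _ := GRing.Zmodule_isNzRing.Build galg
  gmulA gmul1x gmulx1 gmulDl gmulDr gone_neq0.

Fact gscaleAl (k : F) x y : k *: (x * y) = (k *: x) * y.
Proof.
apply/ffunP => g; rewrite !ffunE scaler_sumr.
by apply: eq_bigr => h _; rewrite ffunE scalerAl.
Qed.

HB.instance Definition _ := GRing.Lmodule_isLalgebra.Build F galg gscaleAl.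

Fact gscaleAr (k : F) x y : k *: (x * y) = x * (k *: y).
Proof.
apply/ffunP => g; rewrite !ffunE scaler_sumr.
by apply: eq_bigr => h _; rewrite ffunE scalerAr.
Qed.

HB.instance Definition _ := GRing.Lalgebra_isAlgebra.Build F galg gscaleAr.

Definition gelt (g : G) : galg := galg_elt F g.

Lemma gelt1 : gelt 1%g = 1. Proof. by []. Qed.

Lemma gmul_eltl g x h : (gelt g * x) h = x (g^-1 * h)%g.
Proof.
rewrite ffunE (bigD1 g) //= big1 => [|k /negPf k'g]; rewrite ffunE ?eqxx.
  by rewrite mul1r addr0.
by rewrite k'g mul0r.
Qed.

Lemma gmul_eltr g x h : (x * gelt g) h = x (h * g^-1)%g.
Proof.
rewrite ffunE (bigD1 (h * g^-1)%g) //= big1 => [|k k'g]; rewrite ffunE.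
  by rewrite invMg invgK -mulgA mulVg mulg1 eqxx mulr1 addr0.
rewrite (_ : _ == g = false) ?mulr0 //; apply: contraNF k'g => /eqP <-.
by rewrite invMg invgK mulKVg.
Qed.

Lemma geltM g h : gelt (g * h)%g = gelt g * gelt h.
Proof.
apply/ffunP => k; rewrite gmul_eltl !ffunE.
by rewrite -[in RHS](inj_eq (mulgI g)) mulKVg.
Qed.

Lemma galg_sum x : x = \sum_g x g *: gelt g.
Proof.
apply/ffunP => h; rewrite sum_ffunE (bigD1 h) //= big1 => [|g /negPf g'h].
  by rewrite !ffunE eqxx addr0 [RHS]mulr1.
by rewrite !ffunE eq_sym g'h scaler0.
Qed.

Lemma gmul_suml x z : x * z = \sum_g x g *: (gelt g * z).
Proof.
rewrite {1}(galg_sum x) mulr_suml; apply: eq_bigr => g _.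
by rewrite -scalerAl.
Qed.

Lemma gmul_sumr x z : z * x = \sum_g x g *: (z * gelt g).
Proof.
rewrite {1}(galg_sum x) mulr_sumr; apply: eq_bigr => g _.
by rewrite -scalerAr.
Qed.

Lemma gmul_sum x y z : x * y * z = \sum_g y g *: (x * gelt g * z).
Proof.
rewrite {1}(galg_sum y) mulr_sumr mulr_suml; apply: eq_bigr => g _.
by rewrite -scalerAr -scalerAl.
Qed.

Section Action.

Variable U : rep F G.

Fact galg_act_linear : linear (galg_act U : galg -> 'End(U)).
Proof.
move=> a x y; rewrite /galg_act scaler_sumr -big_split /=.
by apply: eq_bigr => g _; rewrite !ffunE scalerDl scalerA.
Qed.
HB.instance Definition _ := GRing.isLinear.Build F galg 'End(U) _
  (galg_act U : galg -> 'End(U)) galg_act_linear.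

Lemma galg_actE x u : galg_act U x u = \sum_g x g *: rep_act U g u.
Proof.
by rewrite sum_lfunE; apply: eq_bigr => g _; rewrite scale_lfunE.
Qed.

Lemma galg_act_elt g : galg_act U (gelt g) = rep_act U g.
Proof.
rewrite /galg_act (bigD1 g) //= big1 => [|h /negPf h'g]; rewrite ffunE.
  by rewrite eqxx scale1r addr0.
by rewrite h'g scale0r.
Qed.

Lemma galg_act1 : galg_act U (1 : galg) = \1%VF.
Proof. by rewrite -gelt1 galg_act_elt rep_act1. Qed.

Lemma galg_actM x y u :
  galg_act U (x * y) u = galg_act U x (galg_act U y u).
Proof.
have actMl g : galg_act U (gelt g * y) u = rep_act U g (galg_act U y u).
  rewrite !galg_actE linear_sum (reindex_inj (mulgI g)) /=.
  apply: eq_bigr => h _; rewrite linearZ /= gmul_eltl mulKg.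
  by rewrite rep_actM comp_lfunE.
rewrite [in LHS](galg_sum x) mulr_suml linear_sum sum_lfunE galg_actE.
by apply: eq_bigr => g _; rewrite -scalerAl linearZ /= scale_lfunE actMl.
Qed.

End Action.

Lemma galg_act_comm (U V : rep F G) (f : 'Hom(U, V)) x u :
  (forall g u, f (rep_act U g u) = rep_act V g (f u)) ->
  f (galg_act U x u) = galg_act V x (f u).
Proof.
move=> fG; rewrite !galg_actE linear_sum.
by apply: eq_bigr => g _; rewrite linearZ /= fG.
Qed.


Lemma galg_regular x y : galg_act (regular_rep F G) x y = x * y.
Proof.
rewrite galg_actE [in RHS](galg_sum x) mulr_suml; apply: eq_bigr => g _.
rewrite -scalerAl; congr (_ *: _); apply/ffunP => h.
by rewrite gmul_eltl lfunE /= ffunE.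
Qed.

End GroupAlgebraRing.

Section Retracts.

Variables (F : fieldType) (G : groupType).
Implicit Types U X Y : rep F G.

(** A way to assemble direct sum decompositions: representations that are
    retracts of [U] for the same idempotent [e] are isomorphic, and orthogonal
    idempotents add up to direct sums. The retraction is only required to be
    linear: for an idempotent with equivariant inclusion this is enough to
    identify [X] with the image of [e]. *)
Definition retract U (e : 'End(U)) X :=
  exists i : 'Hom(X, U), exists p : 'Hom(U, X),
    [/\ forall g x, i (rep_act X g x) = rep_act U g (i x),
        forall x, p (i x) = x & forall u, i (p u) = e u].

Lemma retract_iso U (e : 'End(U)) X Y :
  retract e X -> retract e Y -> rep_iso X Y.
Proof.
move=> [i [p [iG pi ip]]] [j [q [jG qj jq]]].
have ee u : e (e u) = e u by rewrite -(ip u) -ip pi.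
have jqi x : j (q (i x)) = i x by rewrite jq -ip pi.
have ipj y : i (p (j y)) = j y by rewrite ip -jq qj.
exists (q \o i)%VF => [|g u].
  exists (p \o j)%VF => x; rewrite !comp_lfunE.
    by rewrite jqi pi.
  by rewrite ipj qj.
rewrite !comp_lfunE -[RHS]qj jG jqi.
by rewrite -iG.
Qed.

Lemma retract_zero U : retract (0 : 'End(U)) zero_rep.
Proof.
exists 0, 0; split=> [g x | x | u]; rewrite !zero_lfunE //.
  by rewrite linear0.
by apply/rowP => -[].
Qed.

Definition pair_in U X Y (i : 'Hom(X, U)) (j : 'Hom(Y, U)) (x : X * Y) : U :=
  i x.1 + j x.2.

Fact pair_in_linear U X Y i j : linear (@pair_in U X Y i j).
Proof.
by move=> a x y; rewrite /pair_in !linearP /= scalerDr addrACA.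
Qed.
HB.instance Definition _ U X Y i j :=
  GRing.isLinear.Build F _ _ _ (@pair_in U X Y i j) (pair_in_linear i j).

Definition pair_out U X Y (p : 'Hom(U, X)) (q : 'Hom(U, Y)) (u : U) :
  (X * Y)%type := (p u, q u).

Fact pair_out_linear U X Y p q : linear (@pair_out U X Y p q).
Proof. by move=> a x y; rewrite /pair_out !linearP. Qed.
HB.instance Definition _ U X Y p q :=
  GRing.isLinear.Build F _ _ _ (@pair_out U X Y p q) (pair_out_linear p q).

Lemma retract_dsum U (e f : 'End(U)) X Y :
    (forall u, e (f u) = 0) -> (forall u, f (e u) = 0) ->
  retract e X -> retract f Y -> retract (e + f) (dsum_rep X Y).
Proof.
move=> ef fe [i [p [iG pi ip]]] [j [q [jG qj jq]]].
have pj y : p (j y) = 0.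
  by rewrite -[LHS]pi ip -(qj y) jq ef linear0.
have qi x : q (i x) = 0.
  by rewrite -[LHS]qj jq -(pi x) ip fe linear0.
exists (linfun (pair_in i j)), (linfun (pair_out p q)); split.
- move=> g [x y]; rewrite !lfunE /= /pair_in /= iG jG.
  by rewrite linearD.
- move=> [x y]; rewrite !lfunE /= /pair_out /pair_in /= !linearD /=.
  by rewrite pi qj pj qi addr0 add0r.
- by move=> u; rewrite !lfunE /= /pair_in /= ip jq.
Qed.

Lemma retract_sum U (I : finType) (P : pred I) (e : I -> 'End(U))
    (X : I -> rep F G) :
    (forall i j u, P i -> P j -> i != j -> e i (e j u) = 0) ->
    (forall i, P i -> retract (e i) (X i)) ->
  retract (\sum_(i | P i) e i) (\bigoplus_(i | P i) X i)%rep.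
Proof.
move=> e_orth eX; elim: (index_enum I) (index_enum_uniq I) => [_ | i r IHr].
  by rewrite !big_nil; apply: retract_zero.
case/andP=> r'i /IHr {}IHr; rewrite !big_cons; case: ifP => // Pi.
have r_i j : j \in r -> (j != i) * (i != j).
  by move=> rj; rewrite (eq_sym i); suff -> : j != i by [];
    apply: contraNneq r'i => <-.
apply: retract_dsum (eX i Pi) IHr => u; rewrite sum_lfunE ?linear_sum.
  rewrite big_seq_cond big1 // => j /andP[rj Pj].
  by apply: e_orth => //; rewrite r_i.
rewrite big_seq_cond big1 // => j /andP[rj Pj].
by apply: e_orth => //; rewrite r_i.
Qed.

End Retracts.

(** * Tableaux *)

Section Tableau.

Variables (n : nat).
Implicit Types (la mu : intpart n) (x y : 'I_n).

Lemma sumn_intpart la : sumn la = n.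
Proof. by case: la => s /= /and3P[_ _ /eqP]. Qed.

Lemma ltn_sumn_intpart la x : (x < sumn la)%N.
Proof. by rewrite sumn_intpart. Qed.

Lemma tab_row_lt_size la x : (tab_row la x < size la)%N.
Proof. exact/reshape_indexP/ltn_sumn_intpart. Qed.

Lemma tab_colP la x : (tab_col la x < nth 0%N la (tab_row la x))%N.
Proof. exact/reshape_offsetP/ltn_sumn_intpart. Qed.

Lemma tab_cell la r c :
  (c < nth 0 la r)%N -> exists2 x, tab_row la x = r & tab_col la x = c.
Proof.
move=> c_lt; have x_lt := flatten_indexP c_lt; rewrite sumn_intpart in x_lt.
exists (Ordinal x_lt); first exact: flatten_indexKl.
exact: flatten_indexKr.
Qed.

Lemma tab_inj la x y :
  tab_row la x = tab_row la y -> tab_col la x = tab_col la y -> x = y.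
Proof.
move=> eq_r eq_c; apply/val_inj; rewrite /= -(reshape_indexK la x).
by rewrite -(reshape_indexK la y); congr flatten_index.
Qed.

Lemma nth_intpart_geq la i j : (i <= j)%N -> (nth 0 la j <= nth 0 la i)%N.
Proof.
case: la => s /= /and3P[s_sorted _ _] ij.
have [j_s | s_j] := ltnP j (size s); last by rewrite nth_default.
have geq_trans : transitive geq by move=> a b c ba ca; apply: leq_trans ca ba.
apply: (sorted_leq_nth geq_trans _ 0%N s_sorted) => //.
  by move=> ?; apply: leqnn.
exact: leq_ltn_trans j_s.
Qed.

Lemma nth_intpart_le la i : (nth 0 la i <= n)%N.
Proof.
have [i_s | s_i] := ltnP i (size la); last by rewrite nth_default.
exact/part_le/mem_nth.
Qed.

Fact tab_row_lt la x : (tab_row la x < n)%N.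
Proof. exact: leq_trans (tab_row_lt_size la x) (size_intpart la). Qed.

Fact tab_col_lt la x : (tab_col la x < n)%N.
Proof. exact: leq_trans (tab_colP la x) (nth_intpart_le la _). Qed.

Definition rowO la x := Ordinal (tab_row_lt la x).
Definition colO la x := Ordinal (tab_col_lt la x).

Lemma intpart_eq la mu : (forall i, nth 0 la i = nth 0 mu i)%N -> la = mu.
Proof.
move=> eq_lm; apply/val_inj => /=.
have nz (s : intpart n) i : (nth 0 s i == 0)%N = (size s <= i)%N.
  have [i_s | s_i] := ltnP i (size s); last by rewrite nth_default.
  case: s i_s => s /= /and3P[_ s0 _] i_s.
  by apply: contraNF s0 => /eqP <-; apply: mem_nth.
apply: (@eq_from_nth _ 0%N) => [|i _]; last exact: eq_lm.
by apply/eqP; rewrite eqn_leq -!nz eq_lm nz leqnn -eq_lm nz leqnn.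
Qed.

Lemma card_tab_row la r : #|[pred x | tab_row la x == r]| = nth 0%N la r.
Proof.
have cell (c : 'I_(nth 0%N la r)) :
    {x | (tab_row la x == r) && (tab_col la x == c)}.
  apply/sigW; have [x x_r x_c] := tab_cell (ltn_ord c).
  by exists x; rewrite x_r x_c !eqxx.
have cellP c : tab_row la (sval (cell c)) = r /\ tab_col la (sval (cell c)) = c.
  by case: (cell c) => x /= /andP[/eqP ? /eqP ?].
rewrite -[RHS]card_ord -(card_image (f := fun c => sval (cell c))).
  apply: eq_card => x; rewrite inE; apply/eqP/imageP => [x_r | [c _ ->]].
    have x_c : (tab_col la x < nth 0 la r)%N by rewrite -x_r tab_colP.
    exists (Ordinal x_c) => //; apply: (tab_inj (la := la)).
      by rewrite (cellP _).1.
    by rewrite (cellP _).2.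
  exact: (cellP c).1.
move=> c d eq_cd; apply/val_inj; rewrite /= -(cellP c).2 -(cellP d).2.
by rewrite eq_cd.
Qed.

(** Among the sets of a given cardinal, the initial segments have the least
    sum: exchanging the elements of [A] outside the initial segment [B] for
    the missing elements of [B] decreases each of them. *)
Lemma sum_initial_segment N (A B : {set 'I_N}) :
    #|A| = #|B| -> (forall a b, a \notin B -> b \in B -> b < a)%N ->
  (\sum_(b in B) b + #|A :\: B| <= \sum_(a in A) a)%N.
Proof.
move=> AB ltB; have eq_card : #|B :\: A| = #|A :\: B|.
  by apply/eqP; rewrite -(eqn_add2l #|A :&: B|) cardsID setIC cardsID AB.
rewrite (big_setID A) [leqRHS](big_setID B) /= setIC -addnA leq_add2l.
set D := A :\: B in eq_card *; set E := B :\: A in eq_card *.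
have [D0 | D_gt0] := posnP #|D|.
  by move: eq_card; rewrite D0 => /cards0_eq ->; rewrite big_set0.
have -> : (\sum_(b in E) b + #|D| = \sum_(b in E) b.+1)%N.
  by rewrite -eq_card -sum1_card -big_split; apply: eq_bigr => b _;
    apply: addn1.
rewrite -(leq_pmul2l D_gt0) -[in leqRHS]eq_card -!sum_nat_const.
rewrite [leqRHS]exchange_big /=.
apply: leq_sum => a /setDP[_ aB]; apply: leq_sum => b /setDP[bB _].
exact: ltB.
Qed.

Definition row_weight la := (\sum_x tab_row la x)%N.

Section Match.

Variables (la mu : intpart n) (w : 'S_n).

Hypothesis w_rows : forall x y, x != y -> tab_row la x = tab_row la y ->
  tab_col mu (w x) != tab_col mu (w y).

Hypothesis le_weight : (row_weight la <= row_weight mu)%N.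

(** The cells sent by [w] to a column of [mu] lie in distinct rows of [la], as
    many as there are cells in that column; the sum of these rows is least when
    they are the rows of the column. Summing over the columns, [le_weight]
    forces equality everywhere. *)
Lemma match_in_shape x : (tab_col mu (w x) < nth 0 mu (tab_row la x))%N.
Proof.
pose N (j : 'I_n) := [set x | colO mu (w x) == j].
pose M (j : 'I_n) := [set y | colO mu y == j].
pose A j := [set rowO la x | x in N j]; pose B j := [set rowO mu y | y in M j].
have injA j : {in N j &, injective (rowO la)}.
  move=> y z; rewrite !inE => /eqP /(congr1 val) /= yj /eqP /(congr1 val) /= zj
    [eq_r].
  apply: contraTeq isT => /w_rows /(_ eq_r); by rewrite yj zj eqxx.
have injB j : {in M j &, injective (rowO mu)}.
  move=> y z; rewrite !inE => /eqP /(congr1 val) /= yj /eqP /(congr1 val) /= zj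
    [eq_r].
  by apply: tab_inj eq_r _; rewrite yj zj.
have memB j i : (i \in B j) = (j < nth 0 mu i)%N.
  apply/imsetP/idP => [[y] | ji].
    by rewrite inE => /eqP <- ->; apply: tab_colP.
  have [y y_i y_j] := tab_cell ji.
  by exists y; rewrite ?inE; [apply/eqP|]; apply: val_inj.
have cardAB j : #|A j| = #|B j|.
  rewrite !card_in_imset //; rewrite -(card_imset (N j) (@perm_inj _ w)).
  apply: eq_card => y; apply/imsetP/idP => [[z] | yj].
    by rewrite !inE => zj ->.
  by exists (w^-1 y)%g; rewrite ?permKV // !inE permKV; rewrite inE in yj.
have leAB j : (\sum_(i in B j) i + #|A j :\: B j| <= \sum_(i in A j) i)%N.
  apply: sum_initial_segment => // a b; rewrite !memB -leqNgt => aj bj.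
  by rewrite ltnNge; apply: contraL bj => /(@nth_intpart_geq mu); lia.
have sumA : row_weight la = (\sum_j \sum_(i in A j) i)%N.
  rewrite /row_weight (partition_big (fun x => colO mu (w x)) predT) //=.
  apply: eq_bigr => j _; rewrite big_imset //=.
  by apply: eq_bigl => y; rewrite inE.
have sumB : row_weight mu = (\sum_j \sum_(i in B j) i)%N.
  rewrite /row_weight (partition_big (colO mu) predT) //=.
  apply: eq_bigr => j _; rewrite big_imset //=.
  by apply: eq_bigl => y; rewrite inE.
have /eqP : (\sum_j #|A j :\: B j|)%N = 0%N.
  have := leq_sum (index_enum _) (P := predT) (fun j _ => leAB j).
  by rewrite big_split /= -sumA -sumB; lia.
rewrite sum_nat_eq0 => /forallP /(_ (colO mu (w x))) /=.
rewrite cards_eq0 setD_eq0 => /subsetP /(_ (rowO la x)).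
by rewrite memB; apply; apply/imsetP; exists x; rewrite ?inE.
Qed.

(** The entry [x] is moved to the cell in its own row and in the column of its
    image under [w], which is a cell of [mu] by the previous lemma. *)
Lemma matching_perm : exists p : 'S_n,
  forall x, tab_row mu (p x) = tab_row la x /\
            tab_col mu (p x) = tab_col mu (w x).
Proof.
have cell x : {y | (tab_row mu y == tab_row la x) &&
                   (tab_col mu y == tab_col mu (w x))}.
  apply/sigW; have [y y_r y_c] := tab_cell (match_in_shape x).
  by exists y; rewrite y_r y_c !eqxx.
pose p x := sval (cell x).
have pr x : tab_row mu (p x) = tab_row la x.
  by rewrite /p; case: (cell x) => y /= /andP[/eqP].
have pc x : tab_col mu (p x) = tab_col mu (w x).
  by rewrite /p; case: (cell x) => y /= /andP[_ /eqP].
have p_inj : injective p.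
  move=> x y eq_p; apply: contraTeq isT => /w_rows.
  by rewrite -!pr -!pc eq_p eqxx => /(_ erefl).
by exists (perm p_inj) => x; rewrite permE pr pc.
Qed.

Lemma match_eq_shape : la = mu.
Proof.
have [p pP] := matching_perm; apply: intpart_eq => r.
rewrite -!card_tab_row -(card_image (@perm_inj _ p)); apply: eq_card => y.
apply/imageP/idP => [[x] | y_r].
  by rewrite !inE => /eqP <- ->; rewrite (pP x).1.
exists (p^-1 y)%g; last by rewrite permKV.
by rewrite inE -(pP _).1 permKV.
Qed.

End Match.

End Tableau.

(** * Young symmetrizers *)

Section YoungSymmetrizer.

Variables (F : fieldType) (n : nat).
Implicit Types (la mu : intpart n) (z : galg F 'S_n) (g p q : 'S_n) (x y :
  'I_n).

Local Notation elt := (@gelt F 'S_n).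

Definition row_sum la : galg F 'S_n := \sum_(p in row_stab la) elt p.

Definition col_sum la : galg F 'S_n :=
  \sum_(q in col_stab la) (-1) ^+ odd_perm q *: elt q.

Definition young la : galg F 'S_n := young_symm F la.

Lemma row_stabP la p :
  reflect (forall x, tab_row la (p x) = tab_row la x) (p \in row_stab la).
Proof. by rewrite inE; apply: (iffP forallP) => pP x; apply/eqP. Qed.

Lemma col_stabP la q :
  reflect (forall x, tab_col la (q x) = tab_col la x) (q \in col_stab la).
Proof. by rewrite inE; apply: (iffP forallP) => pP x; apply/eqP. Qed.

Fact row_stab_group la : group_set (row_stab la).
Proof.
apply/group_setP; split=> [|p q /row_stabP pP /row_stabP qP].
  by apply/row_stabP => x; rewrite perm1.
by apply/row_stabP => x; rewrite permM qP pP.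
Qed.
Canonical row_group la := group (row_stab_group la).

Fact col_stab_group la : group_set (col_stab la).
Proof.
apply/group_setP; split=> [|p q /col_stabP pP /col_stabP qP].
  by apply/col_stabP => x; rewrite perm1.
by apply/col_stabP => x; rewrite permM qP pP.
Qed.
Canonical col_group la := group (col_stab_group la).

Lemma young_mul la : young la = col_sum la * row_sum la.
Proof.
rewrite /young /young_symm /row_sum mulr_sumr; apply: eq_bigr => p _.
rewrite mulr_suml; apply: eq_bigr => q _.
by rewrite -scalerAl -geltM.
Qed.

Lemma mul_row_sum la p : p \in row_stab la -> elt p * row_sum la = row_sum la.
Proof.
move=> pR; rewrite mulr_sumr [RHS](reindex_inj (mulgI p)) /=.
apply: eq_big => [q | q _]; first by rewrite groupMl.
by rewrite geltM.
Qed.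

Lemma col_sum_mul la q : q \in col_stab la ->
  col_sum la * elt q = (-1) ^+ odd_perm q *: col_sum la.
Proof.
move=> qC; rewrite mulr_suml scaler_sumr [RHS](reindex_inj (mulIg q)) /=.
apply: eq_big => [p | p _]; first by rewrite groupMr.
by rewrite geltM -scalerAl scalerA odd_permM signr_addb mulrCA -expr2 sqrr_sign
  mulr1.
Qed.

Lemma row_sum_sqr la : row_sum la * row_sum la = #|row_stab la|%:R *: row_sum
  la.
Proof.
rewrite {1}/row_sum mulr_suml (eq_bigr (fun=> row_sum la)) => [|p pR].
  by rewrite sumr_const scaler_nat.
exact: mul_row_sum.
Qed.

Lemma col_sum_sqr la : col_sum la * col_sum la = #|col_stab la|%:R *: col_sum
  la.
Proof.
rewrite {2}/col_sum mulr_sumr (eq_bigr (fun=> col_sum la)) => [|q qC].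
  by rewrite sumr_const scaler_nat.
by rewrite -scalerAr col_sum_mul // scalerA -expr2 sqrr_sign scale1r.
Qed.

Hypothesis two_neq0 : 2%:R != 0 :> F.

(** If two entries of a row of [la] are moved by [g^-1] to a column of [mu],
    then the transposition exchanging them is absorbed by the row sum on one
    side and changes the sign of the column sum on the other. *)
Lemma col_row_eq0 la mu g x y : x != y -> tab_row la x = tab_row la y ->
    tab_col mu (g^-1 x)%g = tab_col mu (g^-1 y)%g ->
  col_sum mu * elt g * row_sum la = 0.
Proof.
move=> xy eq_r eq_c; pose t := tperm x y;
  pose t' := tperm (g^-1 x)%g (g^-1 y)%g.
have tR : t \in row_stab la.
  by apply/row_stabP => z; rewrite permE /=; do ![case: eqP => [->|_]].
have tC : t' \in col_stab mu.
  by apply/col_stabP => z; rewrite permE /=; do ![case: eqP => [->|_]].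
have gt : (g * t = t' * g)%g by rewrite /t' -tpermJ conjgE invgK mulgA mulgKV.
have eqN : col_sum mu * elt g * row_sum la = - (col_sum mu * elt g * row_sum
  la).
  rewrite -{1}(mul_row_sum tR) mulrA -[X in X * _]mulrA -geltM gt geltM mulrA.
  rewrite col_sum_mul // odd_tperm (inj_eq perm_inj) xy expr1 scaleN1r.
  by rewrite !mulNr.
apply/eqP; move/eqP: eqN; rewrite -addr_eq0 -mulr2n -scaler_nat scaler_eq0.
by rewrite (negPf two_neq0).
Qed.

(** Unless two entries of a row are moved to the same column, [g^-1] factors as
    a row permutation followed by a column permutation. *)
Lemma col_row_young la g :
  exists k : F, col_sum la * elt g * row_sum la = k *: young la.
Proof.
pose bad := [pred z : 'I_n * 'I_n | [&& z.1 != z.2,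
  tab_row la z.1 == tab_row la z.2 &
  tab_col la (g^-1 z.1)%g == tab_col la (g^-1 z.2)%g]].
have [[x y] /and3P[xy /eqP eq_r /eqP eq_c] | good] := pickP bad.
  by exists 0; rewrite scale0r (col_row_eq0 xy).
have gP x y : x != y -> tab_row la x = tab_row la y ->
    tab_col la (g^-1 x)%g != tab_col la (g^-1 y)%g.
  by move=> xy eq_r; have := good (x, y); rewrite /= xy eq_r eqxx => /negbT.
have [p pP] := matching_perm gP (leqnn _).
have pR : p \in row_stab la by apply/row_stabP => x; rewrite (pP x).1.
have qC : (p^-1 * g^-1)%g \in col_stab la.
  by apply/col_stabP => x; rewrite permM -(pP _).2 permKV.
have -> : g = ((p^-1 * g^-1)^-1 * p^-1)%g by rewrite invMg !invgK mulgK.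
rewrite geltM mulrA -[_ * row_sum la]mulrA mul_row_sum ?groupV //.
rewrite col_sum_mul ?groupV // -scalerAl -young_mul.
by eexists.
Qed.

(** With [c = b * a], where [b] is the column sum and [a] the row sum, the product
    [c * z * c] is [b * (a * z * b) * a]. *)
Lemma young_sandwich_line la z : young la * z * young la \in <[young la]>%VS.
Proof.
have line z' : col_sum la * z' * row_sum la \in <[young la]>%VS.
  rewrite gmul_sum; apply: memv_suml => g _; apply: memvZ.
  by have [k ->] := col_row_young la g; apply/memvZ/memv_line.
rewrite {1 2}young_mul -2!mulrA; have := line (row_sum la * z * col_sum la).
by rewrite !mulrA.
Qed.

(** The row and column stabilizers only meet in the identity. *)
Lemma young1 la : young la 1%g = 1.
Proof.
rewrite young_mul ffunE (bigD1 1%g) //= big1 => [|g g1]; last first.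
  rewrite /col_sum /row_sum !sum_ffunE.
  have [gC | gC] := boolP (g \in col_stab la); last first.
    rewrite big1 ?mul0r // => q qC;
      rewrite !ffunE (_ : g == q = false) ?scaler0 //.
    by apply: contraNF gC => /eqP ->.
  rewrite [X in _ * X]big1 ?mulr0 // => p pR; rewrite ffunE mulg1.
  case: eqP => // gp; case/eqP: g1; apply/permP => x; rewrite perm1.
  apply: (@tab_inj _ la); last exact: (col_stabP _ _ gC).
  have := row_stabP _ _ pR; rewrite -gp => /(_ (g x)).
  by rewrite permK.
rewrite addr0 invg1 mulg1 /col_sum /row_sum !sum_ffunE.
rewrite (bigD1 1%g) ?group1 //= [X in _ + X]big1 => [|q /andP[_ /negPf q1]];
  last first.
  by rewrite !ffunE eq_sym q1 scaler0.
rewrite addr0 (bigD1 1%g) ?group1 //= [X in _ + X]big1 => [|q /andP[_ /negPf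
  q1]]; last first.
  by rewrite !ffunE eq_sym q1.
by rewrite !ffunE eqxx odd_perm1 expr0 scale1r addr0 mulr1.
Qed.

Definition young_coef la z : F := (young la * z * young la) 1%g.

Lemma young_sandwich la z :
  young la * z * young la = young_coef la z *: young la.
Proof.
have /vlineP[k kP] := young_sandwich_line la z.
by rewrite /young_coef kP ffunE young1 [k *: 1]mulr1.
Qed.

End YoungSymmetrizer.

Section YoungOrthogonality.

Variables (C : numClosedFieldType) (n : nat).
Implicit Types (la mu : intpart n) (z : galg C 'S_n) (g p q : 'S_n).

(** The adjoint for the Hermitian form making the group elements orthonormal. *)
Definition gstar z : galg C 'S_n := [ffun g => (z g^-1%g)^*].

Lemma gstarM z z' : gstar (z * z') = gstar z' * gstar z.
Proof.
apply/ffunP => g; rewrite !ffunE rmorph_sum.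
rewrite (reindex_inj (mulgI g^-1%g)) /=.
apply: eq_bigr => h _; rewrite !ffunE rmorphM mulrC.
by rewrite !invMg !invgK mulgK.
Qed.

Fact gstar_is_additive : zmod_morphism gstar.
Proof. by move=> z z'; apply/ffunP => g; rewrite !ffunE rmorphB. Qed.
HB.instance Definition _ :=
  GRing.isZmodMorphism.Build _ _ gstar gstar_is_additive.

Lemma gstarZ (k : C) z : gstar (k *: z) = k^* *: gstar z.
Proof. by apply/ffunP => g; rewrite !ffunE rmorphM. Qed.

Lemma gstar_elt g : gstar (gelt C g) = gelt C g^-1%g.
Proof.
apply/ffunP => h; rewrite !ffunE -(inj_eq invg_inj) invgK.
by case: eqP; rewrite ?conjC1 ?conjC0.
Qed.

(** The value at the identity of [gstar z * z] is the squared Hermitian norm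
    of [z]. *)
Lemma gstar_mul_eq0 z : gstar z * z = 0 -> z = 0.
Proof.
move=> /ffunP /(_ 1%g); rewrite !ffunE => sum0.
have {}sum0 : \sum_h `|z h^-1%g| ^+ 2 == 0.
  rewrite -[X in _ == X]sum0; apply/eqP/eq_bigr => h _.
  by rewrite ffunE mulg1 normCKC.
apply/ffunP => g; move: sum0; rewrite psumr_eq0 => [|h _];
  last exact: exprn_ge0.
move=> /allP /(_ g^-1%g (mem_index_enum _));
  rewrite /= sqrf_eq0 normr_eq0 invgK.
by move/eqP => ->; rewrite ffunE.
Qed.

Lemma gstar_row_sum la : gstar (row_sum C la) = row_sum C la.
Proof.
rewrite raddf_sum [RHS](reindex_inj invg_inj) /=.
by apply: eq_big => [g | g _]; rewrite ?groupV ?gstar_elt.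
Qed.

Lemma gstar_col_sum la : gstar (col_sum C la) = col_sum C la.
Proof.
rewrite raddf_sum [RHS](reindex_inj invg_inj) /=.
apply: eq_big => [g | g _]; rewrite ?groupV // odd_permV.
by rewrite gstarZ gstar_elt rmorph_sign.
Qed.

Definition young_norm la := young_coef la (1 : galg C 'S_n).

Lemma young_sqr la : young C la * young C la = young_norm la *: young C la.
Proof.
rewrite -{1}[young C la]mulr1 young_sandwich //.
by rewrite pnatr_eq0.
Qed.

(** If the square of the symmetrizer [c = b * a] vanished, so would the square
    of the self-adjoint element [a * b * a], hence [a * b * a] itself, hence
    [gstar c * c], hence [c]. *)
Lemma young_norm_neq0 la : young_norm la != 0.
Proof.
set a := row_sum C la; set b := col_sum C la.
have card_neq0 (A : {group 'S_n}) : #|A|%:R != 0 :> C by rewrite pnatr_eq0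
  -lt0n.
apply/eqP => norm0; have := young_sqr la; rewrite norm0 scale0r young_mul.
rewrite -/a -/b => cc0.
have aba0 : a * b * a = 0.
  apply: gstar_mul_eq0; rewrite !gstarM gstar_row_sum gstar_col_sum -/a -/b.
  have -> : a * (b * a) * (a * b * a) = a * b * (a * a) * (b * a) by rewrite
    !mulrA.
  rewrite row_sum_sqr -scalerAr -scalerAl -/a.
  have -> : a * b * a * (b * a) = a * (b * a * (b * a)) by rewrite !mulrA.
  by rewrite cc0 mulr0 scaler0.
have : young C la = 0.
  apply: gstar_mul_eq0; rewrite young_mul gstarM gstar_row_sum gstar_col_sum
    -/a -/b.
  have -> : a * b * (b * a) = a * (b * b) * a by rewrite !mulrA.
  by rewrite col_sum_sqr -scalerAr -scalerAl -/b aba0 scaler0.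
by move=> /ffunP /(_ 1%g); rewrite young1 ffunE => /eqP; rewrite oner_eq0.
Qed.

(** If no transposition cancels the product, then [g^-1] matches the two shapes. *)
Lemma col_row_orth la mu z : la != mu -> (row_weight la <= row_weight mu)%N ->
  col_sum C mu * z * row_sum C la = 0.
Proof.
move=> la'mu le_w; rewrite gmul_sum big1 // => g _.
pose bad := [pred z : 'I_n * 'I_n | [&& z.1 != z.2,
  tab_row la z.1 == tab_row la z.2 &
  tab_col mu (g^-1 z.1)%g == tab_col mu (g^-1 z.2)%g]].
have [[x y] /and3P[xy /eqP eq_r /eqP eq_c] | good] := pickP bad.
  by rewrite (col_row_eq0 _ xy) ?scaler0 // pnatr_eq0.
case/eqP: la'mu; apply: (@match_eq_shape _ _ _ (g^-1)%g) le_w => x y xy eq_r.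
by have := good (x, y); rewrite /= xy eq_r eqxx => /negbT.
Qed.

(** By adjunction one may compare the weights of the two shapes either way. *)
Lemma young_orth la mu z : la != mu -> young C mu * z * young C la = 0.
Proof.
move=> la'mu; rewrite !young_mul.
have -> : col_sum C mu * row_sum C mu * z * (col_sum C la * row_sum C la) =
    col_sum C mu * (row_sum C mu * z * col_sum C la) * row_sum C la.
  by rewrite !mulrA.
have [le_w | /ltnW le_w] := leqP (row_weight la) (row_weight mu).
  exact: col_row_orth.
suff -> : row_sum C mu * z * col_sum C la = 0 by rewrite mulr0 mul0r.
apply: gstar_mul_eq0; rewrite [X in X * _]gstarM gstarM.
rewrite gstar_row_sum gstar_col_sum mulrA col_row_orth ?mul0r //.
by rewrite eq_sym.
Qed.

End YoungOrthogonality.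

(** * Conjugacy in the symmetric group and completeness of the symmetrizers *)

Section Conjugacy.

Local Open Scope nat_scope.

Variables (T : finType).
Implicit Types (s t : {perm T}) (x y : T) (X : {set T}).

Lemma iter_porbit_mod s x m : iter (m %% #|porbit s x|) s x = iter m s x.
Proof.
rewrite [in RHS](divn_eq m #|porbit s x|) addnC iterD; congr iter.
elim: (m %/ _) => // k IHk.
by rewrite mulSn addnC iterD iter_porbit.
Qed.

(** Both equalities express the congruence of [a] and [b] modulo the common size
    of the orbits. *)
Lemma iter_porbit_inj s t x y a b : #|porbit s x| = #|porbit t y| ->
  iter a s x = iter b s x -> iter a t y = iter b t y.
Proof.
move=> eq_o eq_ab; rewrite -(iter_porbit_mod t y a) -(iter_porbit_mod t y b).
suff -> : a %% #|porbit t y| = b %% #|porbit t y| by [].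
have o_gt0 : (0 < #|porbit s x|)%N by rewrite lt0n card_porbit_neq0.
have lt_o c : (c %% #|porbit s x| < #|porbit s x|)%N by rewrite ltn_mod.
rewrite -eq_o; apply/eqP.
rewrite -(nth_uniq x _ _ (uniq_traject_porbit s x)) ?size_traject //.
by rewrite !nth_traject // !iter_porbit_mod eq_ab.
Qed.

Definition orbit_sizes s : seq nat := sort geq [seq #|X| | X <- enum (porbits
  s)].

(** Permutations with orbits of the same sizes are conjugate: match the orbits,
    choose a base point in each, and follow the two permutations from there. *)
Lemma orbit_sizes_conj s t :
  orbit_sizes s = orbit_sizes t -> exists g : {perm T}, t = (s ^ g)%g.
Proof.
pose ord s := sort (relpre (fun X => #|X|) geq) (enum (porbits s)).
have mem_ord r X : (X \in ord r) = (X \in porbits r) by rewrite mem_sort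
  mem_enum.
have uniq_ord r : uniq (ord r) by rewrite sort_uniq enum_uniq.
rewrite /orbit_sizes !sort_map -!/(ord _) => eq_sizes.
have eq_size : size (ord s) = size (ord t).
  by rewrite -(size_map (fun X => #|X|)) eq_sizes size_map.
pose F X := nth set0 (ord t) (index X (ord s)).
have index_lt X : X \in porbits s -> (index X (ord s) < size (ord t))%N.
  by rewrite -mem_ord -index_mem eq_size.
have Ft X : X \in porbits s -> F X \in porbits t.
  by move=> sX; rewrite -mem_ord mem_nth ?index_lt.
have Fcard X : X \in porbits s -> #|F X| = #|X|.
  move=> sX; rewrite /F -(nth_map _ 0%N (fun X => #|X|)) ?index_lt //.
  rewrite -eq_sizes (nth_map set0) ?eq_size ?index_lt //.
  by rewrite nth_index // mem_ord.
have Finj X Y : X \in porbits s -> Y \in porbits s -> F X = F Y -> X = Y.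
  move=> sX sY /eqP; rewrite nth_uniq ?index_lt // => /eqP eq_i.
  by rewrite -(nth_index set0 (s := ord s) (x := X)) ?mem_ord // eq_i nth_index
    ?mem_ord.
pose base X x := odflt x [pick y in X].
have base_in r X x : X \in porbits r -> base X x \in X.
  case/imsetP => y _ ->; rewrite /base; case: pickP => //= /(_ y).
  by rewrite porbit_id.
have base_eq r X x y : X \in porbits r -> base X x = base X y.
  case/imsetP => z _ ->; rewrite /base; case: pickP => //= /(_ z).
  by rewrite porbit_id.
have orb x : porbit s x \in porbits s by apply: imset_f.
have porbit_base r X x : X \in porbits r -> porbit r (base X x) = X.
  move=> rX; have := base_in r X x rX; case/imsetP: (rX) => y _ ->.
  by rewrite -eq_porbit_mem => /eqP.
pose r x := base (porbit s x) x; pose r' x := base (F (porbit s x)) x.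
pose idx x := index x (traject s (r x) #|porbit s (r x)|).
have idxP x : iter (idx x) s (r x) = x.
  have x_in : x \in traject s (r x) #|porbit s (r x)|.
    by rewrite -porbit_traject porbit_base // porbit_id.
  have := x_in; rewrite -index_mem size_traject => lt_i.
  by rewrite -(nth_traject _ lt_i) nth_index.
have eq_card x : #|porbit s (r x)| = #|porbit t (r' x)|.
  by rewrite !porbit_base ?Ft // Fcard.
pose g x := iter (idx x) t (r' x).
have gE x y a : porbit s x = porbit s y -> x = iter a s (r y) ->
    g x = iter a t (r' y).
  move=> eq_xy x_a; have eq_r : r x = r y.
    by rewrite /r eq_xy; apply: base_eq (orb y).
  have eq_r' : r' x = r' y by rewrite /r' eq_xy; apply/base_eq/Ft/orb.
  rewrite /g eq_r'; apply: iter_porbit_inj (eq_card y) _.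
  by rewrite -x_a -eq_r idxP.
have g_comm x : g (s x) = t (g x).
  apply: (gE (s x) x (idx x).+1); last by rewrite iterS idxP.
  by have := porbit_perm s 1 x; rewrite expg1.
have g_inj : injective g.
  move=> x y eq_g; have porbit_g z : porbit t (g z) = F (porbit s z).
    by rewrite /g -permX porbit_perm porbit_base ?Ft.
  have eq_xy : porbit s x = porbit s y by apply: Finj;
    rewrite // -!porbit_g eq_g.
  have eq_r : r x = r y by rewrite /r eq_xy; apply: base_eq (orb y).
  have eq_r' : r' x = r' y by rewrite /r' eq_xy; apply/base_eq/Ft/orb.
  rewrite -(idxP x) -(idxP y) -eq_r.
  apply: iter_porbit_inj (esym (eq_card x)) _.
  by rewrite [in RHS]eq_r' -/(g y) -eq_g.
exists (perm g_inj); rewrite conjgE; apply/permP => x.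
rewrite !permM -{1}[x](permKV (perm g_inj)) !permE -g_comm.
by [].
Qed.

End Conjugacy.

Section CycleType.

Variable n : nat.

Fact orbit_sizes_intpart (s : 'S_n) : is_intpart n (orbit_sizes s).
Proof.
apply/and3P; split.
- by apply: sort_sorted => a b; apply: leq_total.
- rewrite mem_sort; apply/mapP => -[X]; rewrite mem_enum => /imsetP[x _ ->].
  by move/esym/eqP; rewrite (negPf (card_porbit_neq0 s x)).
rewrite (perm_sumn (permEl (perm_sort _ _))) sumnE big_map big_enum /= -[X in _
  == X]card_ord -sum1_card.
rewrite (partition_big (porbit s) (mem (porbits s))) /= => [|x _];
  last exact: imset_f.
apply/eqP/eq_bigr => _ /imsetP[x _ ->]; rewrite -sum1_card.
by apply: eq_bigl => y; rewrite eq_porbit_mem.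
Qed.

Definition cycle_type (s : 'S_n) := IntPart (orbit_sizes_intpart s).

Lemma cycle_type_conj s t :
  cycle_type s = cycle_type t -> exists g, t = (s ^ g)%g.
Proof. by move/(congr1 val); apply: orbit_sizes_conj. Qed.

End CycleType.

Section Completeness.

Variables (C : numClosedFieldType) (n : nat).
Implicit Types (la mu : intpart n) (g h : 'S_n).

Local Notation elt := (@gelt C 'S_n).
Local Notation c := (@young C n).
Local Notation coefs := {ffun intpart n -> C^o}.

Definition young_avg la : galg C 'S_n := \sum_g elt g * c la * elt g^-1%g.

Definition class_fun (k : coefs) : galg C 'S_n := [ffun g => k (cycle_type g)].

Fact class_fun_linear : linear class_fun.
Proof. by move=> a x y; apply/ffunP => g; rewrite !ffunE. Qed.
HB.instance Definition _ := GRing.isLinear.Build C _ _ _ class_fun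
  class_fun_linear.

Definition avg_comb (k : coefs) : galg C 'S_n := \sum_la k la *: young_avg la.

Fact avg_comb_linear : linear avg_comb.
Proof.
move=> a x y; rewrite /avg_comb scaler_sumr -big_split /=.
by apply: eq_bigr => la _; rewrite !ffunE scalerDl scalerA.
Qed.
HB.instance Definition _ := GRing.isLinear.Build C _ _ _ avg_comb
  avg_comb_linear.

Lemma class_funP (z : galg C 'S_n) : (forall g h, z (g ^ h)%g = z g) ->
  z \in limg (linfun class_fun).
Proof.
move=> z_class; apply/memv_imgP.
pose k : coefs := [ffun p => oapp z 0 [pick g | cycle_type g == p]].
exists k; rewrite ?memvf // lfunE; apply/ffunP => g; rewrite !ffunE.
case: pickP => [h /eqP | /(_ g)]; last by rewrite eqxx.
by case/cycle_type_conj => x ->; rewrite z_class.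
Qed.

Lemma young_avg_comm la h : elt h * young_avg la = young_avg la * elt h.
Proof.
rewrite mulr_sumr mulr_suml [RHS](reindex_inj (mulgI h)) /=.
apply: eq_bigr => g _; rewrite invMg !geltM -!mulrA -geltM mulVg gelt1 mulr1.
by rewrite !mulrA.
Qed.

Lemma young_avg_class la : young_avg la \in limg (linfun class_fun).
Proof.
apply: class_funP => g h.
have := young_avg_comm la h; move/ffunP => /(_ (g * h)%g).
by rewrite gmul_eltl gmul_eltr conjgE mulgK.
Qed.

Lemma young_mul_avg_neq la mu : mu != la -> c la * young_avg mu = 0.
Proof.
move=> mu'la; rewrite mulr_sumr big1 // => g _.
by rewrite !mulrA young_orth ?mul0r.
Qed.

(** The coefficient of the identity in [c la * young_avg la] is that of the cube
    of [c la]. *)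
Lemma young_mul_avg_neq0 la : c la * young_avg la != 0.
Proof.
have nz := young_norm_neq0 C la.
suff c3 : (c la * young_avg la) 1%g = young_norm C la ^+ 2.
  apply/eqP => /ffunP /(_ 1%g); rewrite c3 ffunE => /eqP.
  by rewrite sqrf_eq0 (negPf nz).
have -> : young_norm C la ^+ 2 = (c la * c la * c la) 1%g.
  rewrite !young_sqr -scalerAl young_sqr scalerA !ffunE young1.
  by rewrite [RHS]mulr1 expr2.
rewrite gmul_sum mulr_sumr !sum_ffunE; apply: eq_bigr => g _.
rewrite !mulrA young_sandwich ?pnatr_eq0 // -scalerAl.
rewrite ffunE gmul_eltr invgK mul1g ![in RHS]ffunE young1.
by rewrite [X in _ = _ *: X]mulr1; apply: mulrC.
Qed.

(** The [young_avg la] are linearly independent class functions, and there are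
    at least as many of them as cycle types: they span the class functions, and in
    particular the identity. *)
Lemma young_complete : exists k : intpart n -> C, 1 = \sum_la k la *: young_avg
  la.
Proof.
have avg_ker : lker (linfun avg_comb) == 0%VS.
  rewrite -subv0; apply/subvP => k; rewrite memv_ker lfunE memv0 => /eqP k0.
  apply/eqP/ffunP => la; rewrite [RHS]ffunE.
  have /eqP := congr1 (fun z => c la * z) k0.
  rewrite mulr0 /= /avg_comb mulr_sumr (bigD1 la) //= big1 => [|mu mu'la].
    by rewrite addr0 -scalerAr scaler_eq0 (negPf (young_mul_avg_neq0 la)) orbF
      => /eqP.
  by rewrite -scalerAr young_mul_avg_neq ?scaler0.
have sub_img : (limg (linfun avg_comb) <= limg (linfun class_fun))%VS.
  apply/subvP => _ /memv_imgP[k _ ->]; rewrite lfunE; apply: memv_suml => la _.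
  exact/memvZ/young_avg_class.
have : (1 : galg C 'S_n) \in limg (linfun avg_comb).
  have /eqP -> : limg (linfun avg_comb) == limg (linfun class_fun).
    rewrite eqEdim sub_img limg_dim_eq; last by rewrite (eqP avg_ker) capv0.
    by rewrite -(limg_ker_dim (linfun class_fun) fullv) leq_addl.
  apply: class_funP => g h; rewrite !ffunE; congr (_%:R).
  by rewrite (can2_eq (conjgK h) (conjgKV h)) conj1g.
by case/memv_imgP => k _ ->; exists k; rewrite lfunE.
Qed.

End Completeness.

(** * Isotypic decomposition *)

Section Isotypic.

Variables (C : numClosedFieldType) (n : nat).
Implicit Types (la mu nu : intpart n) (g h : 'S_n) (U : rep C 'S_n).
Implicit Types (z : galg C 'S_n).

Local Notation elt := (@gelt C 'S_n).
Local Notation c := (@young C n).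
Local Notation norm := (@young_norm C n).

(** The [avg_coef la *: young_avg C la] are central and add up to [1]; they turn
    out to be the primitive central idempotents of the group algebra. *)
Definition avg_coef : intpart n -> C := sval (cid (young_complete C n)).

Lemma sum_young_avg : 1 = \sum_la avg_coef la *: young_avg C la.
Proof. exact: svalP (cid (young_complete C n)). Qed.

Lemma avg_coef_young la : avg_coef la *: (young_avg C la * c la) = c la.
Proof.
rewrite -[RHS]mul1r sum_young_avg [RHS]mulr_suml [RHS](bigD1 la) //=.
rewrite [X in _ + X]big1 => [|mu mu'la].
  by rewrite -scalerAl addr0.
rewrite -scalerAl mulr_suml big1 ?scaler0 // => g _.
by rewrite -!mulrA (mulrA (c mu)) young_orth ?mulr0 // eq_sym.
Qed.

Lemma young_avg_central la z : z * young_avg C la = young_avg C la * z.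
Proof.
rewrite gmul_suml gmul_sumr; apply: eq_bigr => g _.
by rewrite young_avg_comm.
Qed.

Lemma sub_galg_act U (S : {vspace U}) (Sst : stable S) z (m : sub_rep Sst) :
  vsval (galg_act (sub_rep Sst) z m) = galg_act U z (vsval m).
Proof.
rewrite !galg_actE linear_sum; apply: eq_bigr => g _.
by rewrite linearZ /= sub_actE.
Qed.

Lemma young_in_specht la z : z * c la \in cyclic_space (c la : regular_rep C
  'S_n).
Proof.
rewrite gmul_suml; apply: memv_suml => g _; apply/memvZ/memv_span/mapP.
by exists g; rewrite ?mem_enum // -galg_act_elt galg_regular.
Qed.

Definition specht_val la (m : specht C la) : galg C 'S_n := vsval m.

Fact specht_val_linear la : linear (@specht_val la).
Proof. exact: linearP. Qed.
HB.instance Definition _ la :=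
  GRing.isLinear.Build C _ _ _ (@specht_val la) (@specht_val_linear la).

Lemma specht_valM la (m : specht C la) :
  specht_val m * c la = norm la *: specht_val m.
Proof.
case: m => m m_in; rewrite /specht_val /=.
rewrite (coord_span (X := in_tuple _) m_in) mulr_suml scaler_sumr.
apply: eq_bigr => i _; rewrite -scalerAl scalerA mulrC -scalerA; congr (_ *: _).
have /mapP[g _ ->] : (in_tuple [seq rep_act (regular_rep C 'S_n) g (c la) |
    g : 'S_n])`_i \in [seq rep_act (regular_rep C 'S_n) g (c la) | g : 'S_n].
  exact/mem_nth/ltn_ord.
rewrite -galg_act_elt galg_regular -mulrA young_sqr.
by rewrite -scalerAr.
Qed.

Lemma specht_val_act la z (m : specht C la) :
  specht_val (galg_act (specht C la) z m) = z * specht_val m.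
Proof. by rewrite /specht_val sub_galg_act galg_regular. Qed.

Lemma specht_val_rep la g (m : specht C la) :
  specht_val (rep_act (specht C la) g m) = elt g * specht_val m.
Proof. by rewrite -specht_val_act galg_act_elt. Qed.

(** The multiplicity space of [specht C la] in [U]: evaluation at the generator
    identifies the morphisms from [specht C la] to [U] with this space. *)
Definition young_space U la : {vspace U} := limg (galg_act U (c la)).

Definition young_dim U la := \dim (young_space U la).

Section Components.

Variables (U : rep C 'S_n) (la : intpart n).

Lemma young_spaceP w : w \in young_space U la ->
  galg_act U (c la) w = norm la *: w.
Proof.
case/memv_imgP => u _ ->; rewrite -galg_actM young_sqr linearZ /=.
by rewrite scale_lfunE.
Qed.

(** The map [specht C la -> U] determined by the image of the generator: up to
    a scalar, every vector [w] of [young_space U la] is such an image. *)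
Definition spin_fun (w : U) (m : specht C la) : U := galg_act U (specht_val m)
  w.

Fact spin_fun_linear w : linear (spin_fun w).
Proof.
move=> a x y; by rewrite /spin_fun !linearP /= add_lfunE scale_lfunE.
Qed.
HB.instance Definition _ w :=
  GRing.isLinear.Build C _ _ _ (spin_fun w) (spin_fun_linear w).

Definition spin w : 'Hom(specht C la, U) := linfun (spin_fun w).

Lemma spinE w m : spin w m = galg_act U (specht_val m) w.
Proof. exact: lfunE. Qed.

Lemma spin_equivariant w g m :
  spin w (rep_act (specht C la) g m) = rep_act U g (spin w m).
Proof. by rewrite !spinE specht_val_rep galg_actM galg_act_elt. Qed.

Lemma spin_linear (a : C) w w' : spin (a *: w + w') = a *: spin w + spin w'.
Proof.
by apply/lfunP => m; rewrite add_lfunE scale_lfunE !spinE linearP.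
Qed.

Local Notation W := (subvs_of (young_space U la)).
Local Notation B := (vbasis {:W}).

Definition mult_coord (i : 'I_(\dim {:W})) (u : U) : C :=
  coord B i (vsproj (young_space U la) u).

Definition mult_basis (i : 'I_(\dim {:W})) : U := vsval B`_i.

Lemma mult_basis_in i : mult_basis i \in young_space U la.
Proof. exact: subvsP. Qed.

Lemma mult_coordP w :
  w \in young_space U la -> w = \sum_i mult_coord i w *: mult_basis i.
Proof.
move=> wS; rewrite -[LHS](vsprojK wS).
rewrite {1}(coord_vbasis (memvf (vsproj (young_space U la) w))) linear_sum /=.
by apply: eq_bigr => i _; rewrite ?linearZ.
Qed.

Lemma mult_coord_basis i j : mult_coord i (mult_basis j) = (i == j)%:R.
Proof.
by rewrite /mult_coord vsvalK coord_free ?(basis_free (vbasisP _)) // eq_sym.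
Qed.

Lemma mult_coord_linear i : scalar (mult_coord i).
Proof. by move=> a x y; rewrite /mult_coord !linearP. Qed.

(** The left inverse of [spin (mult_basis i)] obtained by averaging. *)
Definition unspin_val (i : 'I_(\dim {:W})) (u : U) : galg C 'S_n :=
  (avg_coef la / norm la) *:
    \sum_g mult_coord i (galg_act U (c la * elt g^-1%g) u) *: (elt g * c la).

Definition unspin_fun (i : 'I_(\dim {:W})) (u : U) : specht C la :=
  vsproj _ (unspin_val i u).

Fact unspin_fun_linear i : linear (unspin_fun i).
Proof.
have lin a x y : unspin_val i (a *: x + y) = a *: unspin_val i x + unspin_val i
  y.
  rewrite /unspin_val; move: (avg_coef la / norm la) => k.
  rewrite scalerA [a * _]mulrC -scalerA -scalerDr; congr (_ *: _).
  rewrite scaler_sumr -big_split /=; apply: eq_bigr => g _.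
  by rewrite linearP /= mult_coord_linear scalerDl scalerA.
by move=> a x y; rewrite /unspin_fun lin; apply: linearP.
Qed.
HB.instance Definition _ i :=
  GRing.isLinear.Build C _ _ _ (unspin_fun i) (unspin_fun_linear i).

Definition unspin i : 'Hom(U, specht C la) := linfun (unspin_fun i).

Lemma unspinE i u : specht_val (unspin i u) = (avg_coef la / norm la) *:
  \sum_g mult_coord i (galg_act U (c la * elt g^-1%g) u) *: (elt g * c la).
Proof.
rewrite /specht_val lfunE /= vsprojK //; apply/memvZ/memv_suml => g _.
exact/memvZ/young_in_specht.
Qed.

Lemma unspin_equivariant i g u :
  unspin i (rep_act U g u) = rep_act (specht C la) g (unspin i u).
Proof.
apply: val_inj; rewrite -![val _]/(specht_val _) specht_val_rep !unspinE.
rewrite -scalerAr mulr_sumr (reindex_inj (mulgI g)) /=; congr (_ *: _).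
apply: eq_bigr => h _; rewrite -scalerAr mulrA -geltM; congr (_ *: _).
by rewrite -galg_act_elt -galg_actM -mulrA -geltM invMg mulgKV.
Qed.

(** On the image of [spin w] the averaged coefficients are values of
    [young_coef], so that the average becomes the central element
    [young_avg C la], which [avg_coef la] normalizes to the identity. *)
Lemma unspin_spin i w m : w \in young_space U la ->
  unspin i (spin w m) = mult_coord i w *: m.
Proof.
move=> wS; have nz := young_norm_neq0 C la.
have m_c : specht_val m = (norm la)^-1 *: (specht_val m * c la).
  by rewrite specht_valM scalerA mulVf ?scale1r.
apply: val_inj; rewrite -![val _]/(specht_val _) unspinE.
rewrite linearZ /=.
have coordE g : mult_coord i (galg_act U (c la * elt g^-1%g) (spin w m)) =
    mult_coord i w * young_coef la (elt g^-1%g * specht_val m).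
  rewrite spinE -galg_actM {1}m_c -!scalerAr linearZ /= scale_lfunE.
  rewrite !mulrA -(mulrA (c la)) young_sandwich ?pnatr_eq0 // linearZ /=.
  rewrite scale_lfunE young_spaceP // !scalerA.
  have mcZ a x : mult_coord i (a *: x) = a * mult_coord i x.
    by rewrite /mult_coord !linearZ.
  by rewrite mcZ mulrC mulrAC mulVf ?mul1r.
under eq_bigr do rewrite coordE -scalerA scalerAr -young_sandwich ?pnatr_eq0 //.
rewrite -scaler_sumr scalerA [_ * mult_coord i w]mulrC -scalerA; congr (_ *: _).
have -> : \sum_g elt g * (c la * (elt g^-1%g * specht_val m) * c la) =
    young_avg C la * specht_val m * c la.
  by rewrite !mulr_suml; apply: eq_bigr => g _; rewrite !mulrA.
rewrite -young_avg_central -mulrA mulrC -scalerA scalerAr.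
by rewrite avg_coef_young -m_c.
Qed.

Lemma unspin_spin_basis i j m :
  unspin i (spin (mult_basis j) m) = (i == j)%:R *: m.
Proof. by rewrite unspin_spin ?mult_basis_in // mult_coord_basis. Qed.

Definition isotypic : 'End(U) :=
  galg_act U (avg_coef la *: young_avg C la).

Lemma sum_spin_unspin u : \sum_i spin (mult_basis i) (unspin i u) = isotypic u.
Proof.
have nz := young_norm_neq0 C la.
rewrite /isotypic linearZ scale_lfunE linear_sum sum_lfunE /=.
under eq_bigr do rewrite spinE unspinE linearZ linear_sum /= scale_lfunE
  sum_lfunE.
rewrite -scaler_sumr exchange_big /= -scalerA; congr (_ *: _).
rewrite scaler_sumr; apply: eq_bigr => g _.
have vS : galg_act U (c la * elt g^-1%g) u \in young_space U la.
  by rewrite galg_actM; apply/memv_img/memvf.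
rewrite -[elt g * c la * _]mulrA [in RHS]galg_actM [in RHS](mult_coordP vS).
rewrite [RHS]linear_sum scaler_sumr; apply: eq_bigr => i _.
move: (mult_coord i _) => k.
rewrite [RHS]linearZ [galg_act U (_ *: _)]linearZ /= scale_lfunE galg_actM
  young_spaceP ?mult_basis_in //.
rewrite [galg_act U (elt g) (_ *: _)]linearZ /= !scalerA; congr (_ *: _).
by rewrite mulrAC mulVf ?mul1r.
Qed.

End Components.

Lemma unspin_spin_orth U la mu i w m : la != mu ->
  unspin i (@spin U mu w m) = 0 :> specht C la.
Proof.
move=> la'mu; have nz := young_norm_neq0 C mu.
apply: val_inj; rewrite -![val _]/(specht_val _) unspinE big1 ?scaler0 // => g
  _.
have m_c : specht_val m = (norm mu)^-1 *: (specht_val m * c mu).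
  by rewrite specht_valM scalerA mulVf ?scale1r.
rewrite spinE -galg_actM m_c -scalerAr !mulrA -(mulrA (c la)) young_orth
  1?eq_sym //.
rewrite scaler0 linear0 zero_lfunE /mult_coord !linear0 scale0r.
by [].
Qed.

Lemma sum_isotypic U u : \sum_la isotypic U la u = u.
Proof.
rewrite -sum_lfunE -[RHS](id_lfunE u) -galg_act1; congr (_ _).
by rewrite [in RHS]sum_young_avg linear_sum.
Qed.

Lemma isotypic_orth U la mu u : la != mu -> isotypic U la (isotypic U mu u) = 0.
Proof.
move=> la'mu; rewrite -[isotypic U mu u]sum_spin_unspin linear_sum /=.
apply: big1 => j _; rewrite -sum_spin_unspin big1 // => i _.
by rewrite unspin_spin_orth // linear0.
Qed.

Lemma isotypic_rep U la g u :
  isotypic U la (rep_act U g u) = rep_act U g (isotypic U la u).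
Proof.
rewrite /isotypic -galg_act_elt -!galg_actM -scalerAl -scalerAr.
by rewrite young_avg_comm.
Qed.

End Isotypic.

(** * Multiplicities *)

Section Multiplicity.

Variables (C : numClosedFieldType) (n : nat).
Implicit Types (la mu nu : intpart n) (U V : rep C 'S_n).
Implicit Types (z : galg C 'S_n).

Local Notation elt := (@gelt C 'S_n).
Local Notation c := (@young C n).

Lemma young_dim_iso U V la : rep_iso U V -> young_dim U la = young_dim V la.
Proof.
case=> f [f' fK f'K] fG; have f_inj : lker f == 0%VS by apply/lker0P/(can_inj
  fK).
rewrite /young_dim -(limg_dim_eq (f := f)); last by rewrite (eqP f_inj) capv0.
congr (\dim _); apply/vspaceP => v; apply/memv_imgP/memv_imgP.
  case=> _ /memv_imgP[u _ ->] ->; exists (f u); rewrite ?memvf //.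
  exact: galg_act_comm.
case=> w _ ->; exists (galg_act U (c la) (f' w)); first exact/memv_img/memvf.
by rewrite (galg_act_comm _ _ fG) f'K.
Qed.

Lemma dsum_galg_act U V z (x : dsum_rep U V) :
  galg_act (dsum_rep U V) z x = (galg_act U z x.1, galg_act V z x.2).
Proof.
rewrite !galg_actE; apply: (big_ind3 (fun a b d => a = (b, d))) => //.
  by move=> a b d a' b' d' -> ->.
by move=> g _; rewrite lfunE.
Qed.

Lemma young_dim_dsum la U V :
  young_dim (dsum_rep U V) la = (young_dim U la + young_dim V la)%N.
Proof.
pose i : 'Hom(U, dsum_rep U V) := linfun (@pair_out _ _ U U V \1%VF 0).
pose j : 'Hom(V, dsum_rep U V) := linfun (@pair_out _ _ V U V 0 \1%VF).
have iE u : i u = (u, 0) by rewrite lfunE /= /pair_out id_lfunE zero_lfunE.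
have jE v : j v = (0, v) by rewrite lfunE /= /pair_out id_lfunE zero_lfunE.
have -> : young_dim U la = \dim (i @: young_space U la).
  rewrite limg_dim_eq //; apply/eqP; rewrite -subv0; apply/subvP => u.
  by case/memv_capP => _; rewrite memv_ker iE memv0 => /eqP[->].
have -> : young_dim V la = \dim (j @: young_space V la).
  rewrite limg_dim_eq //; apply/eqP; rewrite -subv0; apply/subvP => u.
  by case/memv_capP => _; rewrite memv_ker jE memv0 => /eqP[->].
rewrite -dimv_disjoint_sum; last first.
  apply/eqP; rewrite -subv0; apply/subvP => x /memv_capP[].
  case/memv_imgP => u _ ->; case/memv_imgP => v _.
  by rewrite iE jE memv0 => -[-> _].
congr (\dim _); apply/vspaceP => x; apply/memv_imgP/memv_addP.
  case=> [[u v] _ ->]; rewrite dsum_galg_act.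
  exists (i (galg_act U (c la) u)); first exact/memv_img/memv_img/memvf.
  exists (j (galg_act V (c la) v)); first exact/memv_img/memv_img/memvf.
  by rewrite iE jE; congr (_, _); rewrite ?addr0 ?add0r.
case=> _ /memv_imgP[_ /memv_imgP[u _ ->] ->].
case=> _ /memv_imgP[_ /memv_imgP[v _ ->] ->] ->.
exists (u, v); rewrite ?memvf // dsum_galg_act iE jE.
by congr (_, _); rewrite ?addr0 ?add0r.
Qed.

Lemma young_dim_zero la : young_dim (@zero_rep C 'S_n) la = 0%N.
Proof.
by apply/eqP; rewrite -leqn0; apply: leq_trans (dimvS (subvf _)) _;
  rewrite dimvf.
Qed.

Lemma young_dim_specht la mu : young_dim (specht C la) mu = (la == mu).
Proof.
have act_c (m : specht C la) : specht_val (galg_act (specht C la) (c mu) m) =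
    (young_norm C la)^-1 *: (c mu * specht_val m * c la).
  rewrite specht_val_act -mulrA specht_valM -scalerAr scalerA.
  by rewrite mulVf ?scale1r // young_norm_neq0.
have val_inj (m m' : specht C la) : specht_val m = specht_val m' -> m = m'.
  exact: val_inj.
have [eq_lm|la'mu] := eqVneq la mu; last first.
  apply/eqP; rewrite dimv_eq0 -subv0; apply/subvP => _ /memv_imgP[m _ ->].
  rewrite memv0; apply/eqP/val_inj.
  by rewrite act_c young_orth // scaler0 linear0.
rewrite -{mu}eq_lm in act_c *.
have c_in : c la \in cyclic_space (c la : regular_rep C 'S_n).
  by have := @young_in_specht C n la 1; rewrite mul1r.
pose e : specht C la := Subvs c_in; have e_val : specht_val e = c la by [].
have e_neq0 : e != 0.
  apply/eqP => /(congr1 (@specht_val _ _ la)); rewrite e_val linear0.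
  by move/ffunP/(_ 1%g); rewrite young1 ffunE => /eqP; rewrite oner_eq0.
suff -> : young_dim (specht C la) la = \dim <[e]> by rewrite dim_vline e_neq0.
congr (\dim _); apply/vspaceP => m; apply/memv_imgP/vlineP.
  case=> x _ ->; exists ((young_norm C la)^-1 * young_coef la (specht_val x)).
  apply: val_inj; rewrite act_c young_sandwich ?pnatr_eq0 //.
  by rewrite linearZ /= scalerA mulrC.
case=> k ->; exists ((young_norm C la)^-1 * k *: e); rewrite ?memvf //.
apply: val_inj; rewrite specht_val_act !linearZ /= -scalerAr young_sqr.
rewrite scalerA.
by rewrite mulrC mulrA mulfV ?mul1r // young_norm_neq0.
Qed.

(** One copy of the Specht module for each vector of a basis of its multiplicity
    space. *)
Lemma isotypic_retract U la : retract (isotypic U la)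
  (\bigoplus_(i < \dim {: subvs_of (young_space U la)}) specht C la)%rep.
Proof.
pose e i := (spin la (mult_basis (U := U) (la := la) i) \o unspin i)%VF.
have -> : isotypic U la = \sum_i e i.
  apply/lfunP => u; rewrite -sum_spin_unspin sum_lfunE.
  by apply: eq_bigr => i _; rewrite comp_lfunE.
apply: retract_sum => [i j u _ _ ij | i _].
  rewrite !comp_lfunE unspin_spin_basis (negPf ij) scale0r.
  exact: linear0.
exists (spin la (mult_basis i)), (unspin i); split=> [g m | m | u].
- exact: spin_equivariant.
- by rewrite unspin_spin_basis eqxx scale1r.
- by rewrite comp_lfunE.
Qed.

Lemma retract_refl (G : groupType) (X : rep C G) : retract (\1%VF : 'End(X)) X.
Proof. by exists \1%VF, \1%VF; split=> *; rewrite !id_lfunE. Qed.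

Lemma specht_decomposition U :
  is_mult U [ffun la => \dim {: subvs_of (young_space U la)}].
Proof.
apply: retract_iso (retract_refl U) _.
have -> : \1%VF = \sum_la isotypic U la :> 'End(U).
  by apply/lfunP => u; rewrite id_lfunE sum_lfunE sum_isotypic.
apply: retract_sum => [la mu u _ _ | la _]; first exact: isotypic_orth.
by rewrite ffunE; apply: isotypic_retract.
Qed.

(** [young_dim] is additive, invariant under isomorphism, and counts the Specht
    modules of shape [la]; hence it recovers the multiplicities from any
    decomposition. *)
Lemma is_mult_unique U (m : {ffun intpart n -> nat}) la :
  is_mult U m -> m la = young_dim U la.
Proof.
move/young_dim_iso => ->.
rewrite (big_morph (fun V => young_dim V la) (young_dim_dsum la)
  (young_dim_zero la)).
rewrite (bigD1 la) //= big1 => [|mu mu'la].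
  rewrite addn0.
  rewrite (big_morph (fun V => young_dim V la) (young_dim_dsum la)
    (young_dim_zero la)).
  under eq_bigr do rewrite young_dim_specht eqxx.
  by rewrite sum_nat_const card_ord muln1.
rewrite (big_morph (fun V => young_dim V la) (young_dim_dsum la)
  (young_dim_zero la)).
by rewrite big1 // => i _; rewrite young_dim_specht (negPf mu'la).
Qed.

Lemma specht_multE U la :
  specht_mult U la = \dim {: subvs_of (young_space U la)}.
Proof.
have mU : is_mult U (specht_mult U).
  exact: (classical_sets.xgetPex [ffun=> 0%N] (ex_intro _ _
    (specht_decomposition U))).
by rewrite (is_mult_unique _ mU) dimvf.
Qed.

End Multiplicity.

(** * Tensor products of linear maps *)

Section TensorMaps.

Variable F : fieldType.
Implicit Types V W X Y Z : vectType F.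

Definition is_bilinear V W X (B : V -> W -> X) :=
  (forall w, linear (B^~ w)) /\ (forall v, linear (B v)).

Lemma linear_comb V X (h : V -> X) (I : finType) (a : I -> F) (v : I -> V) :
  linear h -> h (\sum_i a i *: v i) = \sum_i a i *: h (v i).
Proof.
move=> lin_h; have h0 : h 0 = 0.
  by have := lin_h (-1) 0 0; rewrite scaler0 addr0 scaleN1r addNr.
elim/big_rec2: _ => [//|i x y _ <-].
by rewrite lin_h.
Qed.

Lemma bilinear_tensv V W : is_bilinear (@tensv F V W).
Proof.
split=> [w a v v' | v a w w']; apply/matrixP => i j; rewrite !mxE linearP /=.
  by rewrite mulrDl mulrA.
by rewrite mulrDr mulrCA.
Qed.

Lemma tensvZ V W a b (v : V) (w : W) :
  tensv (a *: v) (b *: w) = (a * b) *: tensv v w.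
Proof. by apply/matrixP => i j; rewrite !mxE !linearZ mulrACA. Qed.

Lemma bilinear_hom V W X Y Z (B : V -> W -> X) (f : 'Hom(Y, V)) (g : 'Hom(Z,
  W)) :
  is_bilinear B -> is_bilinear (fun (y : Y) (z : Z) => B (f y) (g z)).
Proof.
case=> Bl Br; split=> [z a y y' | y a z z']; rewrite linearP.
  exact: Bl.
exact: Br.
Qed.

Lemma tens_eqh V W X (f f' : 'Hom(tens V W, X)) :
  (forall v w, f (tensv v w) = f' (tensv v w)) -> forall t, f t = f' t.
Proof.
move=> eq_f t; rewrite (tens_sum t) !linear_sum.
apply: eq_bigr => i _; rewrite !linear_sum; apply: eq_bigr => j _.
by rewrite !linearZ /= eq_f.
Qed.

Section Lift.

Variables (V W X : vectType F) (B : V -> W -> X).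

Definition tlift_fun (t : tens V W) : X :=
  \sum_i \sum_j t i j *: B (vbasis {:V})`_i (vbasis {:W})`_j.

Fact tlift_fun_linear : linear tlift_fun.
Proof.
move=> a t u; rewrite /tlift_fun scaler_sumr -big_split; apply: eq_bigr => i _.
rewrite scaler_sumr -big_split; apply: eq_bigr => j _.
by rewrite !mxE scalerDl scalerA.
Qed.
HB.instance Definition _ := GRing.isLinear.Build F _ _ _ tlift_fun
  tlift_fun_linear.

(** The linear map on the tensor product given by its universal property. *)
Definition tlift : 'Hom(tens V W, X) := linfun tlift_fun.

Lemma tlift_basis t :
  tlift t = \sum_i \sum_j t i j *: B (vbasis {:V})`_i (vbasis {:W})`_j.
Proof. exact: lfunE. Qed.

Lemma tliftE v w : is_bilinear B -> tlift (tensv v w) = B v w.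
Proof.
case=> Bl Br; rewrite tlift_basis [in RHS](coord_vbasis (memvf v)).
rewrite (linear_comb _ _ (Bl w)); apply: eq_bigr => i _.
rewrite [in RHS](coord_vbasis (memvf w)) (linear_comb _ _ (Br _)) scaler_sumr.
by apply: eq_bigr => j _; rewrite mxE scalerA.
Qed.

End Lift.

Definition tensh V W X Y (f : 'Hom(V, X)) (g : 'Hom(W, Y)) :
  'Hom(tens V W, tens X Y) := tlift (fun v w => tensv (f v) (g w)).

Lemma tenshE V W X Y (f : 'Hom(V, X)) (g : 'Hom(W, Y)) v w :
  tensh f g (tensv v w) = tensv (f v) (g w).
Proof. exact/tliftE/bilinear_hom/bilinear_tensv. Qed.

Lemma tensh_comp V W V1 W1 V2 W2 (f : 'Hom(V1, V2)) (g : 'Hom(W1, W2))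
    (f' : 'Hom(V, V1)) (g' : 'Hom(W, W1)) t :
  tensh f g (tensh f' g' t) = tensh (f \o f') (g \o g') t.
Proof.
rewrite -comp_lfunE; move: t; apply: tens_eqh => v w.
by rewrite comp_lfunE !tenshE !comp_lfunE.
Qed.

Lemma tensh_tensf V W (f : 'End(V)) (g : 'End(W)) t : tensf f g t = tensh f g t.
Proof. by []. Qed.

Lemma tensh_id V W t : tensh (\1 : 'End(V)) (\1 : 'End(W)) t = t.
Proof. by rewrite -tensh_tensf tensf1 id_lfunE. Qed.

Lemma bilinear_tensh V W X Y t :
  is_bilinear (fun (f : 'Hom(V, X)) (g : 'Hom(W, Y)) => tensh f g t).
Proof.
have [tl tr] := bilinear_tensv X Y.
split=> [g a f f' | f a g g']; rewrite -scale_lfunE -add_lfunE;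
  move: t; apply: tens_eqh => v w;
  by rewrite add_lfunE scale_lfunE !tenshE !add_lfunE !scale_lfunE (tl, tr).
Qed.

Lemma tensh_linearl V W X Y (f f' : 'Hom(V, X)) (g : 'Hom(W, Y)) a :
  tensh (a *: f + f') g = a *: tensh f g + tensh f' g.
Proof.
apply/lfunP => t; rewrite add_lfunE scale_lfunE.
by have [tl _] := bilinear_tensh X Y t; apply: tl.
Qed.

Lemma tensh_linearr V W X Y (f : 'Hom(V, X)) (g g' : 'Hom(W, Y)) a :
  tensh f (a *: g + g') = a *: tensh f g + tensh f g'.
Proof.
apply/lfunP => t; rewrite add_lfunE scale_lfunE.
by have [_ tr] := bilinear_tensh X Y t; apply: tr.
Qed.

Lemma tensh0l V W X Y (g : 'Hom(W, Y)) : tensh (0 : 'Hom(V, X)) g = 0.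
Proof.
apply/lfunP; apply: tens_eqh => v w; rewrite tenshE !zero_lfunE.
by apply/matrixP => i j; rewrite !mxE linear0 mul0r.
Qed.

Lemma tensh0r V W X Y (f : 'Hom(V, X)) : tensh f (0 : 'Hom(W, Y)) = 0.
Proof.
apply/lfunP; apply: tens_eqh => v w; rewrite tenshE !zero_lfunE.
by apply/matrixP => i j; rewrite !mxE linear0 mulr0.
Qed.

Lemma tensh_sum V W X Y (I J : finType) (f : I -> 'Hom(V, X)) (g : J -> 'Hom(W,
  Y)) t :
  tensh (\sum_i f i) (\sum_j g j) t = \sum_i \sum_j tensh (f i) (g j) t.
Proof.
have [tl tr] := bilinear_tensh X Y t.
rewrite -(eq_bigr _ (fun i _ => scale1r (f i))) (linear_comb _ _ (tl _)).
apply: eq_bigr => i _; rewrite scale1r.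
rewrite -(eq_bigr _ (fun i _ => scale1r (g i))) (linear_comb _ _ (tr _)).
by apply: eq_bigr => j _; rewrite scale1r.
Qed.

End TensorMaps.

Arguments is_bilinear {F V W X} B.
Arguments tlift {F V W X} B.

(** * Induced representations as direct summands *)

Lemma rep_act_mul (F : fieldType) (G : groupType) (U : rep F G) g h u :
  rep_act U (g * h)%g u = rep_act U g (rep_act U h u).
Proof. by rewrite rep_actM comp_lfunE. Qed.


(** If the inclusion [q'] of a [H]-stable subspace [Y] of a representation [U] of
    [G] has a [H]-equivariant retraction [q] that kills every translate of [Y]
    not of the form [f h Y], then the translates of [Y] span a copy of the
    representation induced from [Y]. *)
Section Induced.

Variables (C : numClosedFieldType) (H G : finGroupType).
Variables (f : {multiplicative H -> G}) (U : rep C G) (Y : rep C H).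
Variables (q : 'Hom(U, Y)) (q' : 'Hom(Y, U)).

Hypothesis f_inj : injective f.
Hypothesis qH : forall h u, q (rep_act U (f h) u) = rep_act Y h (q u).
Hypothesis q'K : forall y, q (q' y) = y.
Hypothesis q_out : forall g y, (forall h, g != f h) -> q (rep_act U g (q' y)) =
  0.

Definition equivariant (Z Z' : rep C H) (T : 'Hom(Z, Z')) :=
  forall h z, T (rep_act Z h z) = rep_act Z' h (T z).

Lemma ind_repE (Z : rep C H) g (phi : ind_rep f Z) x :
  (vsval (rep_act (ind_rep f Z) g phi) : {ffun G -> Z}) x =
  (vsval phi : {ffun G -> Z}) (x * g)%g.
Proof.
have -> := sub_actE (@ind_stable C H G f Z) g phi.
by rewrite lfunE /= ffunE.
Qed.

Section To.

Variables (Z : rep C H) (T : 'Hom(Y, Z)).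

Definition to_ind_fun (u : U) : ind_rep f Z :=
  vsproj (ind_space f Z) [ffun x => T (q (rep_act U x u))].

Fact to_ind_fun_linear : linear to_ind_fun.
Proof.
move=> a u v; rewrite /to_ind_fun -linearP; congr vsproj; apply/ffunP => x.
by rewrite !ffunE !linearP.
Qed.
HB.instance Definition _ :=
  GRing.isLinear.Build C _ _ _ to_ind_fun to_ind_fun_linear.

Definition to_ind : 'Hom(U, ind_rep f Z) := linfun to_ind_fun.

Hypothesis TH : equivariant T.

Lemma to_indE u x : (vsval (to_ind u) : {ffun G -> Z}) x = T (q (rep_act U x
  u)).
Proof.
rewrite lfunE /= vsprojK ?ffunE //; apply/ind_spaceP => h y.
by rewrite !ffunE rep_actM comp_lfunE qH TH.
Qed.

Lemma to_ind_equivariant g u :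
  to_ind (rep_act U g u) = rep_act (ind_rep f Z) g (to_ind u).
Proof.
apply/val_inj/ffunP => x; rewrite ind_repE !to_indE.
by rewrite rep_actM comp_lfunE.
Qed.

End To.

Section From.

Variables (Z : rep C H) (S : 'Hom(Z, Y)).

Definition from_ind_fun (phi : ind_rep f Z) : U :=
  #|H|%:R^-1 *:
    \sum_x rep_act U x^-1%g (q' (S ((vsval phi : {ffun G -> Z}) x))).

Fact from_ind_fun_linear : linear from_ind_fun.
Proof.
move=> a u v; rewrite /from_ind_fun.
rewrite scalerA mulrC -scalerA -scalerDr; congr (_ *: _).
rewrite scaler_sumr -big_split /=; apply: eq_bigr => x _.
by rewrite !ffunE !linearP.
Qed.
HB.instance Definition _ :=
  GRing.isLinear.Build C _ _ _ from_ind_fun from_ind_fun_linear.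

Definition from_ind : 'Hom(ind_rep f Z, U) := linfun from_ind_fun.

Lemma from_indE phi : from_ind phi = #|H|%:R^-1 *:
  \sum_x rep_act U x^-1%g (q' (S ((vsval phi : {ffun G -> Z}) x))).
Proof. exact: lfunE. Qed.

Lemma from_ind_equivariant g phi :
  from_ind (rep_act (ind_rep f Z) g phi) = rep_act U g (from_ind phi).
Proof.
rewrite !from_indE [RHS]linearZ /=; congr (_ *: _).
rewrite [RHS]linear_sum (reindex_inj (mulIg g^-1%g)) /=; apply: eq_bigr => x _.
by rewrite ind_repE mulgKV invMg invgK rep_actM comp_lfunE.
Qed.

End From.

Lemma from_ind_linear (Z : rep C H) (S S' : 'Hom(Z, Y)) a (phi : ind_rep f Z) :
  from_ind (a *: S + S') phi = a *: from_ind S phi + from_ind S' phi.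
Proof.
rewrite !from_indE scalerA mulrC -scalerA -scalerDr; congr (_ *: _).
rewrite scaler_sumr -big_split /=; apply: eq_bigr => x _.
by rewrite add_lfunE scale_lfunE !linearP.
Qed.

(** In the double sum only the translations by elements of [f H] survive, and by
    equivariance each of them contributes the same value. *)
Lemma to_from_ind (Z Z' : rep C H) (S : 'Hom(Z, Y)) (T : 'Hom(Y, Z')) phi y :
    equivariant S -> equivariant T ->
  (vsval (to_ind T (from_ind S phi)) : {ffun G -> Z'}) y =
  T (S ((vsval phi : {ffun G -> Z}) y)).
Proof.
move=> SH TH; have /ind_spaceP phiH := subvsP phi.
rewrite to_indE // from_indE !linearZ !linear_sum /=.
have inv_inj : injective (fun g => g^-1 * y)%g.
  by move=> g g' /mulIg/invg_inj.
rewrite (reindex_inj inv_inj) /= (bigID (mem [set f h | h : H])) /=.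
rewrite [X in _ + X]big1 ?addr0 => [|g /imsetP g_f]; last first.
  rewrite -rep_act_mul invMg invgK mulKVg q_out ?linear0 // => h.
  by apply/eqP => eq_g; case: g_f; exists h.
rewrite big_imset /=; last by move=> h h' _ _ /f_inj.
rewrite (eq_bigr (fun=> T (S ((vsval phi : {ffun G -> Z}) y)))) => [|h _].
  rewrite sumr_const -scaler_nat scalerA mulVf ?scale1r //.
  by rewrite pnatr_eq0 -lt0n; apply/card_gt0P; exists 1%g.
rewrite -rep_act_mul invMg invgK mulKVg qH q'K.
by rewrite -SH -phiH mulKVg.
Qed.

Definition ind_op_fun (R : 'End(Y)) (u : U) : U :=
  #|H|%:R^-1 *: \sum_x rep_act U x^-1%g (q' (R (q (rep_act U x u)))).

Fact ind_op_fun_linear R : linear (ind_op_fun R).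
Proof.
move=> a u v; rewrite /ind_op_fun.
rewrite scalerA mulrC -scalerA -scalerDr; congr (_ *: _).
rewrite scaler_sumr -big_split /=; apply: eq_bigr => x _.
by rewrite !linearP.
Qed.
HB.instance Definition _ R :=
  GRing.isLinear.Build C _ _ _ (ind_op_fun R) (ind_op_fun_linear R).

(** The action of an endomorphism [R] of [Y] on the copy of the induced
    representation, extended by zero on its complement. *)
Definition ind_op R : 'End(U) := linfun (ind_op_fun R).

Lemma ind_opE R u : ind_op R u =
  #|H|%:R^-1 *: \sum_x rep_act U x^-1%g (q' (R (q (rep_act U x u)))).
Proof. exact: lfunE. Qed.

Lemma ind_op_sum (I : finType) (P : pred I) (R : I -> 'End(Y)) u :
  ind_op (\sum_(i | P i) R i) u = \sum_(i | P i) ind_op (R i) u.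
Proof.
under [RHS]eq_bigr do rewrite ind_opE;
  rewrite ind_opE -scaler_sumr exchange_big /=.
congr (_ *: _); apply: eq_bigr => x _.
by rewrite sum_lfunE !linear_sum.
Qed.

Lemma from_to_ind (Z : rep C H) (S : 'Hom(Z, Y)) (T : 'Hom(Y, Z)) u :
  equivariant T -> from_ind S (to_ind T u) = ind_op (S \o T)%VF u.
Proof.
move=> TH; rewrite from_indE ind_opE; congr (_ *: _); apply: eq_bigr => x _.
by rewrite to_indE // comp_lfunE.
Qed.

Lemma equivariant_id : equivariant (\1%VF : 'End(Y)).
Proof. by move=> h y; rewrite !id_lfunE. Qed.

Lemma ind_op_from_to R u : equivariant R -> ind_op R u = from_ind \1 (to_ind R
  u).
Proof. by move=> RH; rewrite from_to_ind // comp_lfun1l. Qed.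

Lemma ind_op_equivariant R g u : equivariant R ->
  ind_op R (rep_act U g u) = rep_act U g (ind_op R u).
Proof.
by move=> RH; rewrite !ind_op_from_to // to_ind_equivariant //
  from_ind_equivariant.
Qed.

Lemma ind_op_comp (R R' : 'End(Y)) u : equivariant R -> equivariant R' ->
  ind_op R (ind_op R' u) = ind_op (R \o R')%VF u.
Proof.
move=> RH R'H; have idH := equivariant_id.
have RR'H : equivariant (R \o R')%VF by move=> h y; rewrite !comp_lfunE R'H RH.
rewrite !ind_op_from_to //; congr (from_ind _ _); apply/val_inj/ffunP => y.
by rewrite to_from_ind // id_lfunE !to_indE // comp_lfunE.
Qed.

End Induced.

(** * Positions in the Heisenberg product *)

Section Embedding.

Local Open Scope nat_scope.

Definition perm_nat a (s : 'S_a) (m : nat) : nat :=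
  if insub m is Some x then s x else m.

Lemma perm_natE a (s : 'S_a) (x : 'I_a) : perm_nat s x = s x.
Proof. by rewrite /perm_nat valK. Qed.

Lemma iota_embE a b n (e : a + b = n) (st : 'S_a * 'S_b) (i : 'I_n) :
  iota_emb e st i =
    (if i < a then perm_nat st.1 i else a + perm_nat st.2 (i - a)) :> nat.
Proof.
case: _ / e i => i; rewrite /iota_emb cast_perm_id permE /perm_sum_fun.
case: split_ordP => j -> /=; first by rewrite perm_natE.
by rewrite addKn perm_natE.
Qed.

Lemma iota_emb_inj a b n (e : a + b = n) : injective (iota_emb e).
Proof.
move=> [s t] [s' t'] eq_st; congr (_, _); apply/permP => x; apply: val_inj.
  have x_lt : x < n by rewrite -e ltn_addr.
  have := congr1 (fun g : 'S_n => val (g (Ordinal x_lt))) eq_st.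
  by rewrite /= !iota_embE /= ltn_ord !perm_natE.
have x_lt : a + x < n by rewrite -e ltn_add2l.
have := congr1 (fun g : 'S_n => val (g (Ordinal x_lt))) eq_st.
rewrite /= !iota_embE /= ltnNge leq_addr addKn !perm_natE /=.
exact: addnI.
Qed.

Lemma perm_restrict n (g : 'S_n) c a : c + a <= n ->
    (forall i : 'I_n, (c <= i < c + a) -> (c <= g i < c + a)) ->
  exists s : 'S_a, forall i : 'I_n, c <= i < c + a ->
    g i = c + perm_nat s (i - c) :> nat.
Proof.
move=> can gP.
have lt_n (x : 'I_a) : c + x < n by apply: leq_trans can; rewrite ltn_add2l.
have bounds (x : 'I_a) : c <= g (Ordinal (lt_n x)) < c + a.
  by apply: gP; rewrite /= leq_addr ltn_add2l ltn_ord.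
have lt_a (x : 'I_a) : g (Ordinal (lt_n x)) - c < a.
  by have /andP[] := bounds x; lia.
have s_inj : injective (fun x => Ordinal (lt_a x)).
  move=> x y [eq_xy]; apply: val_inj; have := bounds x; have := bounds y.
  move=> /andP[cy _] /andP[cx _].
  have /val_inj/perm_inj[] : g (Ordinal (lt_n x)) = g (Ordinal (lt_n y)) :> nat.
    by rewrite -(subnK cx) -(subnK cy) eq_xy.
  exact: addnI.
exists (perm s_inj) => i /andP[ci ica].
have ia : i - c < a by lia.
rewrite -[i - c]/(val (Ordinal ia)) perm_natE permE /= subnKC.
  by congr (val (g _)); apply: val_inj; rewrite /= subnKC.
by have /andP[] := bounds (Ordinal ia).
Qed.

End Embedding.

Section Positions.

Local Open Scope nat_scope.

Variables (k l n : nat).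
Hypothesis kln : maxn k l <= n <= k + l.

Fact pos_bounds : [/\ k <= n, l <= n & n <= k + l].
Proof. by move: kln; rewrite geq_max => /andP[/andP[-> ->] ->]. Qed.

(** Of the [n] tensor factors, the first [k] carry a vector of the first space
    and the last [l] a vector of the second one. *)
Definition pos1 (i : 'I_n) : option 'I_k := insub (val i).
Definition pos2 (i : 'I_n) : option 'I_l :=
  if n - l <= i then insub (i - (n - l)) else None.

Fact at1_lt (x : 'I_k) : x < n.
Proof. by have [kn _ _] := pos_bounds; apply: leq_trans kn. Qed.
Fact at2_lt (y : 'I_l) : n - l + y < n.
Proof. by have [_ ln _] := pos_bounds; have := ltn_ord y; lia. Qed.

Definition at1 (x : 'I_k) := Ordinal (at1_lt x).
Definition at2 (y : 'I_l) := Ordinal (at2_lt y).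

Lemma at1K : pcancel at1 pos1.
Proof. by move=> x; rewrite /pos1 /= valK. Qed.

Lemma at2K : pcancel at2 pos2.
Proof. by move=> y; rewrite /pos2 /= leq_addr addKn valK. Qed.

Lemma pos1K : ocancel pos1 at1.
Proof. by move=> i; rewrite /pos1; case: insubP => //= x _ xi;
  apply: val_inj. Qed.

Lemma pos2K : ocancel pos2 at2.
Proof.
move=> i; rewrite /pos2; case: leqP => //= ni; case: insubP => //= y _ yi.
by apply: val_inj; rewrite /= yi subnKC.
Qed.

Lemma pos1_some i : isSome (pos1 i) = (i < k).
Proof. by rewrite /pos1; case: insubP => [x -> | /negPf ->]. Qed.

Lemma pos2_some i : isSome (pos2 i) = (n - l <= i).
Proof.
rewrite /pos2; case: leqP => // ni; case: insubP => //= /negP[].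
by have [_ ln _] := pos_bounds; have := ltn_ord i; lia.
Qed.

Lemma heis_at1 h x : heis_to_i kln h (at1 x) = at1 ((heis_to_kl kln h).1 x).
Proof.
case: h => -[s t] r; apply: val_inj; rewrite /= !iota_embE /=.
case: ltnP => // nx; have [kn ln nkl] := pos_bounds.
have xt : x - (n - l) < k + l - n by have := ltn_ord x; lia.
have xl : x - (n - l) < l by lia.
by rewrite -[x - (n - l)]/(val (Ordinal xl)) perm_natE iota_embE /= xt.
Qed.

Lemma heis_at2 h y : heis_to_i kln h (at2 y) = at2 ((heis_to_kl kln h).2 y).
Proof.
case: h => -[s t] r; apply: val_inj; rewrite /= !iota_embE /=.
by rewrite ltnNge leq_addr addKn perm_natE iota_embE.
Qed.

Lemma pos1_heis h i :
  pos1 (heis_to_i kln h i) = omap (heis_to_kl kln h).1 (pos1 i).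
Proof.
set g := heis_to_i kln h; set h1 := (heis_to_kl kln h).1.
case pos_i: (pos1 i) => [x|] /=.
  by have := pos1K i; rewrite pos_i /= => <-; rewrite heis_at1 at1K.
case pos_gi: (pos1 (g i)) => [x|] //=; have := pos1K (g i).
rewrite pos_gi /= -[x](permKV h1) -heis_at1 => /perm_inj eq_i.
by rewrite -eq_i at1K in pos_i.
Qed.

Lemma pos2_heis h i :
  pos2 (heis_to_i kln h i) = omap (heis_to_kl kln h).2 (pos2 i).
Proof.
set g := heis_to_i kln h; set h2 := (heis_to_kl kln h).2.
case pos_i: (pos2 i) => [x|] /=.
  by have := pos2K i; rewrite pos_i /= => <-; rewrite heis_at2 at2K.
case pos_gi: (pos2 (g i)) => [x|] //=; have := pos2K (g i).
rewrite pos_gi /= -[x](permKV h2) -heis_at2 => /perm_inj eq_i.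
by rewrite -eq_i at2K in pos_i.
Qed.

Lemma heis_to_i_inj : injective (heis_to_i kln).
Proof.
move=> [[s t] r] [[s' t'] r'] /= /iota_emb_inj[-> /iota_emb_inj[-> ->]].
by [].
Qed.

(** The image of the embedding is the stabilizer of the three blocks of positions:
    a permutation of this kind restricts to each block. *)
Lemma heis_to_iP (g : 'S_n) :
    (forall i, isSome (pos1 (g i)) = isSome (pos1 i)) ->
    (forall i, isSome (pos2 (g i)) = isSome (pos2 i)) ->
  exists h, g = heis_to_i kln h.
Proof.
move=> g1 g2; have [kn ln nkl] := pos_bounds.
have {}g1 i : (g i < k) = (i < k) by rewrite -!pos1_some.
have {}g2 i : (n - l <= g i) = (n - l <= i) by rewrite -!pos2_some.
have [s sP] : exists s : 'S_(n - l), forall i : 'I_n, 0 <= i < 0 + (n - l) ->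
    g i = 0 + perm_nat s (i - 0) :> nat.
  by apply: perm_restrict => [|i]; [lia | have := g2 i; lia].
have [t tP] : exists t : 'S_(k + l - n), forall i : 'I_n,
    n - l <= i < n - l + (k + l - n) ->
    g i = n - l + perm_nat t (i - (n - l)) :> nat.
  by apply: perm_restrict => [|i]; [lia | have := g1 i; have := g2 i; lia].
have [r rP] : exists r : 'S_(n - k), forall i : 'I_n, k <= i < k + (n - k) ->
    g i = k + perm_nat r (i - k) :> nat.
  by apply: perm_restrict => [|i]; [lia | have := g1 i; have := ltn_ord (g i);
    lia].
exists (s, t, r); apply/permP => i; apply: val_inj; rewrite /= iota_embE /=.
case: ltnP => [i_lt | i_ge]; first by rewrite sP // subn0.
have il : i - (n - l) < l by have := ltn_ord i; lia.
rewrite -[i - (n - l)]/(val (Ordinal il)) perm_natE iota_embE /=.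
case: ltnP => it; first by rewrite tP //; lia.
have -> : i - (n - l) - (k + l - n) = i - k by lia.
by rewrite rP; have := ltn_ord i; lia.
Qed.

Lemma sort_positions (p1 p2 : pred 'I_n) :
    (forall i, p1 i || p2 i) -> #|p1| = k -> #|p2| = l ->
  exists x : 'S_n, forall i,
    p1 (x i) = isSome (pos1 i) /\ p2 (x i) = isSome (pos2 i).
Proof.
move=> p12 p1k p2l; have [kn ln nkl] := pos_bounds.
(* List the positions outside [p2], then the common ones, then those outside
   [p1]. *)
pose A := [seq i <- enum 'I_n | ~~ p2 i].
pose B := [seq i <- enum 'I_n | p1 i && p2 i].
pose D := [seq i <- enum 'I_n | ~~ p1 i].
have sz (p : pred 'I_n) : size [seq i <- enum 'I_n | p i] = #|p|.
  by rewrite cardE [in RHS]/enum_mem enumT.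
have szA : size A = n - l.
  by rewrite sz -p2l -[n in n - _]card_ord -(cardC p2) addKn.
have szD : size D = n - k.
  by rewrite sz -p1k -[n in n - _]card_ord -(cardC p1) addKn.
have szB : size B = k + l - n.
  have := cardUI p1 p2; rewrite p1k p2l (eq_card (B := 'I_n)); last first.
    by move=> i; rewrite inE; apply: p12.
  by rewrite card_ord sz => <-; rewrite addKn.
have sz_all : size (A ++ B ++ D) = n by rewrite !size_cat szA szB szD; lia.
have uniq_all : uniq (A ++ B ++ D).
  rewrite !cat_uniq !(filter_uniq _ (enum_uniq _)) /= andbT; apply/andP; split.
    apply/hasPn => i; rewrite mem_cat !mem_filter.
    by have := p12 i; case: (p1 i); case: (p2 i).
  by apply/hasPn => i; rewrite !mem_filter; case: (p1 i).
have x_inj : injective (fun i : 'I_n => nth i (A ++ B ++ D) i).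
  move=> i j /= eq_ij; apply/val_inj/eqP => /=.
  rewrite -(nth_uniq i _ _ uniq_all) ?sz_all // eq_ij; apply/eqP.
  by apply: set_nth_default; rewrite sz_all.
exists (perm x_inj) => i; rewrite permE pos1_some pos2_some nth_cat szA.
have mem_nthP (p : pred 'I_n) m : m < size [seq j <- enum 'I_n | p j] ->
    p (nth i [seq j <- enum 'I_n | p j] m).
  by move/(mem_nth i); rewrite mem_filter => /andP[].
have i_n := ltn_ord i; case: (ltnP i (n - l)) => iA.
  have := mem_nthP (predC p2) i; rewrite szA => /(_ iA) /= nA.
  have := p12 (nth i A i); rewrite (negPf nA) orbF => ->.
  by split; lia.
rewrite nth_cat szB; case: ltnP => iB.
  have := mem_nthP (predI p1 p2) (i - (n - l)); rewrite szB => /(_ iB) /andP[].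
  by rewrite -/B => -> ->; split; lia.
have iD : i - (n - l) - (k + l - n) < n - k by lia.
have := mem_nthP (predC p1) (i - (n - l) - (k + l - n)).
rewrite szD => /(_ iD) /= nD; have := p12 (nth i D (i - (n - l) - (k + l - n))).
by rewrite (negPf nD) /= => ->; split; lia.
Qed.

End Positions.

(** * Words in the tensor powers of the total space *)

Lemma prod_ocancel (R : comPzRingType) (I J : finType) (pos : I -> option J)
    (at_ : J -> I) (c : J -> R) : pcancel at_ pos -> ocancel pos at_ ->
  \prod_i oapp c 1 (pos i) = \prod_j c j.
Proof.
move=> atK posK; rewrite (bigID (mem [set at_ j | j : J])) /=.
rewrite [X in _ * X]big1 => [|i i_out]; last first.
  case pos_i: (pos i) => [j|] //=; case/imsetP: i_out; exists j => //.
  by have := posK i; rewrite pos_i.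
rewrite mulr1 big_imset /=; last by move=> j j' _ _; apply: (pcan_inj atK).
by apply: eq_bigr => j _; rewrite atK.
Qed.

Section Letters.

Variables (F : fieldType) (V1 V2 : vectType F).

Local Notation e1 := (vbasis {:V1}).
Local Notation e2 := (vbasis {:V2}).
Local Notation d1 := (\dim {:V1}).
Local Notation d2 := (\dim {:V2}).
Local Notation V := (Vhat V1 V2).

(** The quotient map of [(F + V1) (x) (F + V2)] by its summand [F (x) F]. *)
Definition join_vec (u : F * V1) (v : F * V2) : V :=
  (v.1 *: u.2, tensv u.2 v.2, u.1 *: v.2).

Definition letter := (option 'I_d1 * option 'I_d2)%type.

Definition ext1 (a : option 'I_d1) : F * V1 :=
  if a is Some i then (0, e1`_i) else (1, 0).
Definition ext2 (b : option 'I_d2) : F * V2 :=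
  if b is Some j then (0, e2`_j) else (1, 0).

(** The letters other than [(None, None)] index a basis of the total space;
    that one stands for the zero vector. *)
Definition letter_vec (x : letter) : V := join_vec (ext1 x.1) (ext2 x.2).

Definition letter_coord (x : letter) (u : V) : F :=
  match x with
  | (Some i, None) => coord e1 i u.1.1
  | (Some i, Some j) => u.1.2 i j
  | (None, Some j) => coord e2 j u.2
  | (None, None) => 0
  end.

Definition ext1_coord (a : option 'I_d1) (u : F * V1) : F :=
  if a is Some i then coord e1 i u.2 else u.1.
Definition ext2_coord (b : option 'I_d2) (v : F * V2) : F :=
  if b is Some j then coord e2 j v.2 else v.1.

Definition proper_letter : pred letter := predC1 (None, None).

Lemma letter_vec_None : letter_vec (None, None) = 0.
Proof.
rewrite /letter_vec /join_vec /= !scaler0; congr (_, _, _).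
by apply/matrixP => i j; rewrite !mxE !linear0 mul0r.
Qed.

Lemma letter_coord_linear x : scalar (letter_coord x).
Proof.
case: x => -[i|] [j|] a u v; rewrite /= ?linearP //.
  by rewrite !mxE.
by rewrite mulr0 addr0.
Qed.

Lemma letter_coord_join x u v : proper_letter x ->
  letter_coord x (join_vec u v) = ext1_coord x.1 u * ext2_coord x.2 v.
Proof.
case: x => -[i|] [j|] //= _.
- by rewrite mxE.
- by rewrite linearZ mulrC.
- by rewrite linearZ.
Qed.

Lemma ext1_coordE a b : ext1_coord a (ext1 b) = (a == b)%:R.
Proof.
case: a b => [i|] [j|] //=; last by rewrite linear0.
by rewrite coord_free ?(basis_free (vbasisP _)) // eq_sym.
Qed.

Lemma ext2_coordE a b : ext2_coord a (ext2 b) = (a == b)%:R.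
Proof.
case: a b => [i|] [j|] //=; last by rewrite linear0.
by rewrite coord_free ?(basis_free (vbasisP _)) // eq_sym.
Qed.

Lemma letter_coordE x y : proper_letter x -> letter_coord x (letter_vec y) = (x
  == y)%:R.
Proof.
move=> x_proper; rewrite letter_coord_join // ext1_coordE ext2_coordE.
by rewrite -natrM mulnb.
Qed.

Lemma letter_coord_inj u v :
  (forall x, proper_letter x -> letter_coord x u = letter_coord x v) -> u = v.
Proof.
case: u v => -[u1 t] u2 [[v1 t'] v2] eq_uv; congr (_, _, _).
- rewrite (coord_vbasis (memvf u1)) (coord_vbasis (memvf v1)).
  by apply: eq_bigr => i _; congr (_ *: _); apply: (eq_uv (Some i, None)).
- by apply/matrixP => i j; apply: (eq_uv (Some i, Some j)).
- rewrite (coord_vbasis (memvf u2)) (coord_vbasis (memvf v2)).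
  by apply: eq_bigr => j _; congr (_ *: _); apply: (eq_uv (None, Some j)).
Qed.

(** Both sides have the same coordinates on the proper letters. *)
Lemma letter_sum (u : V) : u = \sum_x letter_coord x u *: letter_vec x.
Proof.
apply: letter_coord_inj => y y_proper.
rewrite (linear_comb (X := F^o) _ _ (letter_coord_linear y)) (bigD1 y) //= big1
  => [|x /negPf x'y].
  by rewrite letter_coordE // eqxx addr0 [RHS]mulr1.
by rewrite letter_coordE // eq_sym x'y scaler0.
Qed.

Lemma phi_join g1 g2 x u y v :
  phi (g1, g2) (join_vec (x, u) (y, v)) = join_vec (x, g1 u) (y, g2 v).
Proof.
rewrite lfunE /= /phi_fun /join_vec /= !linearZ /=.
by congr (_, _, _); apply: tensfE.
Qed.

End Letters.

Section Words.

Variables (F : fieldType) (V1 V2 : vectType F) (n : nat).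

Local Notation V := (Vhat V1 V2).
Local Notation word := {ffun 'I_n -> letter V1 V2}.
Local Notation TV := (tpow V n).

Definition word_vec (s : word) : TV := tpowv (fun i => letter_vec (s i)).

(** The linear form on the tensor power whose value on a pure tensor is the
    product of the coordinates of its factors on the letters of [s]. *)
Definition word_coord (s : word) (t : TV) : F :=
  \sum_f t f * \prod_i letter_coord (s i) (vbasis {:V})`_(f i).

Definition proper_word (s : word) := [forall i, proper_letter (s i)].

Lemma word_coord_linear s : scalar (word_coord s).
Proof.
move=> a t u; rewrite /word_coord mulr_sumr -big_split /=;
  apply: eq_bigr => f _.
by rewrite !ffunE mulrDl mulrA.
Qed.

Lemma word_coord_pure s v :
  word_coord s (tpowv v) = \prod_i letter_coord (s i) (v i).
Proof.
transitivity (\prod_i \sum_j coord (vbasis {:V}) j (v i) *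
    letter_coord (s i) (vbasis {:V})`_j).
  rewrite bigA_distr_bigA; apply: eq_bigr => f _.
  by rewrite ffunE -big_split.
apply: eq_bigr => i _; rewrite [in RHS](coord_vbasis (memvf (v i))).
by rewrite (linear_comb (X := F^o) _ _ (letter_coord_linear (s i))).
Qed.

Lemma word_sum (t : TV) : t = \sum_s word_coord s t *: word_vec s.
Proof.
rewrite [t in LHS]tpow_sum.
under [RHS]eq_bigr do rewrite scaler_suml.
rewrite [RHS]exchange_big /=; apply: eq_bigr => f _.
under [RHS]eq_bigr do rewrite -scalerA.
rewrite -scaler_sumr; congr (_ *: _).
transitivity (tpowv (fun i => \sum_x
    letter_coord x (vbasis {:V})`_(f i) *: letter_vec x));
      last exact: tpowv_sumZ.
by congr tpowv; apply/funext => i; apply: letter_sum.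
Qed.

Lemma word_coordE s s' : proper_word s -> word_coord s (word_vec s') = (s ==
  s')%:R.
Proof.
move=> /forallP s_proper; rewrite word_coord_pure.
have [<- | s's] := eqVneq; first by rewrite big1 // => i _;
  rewrite letter_coordE ?eqxx.
have [i si] : exists i, s i != s' i.
  apply/existsP; rewrite -negb_forall; apply: contra s's => /forallP eq_s.
  by apply/eqP/ffunP => i; apply/eqP.
by rewrite (bigD1 i) //= letter_coordE // (negPf si) mul0r.
Qed.

Lemma word_vec_improper s : ~~ proper_word s -> word_vec s = 0.
Proof.
rewrite negb_forall => /existsP[i /negPn/eqP si]; apply/ffunP => f.
by rewrite !ffunE (bigD1 i) //= si letter_vec_None linear0 mul0r.
Qed.

(** The words span the tensor power, and those that are not proper vanish. *)
Lemma word_eq (X : vectType F) (f f' : 'Hom(TV, X)) :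
  (forall s, proper_word s -> f (word_vec s) = f' (word_vec s)) ->
  forall t, f t = f' t.
Proof.
move=> eq_f t; rewrite (word_sum t) !linear_sum; apply: eq_bigr => s _.
rewrite !linearZ /=; congr (_ *: _).
have [/eq_f // | /word_vec_improper ->] := boolP (proper_word s).
by rewrite !linear0.
Qed.

Definition word_act (g : 'S_n) (s : word) : word := [ffun i => s (g i)].

Lemma word_vec_act g s :
  rep_act (perm_tpow_rep V n) g (word_vec s) = word_vec (word_act g s).
Proof.
rewrite [LHS]perm_tpow_actE; congr tpowv; apply/funext => i.
by rewrite ffunE.
Qed.

End Words.

(** * The tensor power of the total space as a sum of induced representations *)

Lemma tpow_basisE (F : fieldType) (V : vectType F) n
    (f g : {ffun 'I_n -> 'I_(\dim {:V})}) :
  tpowv (fun i => (vbasis {:V})`_(f i)) g = (f == g)%:R.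
Proof.
rewrite ffunE; have coordE i : coord (vbasis {:V}) (g i) (vbasis {:V})`_(f i) =
    (f i == g i)%:R.
  by rewrite coord_free ?(basis_free (vbasisP _)).
have [eq_fg | f'g] := eqVneq f g.
  by rewrite big1 // => i _; rewrite coordE eq_fg eqxx.
have [i fi] : exists i, f i != g i.
  apply/existsP; rewrite -negb_forall; apply: contra f'g => /forallP eq_f.
  by apply/eqP/ffunP => i; apply/eqP.
by rewrite (bigD1 i) //= coordE (negPf fi) mul0r.
Qed.

Lemma perm_gl_act (F : fieldType) (V : vectType F) n (g : GL V) (s : 'S_n) t :
  rep_act (perm_tpow_rep V n) s (rep_act (gl_tpow_rep V n) g t) =
  rep_act (gl_tpow_rep V n) g (rep_act (perm_tpow_rep V n) s t).
Proof. by have /lfunP/(_ t) := gl_perm_comm g s; rewrite !comp_lfunE => ->. Qed.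

Section Standard.

Variables (F : fieldType) (V1 V2 : vectType F) (k l n : nat).
Hypothesis kln : (maxn k l <= n <= k + l)%N.

Local Notation V := (Vhat V1 V2).
Local Notation e1 := (vbasis {:V1}).
Local Notation e2 := (vbasis {:V2}).
Local Notation word := {ffun 'I_n -> letter V1 V2}.
Local Notation word1 := {ffun 'I_k -> 'I_(\dim {:V1})}.
Local Notation word2 := {ffun 'I_l -> 'I_(\dim {:V2})}.
Local Notation W := (tens (tpow V1 k) (tpow V2 l)).
Local Notation pos1 := (@pos1 k n).
Local Notation pos2 := (@pos2 l n).
Local Notation at1 := (at1 kln).
Local Notation at2 := (at2 kln).

(** In a standard word the letters involving [V1] fill the first [k] positions
    and those involving [V2] the last [l] ones. *)
Definition std_word (f1 : word1) (f2 : word2) : word :=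
  [ffun i => (omap f1 (pos1 i), omap f2 (pos2 i))].

Definition std_shape (s : word) :=
  forall i, isSome (s i).1 = isSome (pos1 i) /\ isSome (s i).2 = isSome (pos2
    i).

Lemma std_word_shape f1 f2 : std_shape (std_word f1 f2).
Proof. by move=> i; rewrite ffunE /=; case: (pos1 i); case: (pos2 i). Qed.

Lemma std_word_exists s : std_shape s -> exists f1 f2, s = std_word f1 f2.
Proof.
move=> s_std.
have f1P x : {a | (s (at1 x)).1 == Some a}.
  have [] := s_std (at1 x); rewrite at1K.
  by case: (s (at1 x)).1 => [a|] // _ _; exists a.
have f2P x : {a | (s (at2 x)).2 == Some a}.
  have [_] := s_std (at2 x); rewrite at2K.
  by case: (s (at2 x)).2 => [a|] // _; exists a.
exists [ffun x => sval (f1P x)], [ffun x => sval (f2P x)].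
apply/ffunP => i; rewrite ffunE [LHS]surjective_pairing;
  have [s1 s2] := s_std i.
congr (_, _).
  have := pos1K kln i; case: (pos1 i) s1 => [x|] /=; last by case: (s i).1.
  by move=> _ <-; rewrite ffunE; case: (f1P x) => a /= /eqP.
have := pos2K kln i; case: (pos2 i) s2 => [x|] /=; last by case: (s i).2.
by move=> _ <-; rewrite ffunE; case: (f2P x) => a /= /eqP.
Qed.

Lemma std_word_inj f1 f2 f1' f2' :
  std_word f1 f2 = std_word f1' f2' -> f1 = f1' /\ f2 = f2'.
Proof.
move=> /ffunP eq_std; split; apply/ffunP => x.
  by have := eq_std (at1 x); rewrite !ffunE at1K => -[].
by have := eq_std (at2 x); rewrite !ffunE at2K => -[].
Qed.

Lemma std_word_proper f1 f2 : proper_word (std_word f1 f2).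
Proof.
apply/forallP => i; rewrite ffunE /proper_letter /=.
have := pos1_some k i; have := pos2_some kln i;
  have [_ _ nkl] := pos_bounds kln.
by case: (pos1 i) => //; case: (pos2 i) => //= /esym/negbT + /esym/negbT; lia.
Qed.

Lemma std_word_act h f1 f2 :
  word_act (heis_to_i kln h) (std_word f1 f2) =
  std_word [ffun x => f1 ((heis_to_kl kln h).1 x)]
           [ffun x => f2 ((heis_to_kl kln h).2 x)].
Proof.
apply/ffunP => i; rewrite !ffunE pos1_heis pos2_heis.
by case: (pos1 i) => [x|]; case: (pos2 i) => [y|] //=; rewrite ?ffunE.
Qed.

(** A permutation between standard words preserves the positions carrying a
    vector of [V1], and those carrying a vector of [V2]. *)
Lemma std_word_act_heis g f1 f2 f1' f2' :
  word_act g (std_word f1 f2) = std_word f1' f2' -> exists h, g = heis_to_i kln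
    h.
Proof.
move=> /ffunP eq_std; apply: heis_to_iP => i; have := eq_std i; rewrite !ffunE.
  by case: (pos1 i) => [x|]; case: (pos1 (g i)).
by case: (pos2 i) => [x|]; case: (pos2 (g i)) => [?|] //= -[].
Qed.

Definition basis1 (f1 : word1) : tpow V1 k := tpowv (fun x => e1`_(f1 x)).
Definition basis2 (f2 : word2) : tpow V2 l := tpowv (fun x => e2`_(f2 x)).

Lemma tens_tpow_eq (X : vectType F) (f f' : 'Hom(W, X)) :
    (forall f1 f2, f (tensv (basis1 f1) (basis2 f2)) =
                   f' (tensv (basis1 f1) (basis2 f2))) ->
  forall t, f t = f' t.
Proof.
move=> eq_f; apply: tens_eqh => v w;
  have [tl tr] := bilinear_tensv (tpow V1 k) (tpow V2 l).
rewrite [v]tpow_sum (linear_comb _ _ (tl w)) !linear_sum.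
apply: eq_bigr => f1 _; rewrite !linearZ /=; congr (_ *: _).
rewrite [w]tpow_sum (linear_comb _ _ (tr _)) !linear_sum.
by apply: eq_bigr => f2 _; rewrite !linearZ /= eq_f.
Qed.

Definition merge_fun (v : tpow V1 k) (w : tpow V2 l) : tpow V n :=
  \sum_f1 \sum_f2 (v f1 * w f2) *: word_vec (std_word f1 f2).

(** The inclusion of the summand of the tensor power of [V] spanned by the
    standard words. *)
Definition word_merge : 'Hom(W, tpow V n) := tlift merge_fun.

Lemma bilinear_merge_fun : is_bilinear merge_fun.
Proof.
split=> [w a v v' | v a w w']; rewrite /merge_fun scaler_sumr -big_split /=;
    apply: eq_bigr => f1 _; rewrite scaler_sumr -big_split /=;
    apply: eq_bigr => f2 _; rewrite scalerA -scalerDl; congr (_ *: _);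
      rewrite !ffunE.
  by rewrite mulrDl mulrA.
by rewrite mulrDr mulrCA.
Qed.

Lemma merge_basis f1 f2 :
  word_merge (tensv (basis1 f1) (basis2 f2)) = word_vec (std_word f1 f2).
Proof.
rewrite tliftE; last exact: bilinear_merge_fun.
rewrite /merge_fun (bigD1 f1) //= (bigD1 f2) //= !tpow_basisE !eqxx mulr1
  scale1r.
rewrite big1 => [|g2 /negPf f2'g]; last first.
  by rewrite tpow_basisE eq_sym f2'g mulr0 scale0r.
rewrite big1 ?addr0 // => g1 /negPf f1'g; rewrite big1 // => g2 _.
by rewrite !tpow_basisE eq_sym f1'g mul0r scale0r.
Qed.

(** When the right-hand side is expanded in words, the factors [(1, 0)] of [F + V1]
    and [F + V2] at the remaining positions kill all but the standard words. *)
Lemma merge_pure v w : word_merge (tensv (tpowv v) (tpowv w)) =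
  tpowv (fun i => join_vec (oapp (fun x => (0, v x)) (1, 0) (pos1 i))
                       (oapp (fun y => (0, w y)) (1, 0) (pos2 i))).
Proof.
rewrite tliftE; last exact: bilinear_merge_fun.
rewrite [RHS]word_sum (bigID (mem [set std_word p.1 p.2 | p : word1 * word2]))
  /=.
rewrite [X in _ = _ + X]big1 ?addr0 => [|s s_out]; last first.
  have [/forallP s_proper | /word_vec_improper ->] := boolP (proper_word s);
    last first.
    by rewrite scaler0.
  have [i si] : exists i, ~~ ((isSome (s i).1 == isSome (pos1 i)) &&
                              (isSome (s i).2 == isSome (pos2 i))).
    apply/existsP; rewrite -negb_forall; apply: contra s_out => /forallP s_std.
    have [|f1 [f2 ->]] := @std_word_exists s.
      by move=> i; have /andP[/eqP ? /eqP] := s_std i.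
    by apply/imsetP; exists (f1, f2).
  rewrite word_coord_pure (bigD1 i) //= letter_coord_join //.
  suff -> : ext1_coord (s i).1 (oapp (fun x => (0, v x)) (1, 0) (pos1 i)) *
      ext2_coord (s i).2 (oapp (fun y => (0, w y)) (1, 0) (pos2 i)) = 0.
    by rewrite mul0r scale0r.
  move: si; case: (s i) => -[a|] [b|]; case: (pos1 i) => [x|];
    by case: (pos2 i) => [y|] //= _; rewrite ?linear0 ?mul0r ?mulr0.
rewrite big_imset /=; last first.
  by move=> [f1 f2] [g1 g2] _ _ /std_word_inj[/= -> ->].
rewrite /merge_fun pair_bigA /=; apply: eq_bigr => -[f1 f2] _ /=;
  congr (_ *: _).
have /forallP std_proper := std_word_proper f1 f2.
rewrite word_coord_pure !ffunE;
  under [RHS]eq_bigr do rewrite letter_coord_join //.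
rewrite big_split /=; congr (_ * _).
  rewrite -(prod_ocancel _ (at1K kln) (pos1K kln)); apply: eq_bigr => i _.
  by rewrite ffunE; case: (pos1 i).
rewrite -(prod_ocancel _ (at2K kln) (pos2K kln)); apply: eq_bigr => i _.
by rewrite ffunE; case: (pos2 i).
Qed.

Definition split_fun (t : tpow V n) : W :=
  \sum_f1 \sum_f2 word_coord (std_word f1 f2) t *: tensv (basis1 f1) (basis2
    f2).

Fact split_fun_linear : linear split_fun.
Proof.
move=> a t u; rewrite /split_fun scaler_sumr -big_split /=;
  apply: eq_bigr => f1 _.
rewrite scaler_sumr -big_split /=; apply: eq_bigr => f2 _.
by rewrite word_coord_linear scalerDl scalerA.
Qed.
HB.instance Definition _ := GRing.isLinear.Build F _ _ _ split_fun
  split_fun_linear.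

(** The projection onto the span of the standard words. *)
Definition word_split : 'Hom(tpow V n, W) := linfun split_fun.

Lemma split_std f1 f2 :
  word_split (word_vec (std_word f1 f2)) = tensv (basis1 f1) (basis2 f2).
Proof.
rewrite lfunE /= /split_fun (bigD1 f1) //= (bigD1 f2) //=.
rewrite word_coordE ?std_word_proper // eqxx scale1r.
rewrite big1 => [|g2 g2'f]; last first.
  rewrite word_coordE ?std_word_proper //; case: eqP => [|_];
    last by rewrite scale0r.
  by case/std_word_inj => _ eq_g; rewrite eq_g eqxx in g2'f.
rewrite big1 ?addr0 // => g1 g1'f; rewrite big1 // => g2 _.
rewrite word_coordE ?std_word_proper //; case: eqP => [|_];
  last by rewrite scale0r.
by case/std_word_inj => eq_g _; rewrite eq_g eqxx in g1'f.
Qed.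

Lemma split_nonstd s :
  (forall f1 f2, s != std_word f1 f2) -> word_split (word_vec s) = 0.
Proof.
move=> s_nonstd; rewrite lfunE /= /split_fun big1 // => f1 _;
  rewrite big1 // => f2 _.
by rewrite word_coordE ?std_word_proper // eq_sym (negPf (s_nonstd _ _))
  scale0r.
Qed.

Lemma mergeK y : word_split (word_merge y) = y.
Proof.
rewrite -comp_lfunE -[RHS](id_lfunE y); move: y; apply: tens_tpow_eq => f1 f2.
by rewrite comp_lfunE id_lfunE merge_basis split_std.
Qed.

Lemma std_wordP s :
  (exists f1 f2, s = std_word f1 f2) \/ (forall f1 f2, s != std_word f1 f2).
Proof.
have [/imsetP[[f1 f2] _ ->] | s_out] :=
    boolP (s \in [set std_word p.1 p.2 | p : word1 * word2]).
  by left; exists f1, f2.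
by right=> f1 f2; apply: contraNneq s_out => ->; apply/imsetP; exists (f1, f2).
Qed.

Local Notation T := (perm_tpow_rep V n).
Local Notation Y := (res_rep (heis_to_kl kln)
  (etens_rep (perm_tpow_rep V1 k) (perm_tpow_rep V2 l))).

Lemma split_heis h t :
  word_split (rep_act T (heis_to_i kln h) t) = rep_act Y h (word_split t).
Proof.
rewrite -comp_lfunE -[RHS]comp_lfunE; move: t; apply: word_eq => s _.
rewrite comp_lfunE [RHS]comp_lfunE word_vec_act.
have [[f1 [f2 ->]] | s_nonstd] := std_wordP s.
  rewrite std_word_act !split_std [RHS]tensfE; congr tensv.
    rewrite [RHS]perm_tpow_actE; congr tpowv; apply/funext => x.
    by rewrite ffunE.
  rewrite [RHS]perm_tpow_actE; congr tpowv; apply/funext => x.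
  by rewrite ffunE.
rewrite (split_nonstd s_nonstd) linear0 split_nonstd // => f1 f2.
apply/eqP => eq_s; have [|g1 [g2 eq_g]] := @std_word_exists s.
  move=> i; have := std_word_shape f1 f2 ((heis_to_i kln h)^-1 i)%g.
  rewrite -eq_s ffunE permKV => -[-> ->].
  have := pos1_heis kln h ((heis_to_i kln h)^-1 i)%g.
  have := pos2_heis kln h ((heis_to_i kln h)^-1 i)%g.
  by rewrite permKV => -> ->; case: (pos1 _); case: (pos2 _).
by have /eqP := s_nonstd g1 g2.
Qed.

Lemma split_out g y : (forall h, g != heis_to_i kln h) ->
  word_split (rep_act T g (word_merge y)) = 0.
Proof.
move=> g_out; rewrite -(zero_lfunE _ y) -[LHS]comp_lfunE -comp_lfunE.
move: y; apply: tens_tpow_eq => f1 f2.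
rewrite zero_lfunE !comp_lfunE merge_basis word_vec_act split_nonstd // => g1
  g2.
by apply/eqP => /std_word_act_heis[h /eqP]; apply/negP.
Qed.

Lemma phi_merge g1 g2 y :
  rep_act (gl_tpow_rep V n) (phi (g1, g2)) (word_merge y) =
  word_merge (tensf (rep_act (gl_tpow_rep V1 k) g1) (rep_act (gl_tpow_rep V2 l)
    g2) y).
Proof.
rewrite -comp_lfunE -[RHS]comp_lfunE; move: y; apply: tens_tpow_eq => f1 f2.
rewrite !comp_lfunE merge_basis tensfE !tpowfE merge_pure.
congr tpowv; apply/funext => i; rewrite ffunE /letter_vec /=.
case: (pos1 i) => [x|]; case: (pos2 i) => [z|] /=;
  by rewrite phi_join ?linear0.
Qed.

End Standard.

(** * Projections onto the words of a given bidegree *)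

Section WordProjection.

Variables (C : numClosedFieldType) (V1 V2 : vectType C) (k l n : nat).
Hypothesis kln : (maxn k l <= n <= k + l)%N.

Local Notation V := (Vhat V1 V2).
Local Notation word := {ffun 'I_n -> letter V1 V2}.
Local Notation word1 := {ffun 'I_k -> 'I_(\dim {:V1})}.
Local Notation word2 := {ffun 'I_l -> 'I_(\dim {:V2})}.
Local Notation T := (perm_tpow_rep V n).
Local Notation Y := (res_rep (heis_to_kl kln)
  (etens_rep (perm_tpow_rep V1 k) (perm_tpow_rep V2 l))).

(** The standard words span a copy of [Y] whose translates span the copy of the
    representation induced from [Y], that is, the words with [k] letters
    involving [V1] and [l] letters involving [V2]. *)
Definition word_op (R : 'End(Y)) : 'End(T) :=
  ind_op (U := T) (Y := Y) (@word_split C V1 V2 k l n) (@word_merge C V1 V2 k l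
    n) R.

Lemma word_op_equivariant R g u : equivariant R ->
  word_op R (rep_act T g u) = rep_act T g (word_op R u).
Proof.
move=> RH; apply: (ind_op_equivariant (f := heis_to_i kln)) RH.
exact: split_heis.
Qed.

Lemma word_op_comp (R R' : 'End(Y)) u : equivariant R -> equivariant R' ->
  word_op R (word_op R' u) = word_op (R \o R')%VF u.
Proof.
apply: (ind_op_comp (f := heis_to_i kln)).
- exact: heis_to_i_inj.
- exact: split_heis.
- exact: mergeK.
- exact: split_out.
Qed.

Definition word_proj : 'End(T) := word_op \1%VF.

Definition count1 (s : word) := #|[pred i | isSome (s i).1]|.
Definition count2 (s : word) := #|[pred i | isSome (s i).2]|.

Lemma count1_act g s : count1 (word_act g s) = count1 s.
Proof.
rewrite /count1 -(card_image (@perm_inj _ g)); apply: eq_card => i.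
apply/imageP/idP => [[j] | si]; first by rewrite !inE ffunE => sj ->.
by exists (g^-1 i)%g; rewrite ?permKV // !inE ffunE permKV.
Qed.

Lemma count2_act g s : count2 (word_act g s) = count2 s.
Proof.
rewrite /count2 -(card_image (@perm_inj _ g)); apply: eq_card => i.
apply/imageP/idP => [[j] | si]; first by rewrite !inE ffunE => sj ->.
by exists (g^-1 i)%g; rewrite ?permKV // !inE ffunE permKV.
Qed.

Lemma count_std (f1 : word1) (f2 : word2) : count1 (std_word n f1 f2 : word) =
  k /\
                        count2 (std_word n f1 f2 : word) = l.
Proof.
split.
  rewrite /count1 -[RHS]card_ord -(card_image (pcan_inj (at1K kln))).
  apply: eq_card => i; rewrite !inE (std_word_shape f1 f2 i).1.
  apply/idP/imageP => [|[x _ ->]]; last by rewrite at1K.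
  by have := pos1K kln i; case: (pos1 k i) => // x /= <- _; exists x.
rewrite /count2 -[RHS]card_ord -(card_image (pcan_inj (at2K kln))).
apply: eq_card => i; rewrite !inE (std_word_shape f1 f2 i).2.
apply/idP/imageP => [|[x _ ->]]; last by rewrite at2K.
by have := pos2K kln i; case: (pos2 l i) => // x /= <- _; exists x.
Qed.

(** A proper word is an eigenvector of the idempotent [word_proj]; its eigenvalue
    is nonzero exactly when some permutation makes the word standard. *)
Lemma word_proj_vec s : proper_word s ->
  word_proj (word_vec s) = ((count1 s == k) && (count2 s == l))%:R *: word_vec
    s.
Proof.
move=> s_proper; pose std s' := s' \in [set std_word n p.1 p.2 | p : word1 *
  word2].
have merge_split s' : @word_merge C V1 V2 k l n (@word_split C V1 V2 k l n
  (word_vec s')) =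
    (std s')%:R *: word_vec s'.
  have [/imsetP[[f1 f2] _ ->] | s'_out] := boolP (std s').
    by rewrite (split_std kln) merge_basis scale1r.
  rewrite split_nonstd ?linear0 ?scale0r // => f1 f2.
  by apply: contraNneq s'_out => ->; apply/imsetP; exists (f1, f2).
pose N := (\sum_x (std (word_act x s)))%N.
pose c : C := #|{: 'S_(n - l) * 'S_(k + l - n) * 'S_(n - k)}|%:R^-1.
have projE : word_proj (word_vec s) = (c * N%:R) *: word_vec s.
  rewrite /word_proj /word_op ind_opE -scalerA; congr (_ *: _).
  rewrite natr_sum scaler_suml; apply: eq_bigr => x _.
  have actK : rep_act T x^-1%g (word_vec (word_act x s)) = word_vec s.
    by rewrite -word_vec_act -rep_act_mul mulVg rep_act1 id_lfunE.
  by rewrite id_lfunE word_vec_act merge_split linearZ /= [X in _ *: X]actK.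
have cN_idem : c * N%:R * (c * N%:R) = c * N%:R.
  have proj2 : word_proj (word_proj (word_vec s)) = word_proj (word_vec s).
    by rewrite word_op_comp ?comp_lfun1l //; apply: equivariant_id.
  have := congr1 (word_coord s) proj2; rewrite projE linearZ /= projE scalerA.
  have coordZ a : word_coord s (a *: word_vec s) = a.
    have := word_coord_linear s a (word_vec s) 0.
    rewrite addr0 => ->; rewrite word_coordE // eqxx mulr1.
    have := word_coord_linear s (-1) 0 0;
      rewrite scaler0 addr0 mulN1r addNr => ->.
    by rewrite addr0.
  by rewrite !coordZ.
have c_neq0 : c != 0.
  by rewrite invr_eq0 pnatr_eq0 -lt0n; apply/card_gt0P; exists 1%g.
rewrite projE; congr (_ *: _).
have N_std : (N != 0)%N = (count1 s == k) && (count2 s == l).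
  rewrite sum_nat_eq0 negb_forall;
    apply/existsP/andP => [[x] | [/eqP s1 /eqP s2]].
    rewrite /= eqb0 negbK => /imsetP[[f1 f2] _ /= eq_s].
    rewrite -(count1_act x) -(count2_act x) eq_s.
    by have [-> ->] := count_std f1 f2.
  have [|x xP] := @sort_positions _ _ _ kln (fun i => isSome (s i).1)
      (fun i => isSome (s i).2) _ s1 s2.
    move=> i; have /forallP/(_ i) := s_proper.
    by case: (s i) => -[a|] [b|].
  exists x; rewrite /= eqb0 negbK; apply/imsetP.
  have [|f1 [f2 eq_s]] := @std_word_exists _ _ _ _ _ _ kln (word_act x s).
    by move=> i; rewrite ffunE; apply: xP.
  by exists (f1, f2).
rewrite -N_std; have [-> | N_neq0] := eqVneq N 0%N; first by rewrite mulr0.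
apply: (@mulfI _ (c * N%:R)); last by rewrite mulr1.
by rewrite mulf_neq0 ?pnatr_eq0.
Qed.

End WordProjection.

Section WordProjections.

Variables (C : numClosedFieldType) (V1 V2 : vectType C) (n : nat).

Local Notation T := (perm_tpow_rep (Vhat V1 V2) n).

(** Extending [word_proj] by zero outside the bounds on [k] and [l] lets the sum
    over all bidegrees be written without side conditions. *)
Definition word_part (k l : nat) : 'End(T) :=
  match @idP (maxn k l <= n <= k + l)%N with
  | ReflectT kln => word_proj V1 V2 kln
  | ReflectF _ => 0
  end.

Lemma word_partE k l (kln : (maxn k l <= n <= k + l)%N) :
  word_part k l = word_proj V1 V2 kln.
Proof.
rewrite /word_part; case: {-}_ / idP => [kln' | //].
by rewrite (bool_irrelevance kln' kln).
Qed.

Lemma word_part_out k l : ~~ (maxn k l <= n <= k + l)%N -> word_part k l = 0.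
Proof. by rewrite /word_part; case: {-}_ / idP => // kln; rewrite kln. Qed.

Lemma proper_counts s : @proper_word _ V1 V2 n s ->
  (maxn (count1 s) (count2 s) <= n <= count1 s + count2 s)%N.
Proof.
move=> /forallP s_proper; have card_le (p : pred 'I_n) : (#|p| <= n)%N.
  by rewrite -[leqRHS]card_ord max_card.
rewrite geq_max !card_le /= -[leqLHS]card_ord -cardUI.
apply: leq_trans (leq_addr _ _); apply/subset_leq_card/subsetP => i _.
by rewrite !inE; have := s_proper i; case: (s i) => -[a|] [b|].
Qed.

Lemma word_part_vec k l s : proper_word s ->
  word_part k l (word_vec s) = ((count1 s == k) && (count2 s == l))%:R *:
    word_vec s.
Proof.
move=> s_proper; have [kln | nkln] := boolP (maxn k l <= n <= k + l)%N.
  by rewrite (word_partE kln) word_proj_vec.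
rewrite (word_part_out nkln) zero_lfunE; case: andP => [[/eqP s1 /eqP s2] | _].
  by have := proper_counts s_proper; rewrite s1 s2 (negPf nkln).
by rewrite scale0r.
Qed.

Lemma word_part_orth k l k' l' u :
  (k, l) != (k', l') -> word_part k l (word_part k' l' u) = 0.
Proof.
move=> kl'; rewrite -comp_lfunE -(zero_lfunE _ u); move: u;
  apply: word_eq => s s_proper.
rewrite comp_lfunE word_part_vec // linearZ /= word_part_vec // scalerA
  zero_lfunE.
rewrite -natrM mulnb; case: andP => [[/andP[/eqP -> /eqP ->]] | _];
  last by rewrite scale0r.
by rewrite -xpair_eqE eq_sym (negPf kl').
Qed.

Lemma sum_word_part u : \sum_(k < n.+1) \sum_(l < n.+1) word_part k l u = u.
Proof.
under eq_bigr do rewrite -sum_lfunE; rewrite -sum_lfunE -[RHS](id_lfunE u).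
move: u; apply: word_eq => s s_proper; rewrite id_lfunE sum_lfunE.
have /andP[] := proper_counts s_proper; rewrite geq_max => /andP[s1 s2] _.
rewrite (bigD1 (Ordinal (s1 : count1 s < n.+1)%N)) //= sum_lfunE.
rewrite (bigD1 (Ordinal (s2 : count2 s < n.+1)%N)) //= word_part_vec // !eqxx
  scale1r.
rewrite big1 => [|l]; last first.
  rewrite -val_eqE /= => l's.
  by rewrite word_part_vec // eqxx [count2 s == l]eq_sym (negPf l's) scale0r.
rewrite big1 ?addr0 // => k; rewrite -val_eqE /= => k's;
  rewrite sum_lfunE big1 // => l _.
by rewrite word_part_vec // [count1 s == k]eq_sym (negPf k's) scale0r.
Qed.

End WordProjections.

(** * Vanishing of Schur functors *)

Section Vanishing.

Variables (C : numClosedFieldType) (V : vectType C) (n : nat) (la : intpart n).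

(** A basis tensor takes the same value on two entries of the first column of
    the tableau, so that it is fixed by a transposition which changes the sign
    of the column sum. *)
Lemma young_tpow_eq0 t : (\dim {:V} < size la)%N ->
  galg_act (perm_tpow_rep V n) (young C la) t = 0.
Proof.
move=> lt_dim; rewrite young_mul galg_actM.
move: (galg_act _ _ t) => {}t; rewrite [t]tpow_sum linear_sum big1 // => f _.
rewrite linearZ /=; apply/eqP; rewrite scaler_eq0; apply/orP; right; apply/eqP.
have cellP (r : 'I_(size la)) : {x | (tab_row la x == r) && (tab_col la x ==
  0%N)}.
  apply/sigW; have [|x x_r x_c] := @tab_cell n la r 0.
    have := ltn_ord r; case: (la) r => s /= /and3P[_ s0 _] r r_s.
    by rewrite lt0n; apply: contraNneq s0 => <-; apply: mem_nth.
  by exists x; rewrite x_r x_c !eqxx.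
have [r [r' r'r eq_f]] : exists r, exists2 r', r != r' &
    f (sval (cellP r)) = f (sval (cellP r')).
  apply/injectivePn; apply/negP => /injectiveP f_inj.
  by have := leq_card _ f_inj; rewrite !card_ord leqNgt lt_dim.
set x := sval (cellP r) in eq_f; set y := sval (cellP r') in eq_f.
have [/eqP xr /eqP xc] : tab_row la x == r /\ tab_col la x == 0%N.
  by apply/andP; exact: svalP (cellP r).
have [/eqP yr /eqP yc] : tab_row la y == r' /\ tab_col la y == 0%N.
  by apply/andP; exact: svalP (cellP r').
have xy : x != y by apply: contraNneq r'r => eq_xy;
  rewrite -val_eqE /= -xr -yr eq_xy.
have tC : tperm x y \in col_stab la.
  apply/col_stabP => z; rewrite permE /=.
  by case: eqP => [->|_]; [|case: eqP => [->|_]]; rewrite ?xc ?yc.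
set u := tpowv _; have fix_u : rep_act (perm_tpow_rep V n) (tperm x y) u = u.
  rewrite [LHS]perm_tpow_actE; congr tpowv; apply/funext => z.
  by case: tpermP => [->|->|] //; rewrite eq_f.
have eqN : galg_act (perm_tpow_rep V n) (col_sum C la) u =
    - galg_act (perm_tpow_rep V n) (col_sum C la) u.
  rewrite -{1}fix_u -galg_act_elt -galg_actM col_sum_mul // odd_tperm xy expr1.
  by rewrite scaleN1r linearN opp_lfunE.
apply/eqP; move/eqP: eqN; rewrite -addr_eq0 -mulr2n -scaler_nat scaler_eq0.
by rewrite pnatr_eq0.
Qed.

Lemma isotypic_tpow_eq0 t : (\dim {:V} < size la)%N ->
  isotypic (perm_tpow_rep V n) la t = 0.
Proof.
move=> lt_dim; rewrite -sum_spin_unspin big1 // => i _.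
have /memv_imgP[u _ uE] := mult_basis_in i.
by rewrite spinE uE young_tpow_eq0 // linear0.
Qed.

End Vanishing.

(** * Multiplicity spaces of a bilinear family of morphisms *)

(** Two groups [G1] and [G2] act on the space [W] of the representation [T] of
    the symmetric group and bilinearly parametrize, by their representations [S1]
    and [S2], morphisms from [X] to [T]. Applying these morphisms to a vector of
    [young_space X nu] gives a copy of the tensor product of [S1] and [S2]. *)
Section Pairing.

Variables (C : numClosedFieldType) (n : nat) (nu : intpart n).
Variables (X : rep C 'S_n) (G1 G2 : groupType) (S1 : rep C G1) (S2 : rep C G2).
Variables (W : vectType C) (a : 'S_n -> 'End(W)) (b : (G1 * G2)%type ->
  'End(W)).
Variables (a1 : a 1%g = \1%VF) (aM : forall g h, a (g * h)%g = (a g \o a h)%VF).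
Variables (b1 : b 1%g = \1%VF) (bM : forall g h, b (g * h)%g = (b g \o b h)%VF).

Local Notation T := (Rep W a a1 aM).
Local Notation U := (Rep W b b1 bM).
Local Notation B1 := (vbasis {:S1}).
Local Notation B2 := (vbasis {:S2}).

Variable F : S1 -> S2 -> 'Hom(X, T).
Variable D : 'I_(\dim {:S1}) -> 'I_(\dim {:S2}) -> 'Hom(T, X).

Hypothesis F_bilinear : forall x, is_bilinear (fun w w' => F w w' x).
Hypothesis F_perm : forall w w' s x, F w w' (rep_act X s x) = rep_act T s (F w
  w' x).
Hypothesis F_rep : forall g w w' x,
  F (rep_act S1 g.1 w) (rep_act S2 g.2 w') x = b g (F w w' x).
Hypothesis DF : forall i i' (j : 'I_(\dim {:S1})) (j' : 'I_(\dim {:S2})) x,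
  D i i' (F B1`_j B2`_j' x) = ((i == j) && (i' == j'))%:R *: x.

Local Notation c := (young C nu).
Local Notation norm := (young_norm C nu).
Local Notation mult := ('I_(\dim {: subvs_of (young_space X nu)})).

Implicit Type j : mult.

Definition mult_vec j : X := mult_basis (U := X) (la := nu) j.

Definition pairing_in j : 'Hom(etens_rep S1 S2, U) :=
  tlift (fun w w' => F w w' (mult_vec j)).

Lemma pairing_in_basis j t :
  pairing_in j t = \sum_i \sum_i' t i i' *: F B1`_i B2`_i' (mult_vec j).
Proof. exact: tlift_basis. Qed.

(** The component of [u] in the copy of [X] indexed by [i] and [i'], projected onto
    [young_space X nu]. *)
Definition pairing_coef (u : W) i i' : X :=
  norm^-1 *: galg_act X c (D i i' u).

Definition pairing_out_fun j (u : U) : etens_rep S1 S2 :=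
  \matrix_(i, i') mult_coord (U := X) (la := nu) j (pairing_coef u i i').

Fact pairing_out_linear j : linear (pairing_out_fun j).
Proof.
move=> k u v; apply/matrixP => i i'; rewrite !mxE /pairing_coef !linearP /=.
exact: mult_coord_linear.
Qed.
HB.instance Definition _ j :=
  GRing.isLinear.Build C _ _ _ (pairing_out_fun j) (pairing_out_linear j).

Definition pairing_out j : 'Hom(U, etens_rep S1 S2) := linfun (pairing_out_fun
  j).

Lemma pairing_outK i j t : pairing_out i (pairing_in j t) = (i == j)%:R *: t.
Proof.
rewrite lfunE; apply/matrixP => r s;
  rewrite !mxE pairing_in_basis /pairing_coef.
have -> : D r s (\sum_r' \sum_s' t r' s' *: F B1`_r' B2`_s' (mult_vec j)) =
    t r s *: mult_vec j.
  rewrite linear_sum (bigD1 r) //= linear_sum (bigD1 s) //= linearZ /=.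
  rewrite DF !eqxx scale1r big1 => [|s' /negPf s's]; last first.
    by rewrite linearZ /= DF eqxx eq_sym s's scale0r scaler0.
  rewrite addr0 big1 ?addr0 // => r' /negPf r'r;
    rewrite linear_sum big1 // => s' _.
  by rewrite linearZ /= DF eq_sym r'r scale0r scaler0.
rewrite linearZ /= (young_spaceP (mult_basis_in _)) !scalerA mulrAC.
rewrite mulVf ?young_norm_neq0 // mul1r.
have := mult_coord_linear i (t r s) (mult_vec j) 0; rewrite addr0 => ->.
by rewrite mult_coord_basis /mult_coord !linear0 addr0 mulrC.
Qed.

Lemma sum_pairing u : \sum_j pairing_in j (pairing_out j u) =
  norm^-1 *: galg_act T c (\sum_(i < \dim {:S1}) \sum_(i' < \dim {:S2}) F B1`_i
    B2`_i' (D i i' u)).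
Proof.
(* The projection onto the multiplicity space commutes with morphisms, so that
   it may be applied in [X]. *)
have QF w w' x : (norm^-1 *: galg_act T c) (F w w' x) =
    F w w' (norm^-1 *: galg_act X c x).
  rewrite scale_lfunE linearZ /=; congr (_ *: _).
  by rewrite (galg_act_comm (V := T)) //; apply: F_perm.
rewrite -scale_lfunE; move: (norm^-1 *: galg_act T c) QF => Q QF.
under eq_bigr do rewrite pairing_in_basis.
rewrite [RHS]linear_sum exchange_big /=; apply: eq_bigr => i _.
rewrite [RHS]linear_sum exchange_big /=; apply: eq_bigr => i' _.
rewrite QF -/(pairing_coef u i i').
have coef_in : pairing_coef u i i' \in young_space X nu.
  exact/memvZ/memv_img/memvf.
rewrite [in RHS](mult_coordP coef_in) linear_sum; apply: eq_bigr => j _.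
by rewrite linearZ lfunE mxE.
Qed.

Lemma pairing_in_equivariant j g t :
  pairing_in j (rep_act (etens_rep S1 S2) g t) = rep_act U g (pairing_in j t).
Proof.
rewrite -comp_lfunE -[RHS]comp_lfunE; move: t; apply: tens_eqh => w w'.
rewrite comp_lfunE [RHS]comp_lfunE [rep_act (etens_rep S1 S2) _ _]tensfE.
by rewrite !tliftE //; apply: F_rep.
Qed.

Lemma pairing_retract (P : 'End(W)) :
    (forall u, P u = norm^-1 *: galg_act T c (\sum_(i < \dim {:S1}) \sum_(i' <
      \dim {:S2}) F B1`_i B2`_i' (D i i' u))) ->
  retract (U := U) P
    (\bigoplus_(j < \dim {: subvs_of (young_space X nu)}) etens_rep S1 S2)%rep.
Proof.
move=> PE; have -> : P = \sum_j (pairing_in j \o pairing_out j)%VF.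
  apply/lfunP => u; rewrite PE -sum_pairing sum_lfunE.
  by apply: eq_bigr => j _; rewrite comp_lfunE.
apply: retract_sum => [i j u _ _ /negPf ij | j _].
  by rewrite !comp_lfunE pairing_outK ij scale0r linear0.
exists (pairing_in j), (pairing_out j); split=> [g t | t | u].
- exact: pairing_in_equivariant.
- by rewrite pairing_outK eqxx scale1r.
- by rewrite comp_lfunE.
Qed.

End Pairing.

(** * The branching rule *)

Section Branching.

Variables (C : numClosedFieldType) (V1 V2 : vectType C) (n : nat) (nu : intpart
  n).

Local Notation V := (Vhat V1 V2).
Local Notation T := (perm_tpow_rep V n).
Local Notation U := (res_rep (@phi C V1 V2) (gl_tpow_rep V n)).

(** The projection of the tensor power onto [schur V nu]. *)
Definition schur_proj : 'End(T) := (young_norm C nu)^-1 *: galg_act T (young C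
  nu).

Lemma schur_projE u :
  schur_proj u = (young_norm C nu)^-1 *: galg_act T (young C nu) u.
Proof. exact: scale_lfunE. Qed.

Lemma schur_proj_id u : u \in schur_space V nu -> schur_proj u = u.
Proof.
move=> uS; rewrite schur_projE (young_spaceP (U := T)) // scalerA.
by rewrite mulVf ?scale1r // young_norm_neq0.
Qed.

Lemma schur_proj_in u : schur_proj u \in schur_space V nu.
Proof. by rewrite schur_projE; apply/memvZ/memv_img/memvf. Qed.

Lemma schur_retract :
  retract (U := U) schur_proj (res_rep (@phi C V1 V2) (schur V nu)).
Proof.
exists (linfun vsval), (linfun (vsproj (schur_space V nu)) \o schur_proj)%VF;
  split=> [g x | x | u].
- rewrite [LHS]lfunE [linfun vsval x]lfunE.
  exact: (sub_actE (@schur_stable C V n nu) (phi g) x).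
- rewrite comp_lfunE [linfun vsval x]lfunE [LHS]lfunE /= schur_proj_id ?subvsP
  //.
  exact: vsvalK.
- rewrite comp_lfunE [LHS]lfunE [linfun (vsproj _) _]lfunE.
  exact/vsprojK/schur_proj_in.
Qed.

Section Bidegree.

Variables (k l : nat) (kln : (maxn k l <= n <= k + l)%N).

Local Notation T1 := (perm_tpow_rep V1 k).
Local Notation T2 := (perm_tpow_rep V2 l).
Local Notation Y := (res_rep (heis_to_kl kln) (etens_rep T1 T2)).
Local Notation q := (@word_split C V1 V2 k l n).
Local Notation q' := (@word_merge C V1 V2 k l n).

Lemma tensh_equivariant (A A' : rep C 'S_k) (B B' : rep C 'S_l)
    (f : 'Hom(A, A')) (g : 'Hom(B, B')) :
    (forall s x, f (rep_act A s x) = rep_act A' s (f x)) ->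
    (forall s x, g (rep_act B s x) = rep_act B' s (g x)) ->
  equivariant (Z := res_rep (heis_to_kl kln) (etens_rep A B))
    (Z' := res_rep (heis_to_kl kln) (etens_rep A' B')) (tensh f g).
Proof.
move=> fG gG h z; rewrite -comp_lfunE -[RHS]comp_lfunE.
move: z; apply: tens_eqh => v w; rewrite comp_lfunE [RHS]comp_lfunE.
rewrite [rep_act (res_rep _ (etens_rep A B)) h _]tensfE !tenshE.
by rewrite fG gG.
Qed.

Section Pair.

Variables (la : intpart k) (mu : intpart l).

Local Notation Z := (res_rep (heis_to_kl kln) (etens_rep (specht C la) (specht
  C mu))).
Local Notation X := (heisenberg kln (specht C la) (specht C mu)).
Local Notation S1 := (schur V1 la).
Local Notation S2 := (schur V2 mu).

Definition spin2 (w : T1) (w' : T2) : 'Hom(Z, Y) := tensh (spin la w) (spin mu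
  w').

Lemma spin2_equivariant w w' : equivariant (spin2 w w').
Proof. by apply: tensh_equivariant => s m; apply: spin_equivariant. Qed.

Definition unspin2 (i : 'I_(\dim {:S1})) (i' : 'I_(\dim {:S2})) : 'Hom(Y, Z) :=
  tensh (unspin (U := T1) (la := la) i) (unspin (U := T2) (la := mu) i').

Lemma unspin2_equivariant i i' : equivariant (unspin2 i i').
Proof. by apply: tensh_equivariant => s m; apply: unspin_equivariant. Qed.

Definition bas1 (i : 'I_(\dim {:S1})) : T1 := mult_basis (U := T1) (la := la) i.
Definition bas2 (i : 'I_(\dim {:S2})) : T2 := mult_basis (U := T2) (la := mu) i.

Lemma unspin2_spin2 i i' j j' z :
  unspin2 i i' (spin2 (bas1 j) (bas2 j') z) = ((i == j) && (i' == j'))%:R *: z.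
Proof.
rewrite -comp_lfunE -[z in RHS]id_lfunE -scale_lfunE.
move: z; apply: tens_eqh => v w.
rewrite comp_lfunE scale_lfunE id_lfunE !tenshE !unspin_spin_basis tensvZ.
by rewrite -natrM mulnb.
Qed.

Local Notation from S := (@from_ind C _ _ (heis_to_i kln) T Y q' Z S).
Local Notation to R := (@to_ind C _ _ (heis_to_i kln) T Y q Z R).

(** Vectors [w] and [w'] of the Schur functors determine morphisms from the Specht
    modules to the tensor powers of [V1] and [V2], hence a morphism from the
    Heisenberg product of the Specht modules to the tensor power of [V]. *)
Definition heis_in (w : S1) (w' : S2) : 'Hom(X, T) := from (spin2 (vsval w)
  (vsval w')).
Definition heis_out i i' : 'Hom(T, X) := to (unspin2 i i').

Lemma heis_in_bilinear x : is_bilinear (fun w w' => heis_in w w' x).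
Proof.
split=> [w a v v' | v a w w'].
  transitivity (from (a *: spin2 (vsval v) (vsval w) + spin2 (vsval v') (vsval
    w)) x).
    congr (fun_of_lfun (from _) _); rewrite -tensh_linearl; congr tensh.
    exact: spin_linear.
  exact: from_ind_linear.
transitivity (from (a *: spin2 (vsval v) (vsval w) + spin2 (vsval v) (vsval
  w')) x).
  congr (fun_of_lfun (from _) _); rewrite -tensh_linearr; congr tensh.
  exact: spin_linear.
exact: from_ind_linear.
Qed.

Lemma heis_in_perm w w' s x :
  heis_in w w' (rep_act X s x) = rep_act T s (heis_in w w' x).
Proof. exact: from_ind_equivariant. Qed.

Lemma heis_out_in i i' (j : 'I_(\dim {:S1})) (j' : 'I_(\dim {:S2})) (x : X) :
  heis_out i i' (heis_in (vbasis {:S1})`_j (vbasis {:S2})`_j' x) =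
  ((i == j) && (i' == j'))%:R *: x.
Proof.
apply/val_inj/ffunP => y.
transitivity (unspin2 i i' (spin2 (bas1 j) (bas2 j') ((vsval x : {ffun 'S_n ->
  Z}) y))).
  apply: (to_from_ind (f := heis_to_i kln)).
  - exact: heis_to_i_inj.
  - exact: split_heis.
  - exact: mergeK.
  - exact: split_out.
  - exact: spin2_equivariant.
  - exact: unspin2_equivariant.
exact: etrans (unspin2_spin2 _ _ _ _ _) (esym (ffunE _ _)).
Qed.

(** The general linear group commutes with the symmetric group, so that it acts on
    the morphisms [spin ka w] through [w]. *)
Lemma spin_gl (V0 : vectType C) m (ka : intpart m) (g : GL V0) (v : schur V0
  ka) :
  spin (U := perm_tpow_rep V0 m) ka (vsval (rep_act (schur V0 ka) g v)) =
  (rep_act (gl_tpow_rep V0 m) g \o spin (U := perm_tpow_rep V0 m) ka (vsval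
    v))%VF.
Proof.
apply/lfunP => z; rewrite comp_lfunE spinE.
rewrite (sub_actE (@schur_stable C V0 m ka) g v).
have comm := @galg_act_comm C _ (perm_tpow_rep V0 m) (perm_tpow_rep V0 m)
  (gl_tpow_act m g) (specht_val z) (vsval v).
have spin_v := spinE (vsval v : perm_tpow_rep V0 m) z.
transitivity (gl_tpow_act m g (galg_act (perm_tpow_rep V0 m) (specht_val z)
  (vsval v))).
  by symmetry; apply: comm => s x; apply/esym/perm_gl_act.
exact: (congr1 (gl_tpow_act m g) (esym spin_v)).
Qed.

Lemma heis_in_rep g w w' x :
  heis_in (rep_act S1 g.1 w) (rep_act S2 g.2 w') x = rep_act U g (heis_in w w'
    x).
Proof.
case: g => g1 g2.
have in_gl z : spin2 (vsval (rep_act S1 g1 w)) (vsval (rep_act S2 g2 w')) z =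
    tensf (rep_act (gl_tpow_rep V1 k) g1) (rep_act (gl_tpow_rep V2 l) g2)
      (spin2 (vsval w) (vsval w') z).
  by rewrite tensh_tensf tensh_comp -!spin_gl.
pose x_ y := spin2 (vsval w) (vsval w') ((vsval x : {ffun 'S_n -> Z}) y).
have termE (y : 'S_n) : rep_act T y^-1%g (q' (spin2 (vsval (rep_act S1 g1 w))
      (vsval (rep_act S2 g2 w')) ((vsval x : {ffun 'S_n -> Z}) y))) =
    rep_act (gl_tpow_rep V n) (phi (g1, g2)) (rep_act T y^-1%g (q' (x_ y))).
  by rewrite in_gl -(phi_merge kln); exact: perm_gl_act.
have fromE : heis_in w w' x = #|{: 'S_(n - l) * 'S_(k + l - n) * 'S_(n -
  k)}|%:R^-1 *:
    \sum_y rep_act T y^-1%g (q' (x_ y)) by apply: from_indE.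
transitivity (rep_act (gl_tpow_rep V n) (phi (g1, g2))
    (#|{: 'S_(n - l) * 'S_(k + l - n) * 'S_(n - k)}|%:R^-1 *:
      \sum_y rep_act T y^-1%g (q' (x_ y)))).
  rewrite [LHS]from_indE (eq_bigr _ (fun y _ => termE y)) [RHS]linearZ.
  by congr (_ *: _); rewrite [RHS]linear_sum.
exact: (congr1 (rep_act (gl_tpow_rep V n) (phi (g1, g2))) (esym fromE)).
Qed.

Lemma isotypic_sum (V0 : vectType C) m (ka : intpart m) :
  isotypic (perm_tpow_rep V0 m) ka =
  \sum_i (spin ka (mult_basis (U := perm_tpow_rep V0 m) (la := ka) i) \o unspin
    i)%VF.
Proof.
apply/lfunP => u; rewrite -sum_spin_unspin sum_lfunE.
by apply: eq_bigr => i _; rewrite comp_lfunE.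
Qed.

Definition pair_proj : 'End(Y) := tensh (isotypic T1 la) (isotypic T2 mu).

Lemma sum_heis u : \sum_(i < \dim {:S1}) \sum_(i' < \dim {:S2})
    heis_in (vbasis {:S1})`_i (vbasis {:S2})`_i' (heis_out i i' u) =
  word_op (kln := kln) pair_proj u.
Proof.
have -> : pair_proj = \sum_(i < \dim {:S1}) \sum_(i' < \dim {:S2})
    (spin2 (bas1 i) (bas2 i') \o unspin2 i i')%VF.
  apply/lfunP => t; rewrite /pair_proj !isotypic_sum tensh_sum sum_lfunE.
  apply: eq_bigr => i _; rewrite sum_lfunE; apply: eq_bigr => i' _.
  by rewrite comp_lfunE [RHS]tensh_comp.
rewrite /word_op ind_op_sum; apply: eq_bigr => i _.
rewrite ind_op_sum; apply: eq_bigr => i' _.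
have fromto := @from_to_ind C _ _ (heis_to_i kln) T Y q q'
  (@split_heis C V1 V2 k l n kln) Z (spin2 (bas1 i) (bas2 i')) (unspin2 i i') u
  (unspin2_equivariant i i').
exact: fromto.
Qed.

Lemma aguiarE :
  aguiar C la mu nu = \dim {: subvs_of (young_space X nu)}.
Proof.
rewrite /aguiar; case: {-}_ / idP => [kln' | //].
by rewrite (bool_irrelevance kln' kln) specht_multE.
Qed.

Definition pair_part : 'End(T) := (schur_proj \o word_op (kln := kln)
  pair_proj)%VF.

(** The Aguiar coefficient is the dimension of the multiplicity space of
    [specht C nu] in the Heisenberg product. *)
Lemma pair_retract : retract (U := U) pair_part
  (\bigoplus_(j < aguiar C la mu nu) etens_rep S1 S2)%rep.
Proof.
have PE u : pair_part u = (young_norm C nu)^-1 *: galg_act T (young C nu)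
    (\sum_(i < \dim {:S1}) \sum_(i' < \dim {:S2})
       heis_in (vbasis {:S1})`_i (vbasis {:S2})`_i' (heis_out i i' u)).
  by rewrite sum_heis comp_lfunE schur_projE.
rewrite aguiarE.
have := @pairing_retract C n nu X _ _ S1 S2 (tpow V n) (rep_act T) (rep_act U)
  (rep_act1 T) (@rep_actM _ _ T) (rep_act1 U) (@rep_actM _ _ U) heis_in heis_out
  heis_in_bilinear heis_in_perm heis_in_rep heis_out_in.
by move/(_ pair_part PE).
Qed.

Lemma pair_proj_equivariant : equivariant pair_proj.
Proof. by apply: tensh_equivariant => s x; apply: isotypic_rep. Qed.

End Pair.

Lemma schur_proj_word_op (R : 'End(Y)) u : equivariant R ->
  word_op R (schur_proj u) = schur_proj (word_op R u).
Proof.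
move=> RH; rewrite !schur_projE linearZ; congr (_ *: _).
by apply: galg_act_comm => g x; apply: word_op_equivariant.
Qed.

Lemma pair_part_orth (la la' : intpart k) (mu mu' : intpart l) u :
  (la, mu) != (la', mu') -> pair_part la mu (pair_part la' mu' u) = 0.
Proof.
move=> pair_neq; rewrite !comp_lfunE schur_proj_word_op;
  last exact: pair_proj_equivariant.
rewrite word_op_comp; try exact: pair_proj_equivariant.
have -> : (pair_proj la mu \o pair_proj la' mu')%VF = 0.
  apply/lfunP => t; rewrite zero_lfunE comp_lfunE tensh_comp.
  have comp0 (V0 : vectType C) m (ka ka' : intpart m) : ka != ka' ->
      (isotypic (perm_tpow_rep V0 m) ka \o isotypic (perm_tpow_rep V0 m)
        ka')%VF = 0.
    by move=> neq; apply/lfunP => v;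
      rewrite comp_lfunE isotypic_orth // zero_lfunE.
  move: pair_neq; rewrite xpair_eqE negb_and => /orP[] neq.
    by rewrite comp0 // tensh0l zero_lfunE.
  by rewrite [(isotypic T2 _ \o _)%VF]comp0 // tensh0r zero_lfunE.
have -> : word_op (0 : 'End(Y)) u = 0.
  by rewrite ind_opE big1 ?scaler0 // => x _; rewrite zero_lfunE !linear0.
by rewrite !linear0.
Qed.

Definition bidegree_part : 'End(T) := (schur_proj \o word_proj V1 V2 kln)%VF.

(** The identity of [Y] is the sum of the [pair_proj la mu], in which partitions
    with more parts than the dimension contribute zero. *)
Lemma bidegree_retract : retract (U := U) bidegree_part
  (\bigoplus_(la : intpart k | (size la <= \dim {:V1})%N)
     \bigoplus_(mu : intpart l | (size mu <= \dim {:V2})%N)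
        \bigoplus_(j < aguiar C la mu nu) etens_rep (schur V1 la) (schur V2
          mu))%rep.
Proof.
have isotypic_out (V0 : vectType C) m (ka : intpart m) :
    ~~ (size ka <= \dim {:V0})%N -> isotypic (perm_tpow_rep V0 m) ka = 0.
  rewrite -ltnNge => lt_dim; apply/lfunP => v.
  by rewrite isotypic_tpow_eq0 // zero_lfunE.
have sum_pair : \sum_(la : intpart k | (size la <= \dim {:V1})%N)
    \sum_(mu : intpart l | (size mu <= \dim {:V2})%N) pair_proj la mu = \1%VF.
  rewrite big_rmcond => [|la la_out]; last first.
    by rewrite big1 // => mu _; rewrite /pair_proj isotypic_out // tensh0l.
  under eq_bigr => la _.
    rewrite big_rmcond => [|mu mu_out];
      last by rewrite /pair_proj [isotypic T2 _]isotypic_out // tensh0r.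
    over.
  have sum1 : \sum_la isotypic T1 la = \1%VF.
    by apply/lfunP => v; rewrite sum_lfunE sum_isotypic id_lfunE.
  have sum2 : \sum_mu isotypic T2 mu = \1%VF.
    by apply/lfunP => v; rewrite sum_lfunE sum_isotypic id_lfunE.
  apply/lfunP => t; rewrite id_lfunE -[RHS]tensh_id -sum1 -sum2 tensh_sum
    sum_lfunE.
  by apply: eq_bigr => la _; rewrite sum_lfunE.
pose e (la : intpart k) :=
  \sum_(mu : intpart l | (size mu <= \dim {:V2})%N) pair_part la mu.
have -> : bidegree_part = \sum_(la : intpart k | (size la <= \dim {:V1})%N) e
  la.
  apply/lfunP => u; rewrite comp_lfunE sum_lfunE /word_proj -sum_pair /word_op.
  rewrite ind_op_sum linear_sum; apply: eq_bigr => la _.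
  rewrite ind_op_sum linear_sum sum_lfunE; apply: eq_bigr => mu _.
  by rewrite comp_lfunE.
apply: retract_sum => [la la' u _ _ la_neq | la _].
  rewrite /e sum_lfunE big1 // => mu _;
    rewrite sum_lfunE linear_sum big1 // => mu' _.
  by apply: pair_part_orth; rewrite xpair_eqE negb_and la_neq.
apply: retract_sum => [mu mu' u _ _ mu_neq | mu _]; last exact: pair_retract.
by apply: pair_part_orth; rewrite xpair_eqE negb_and mu_neq orbT.
Qed.

End Bidegree.

(** Outside the bounds of the Heisenberg product, both the part of the tensor power
    and the Aguiar coefficients vanish. *)
Theorem schur_branching : rep_iso (res_rep (@phi C V1 V2) (schur V nu))
  (\bigoplus_(k < n.+1) \bigoplus_(l < n.+1)
    \bigoplus_(la : intpart k | (size la <= \dim {:V1})%N)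
      \bigoplus_(mu : intpart l | (size mu <= \dim {:V2})%N)
        \bigoplus_(j < aguiar C la mu nu)
          etens_rep (schur V1 la) (schur V2 mu))%rep.
Proof.
apply: retract_iso schur_retract _.
pose e k l := (schur_proj \o word_part V1 V2 n k l)%VF.
have part_comm k l u : word_part V1 V2 n k l (schur_proj u) =
    schur_proj (word_part V1 V2 n k l u).
  have [kln | kln] := boolP (maxn k l <= n <= k + l)%N.
    rewrite (word_partE _ _ kln); apply: schur_proj_word_op.
    exact: equivariant_id.
  by rewrite word_part_out // !zero_lfunE linear0.
have e_orth k l k' l' u : (k, l) != (k', l') -> e k l (e k' l' u) = 0.
  by move=> kl; rewrite !comp_lfunE part_comm word_part_orth // !linear0.
have -> : schur_proj = \sum_(k < n.+1) \sum_(l < n.+1) e k l.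
  apply/lfunP => u; rewrite -{1}[u]sum_word_part linear_sum sum_lfunE.
  apply: eq_bigr => k _; rewrite linear_sum sum_lfunE.
  by apply: eq_bigr => l _; rewrite comp_lfunE.
apply: retract_sum => [k k' u _ _ k_neq | k _].
  rewrite sum_lfunE big1 // => l _;
    rewrite sum_lfunE linear_sum big1 // => l' _.
  by apply: e_orth; rewrite xpair_eqE negb_and [k == k' :> nat]val_eqE k_neq.
apply: retract_sum => [l l' u _ _ l_neq | l _].
  by apply: e_orth; rewrite xpair_eqE negb_and [l == l' :> nat]val_eqE l_neq
    orbT.
have [kln | kln] := boolP (maxn k l <= n <= k + l)%N.
  by rewrite /e (word_partE _ _ kln); apply: bidegree_retract.
have -> : e k l = \sum_(la : intpart k | (size la <= \dim {:V1})%N)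
    \sum_(mu : intpart l | (size mu <= \dim {:V2})%N) 0.
  apply/lfunP => u; rewrite comp_lfunE word_part_out // zero_lfunE linear0.
  by rewrite big1 ?zero_lfunE // => la _; rewrite big1.
apply: retract_sum => [la la' u _ _ _ | la _].
  by rewrite [X in fun_of_lfun X _]big1 ?zero_lfunE.
apply: retract_sum => [mu mu' u _ _ _ | mu _]; first by rewrite zero_lfunE.
by rewrite aguiar_out // big_ord0; apply: retract_zero.
Qed.

End Branching.

Local Open Scope complex_scope.

Theorem theorem1p1 (R : realType) (V1 V2 : vectType R[i]) (n : nat)
    (nu : intpart n) :
  (size nu <= \dim {: Vhat V1 V2})%N ->
  rep_iso
    (res_rep (@phi R[i] V1 V2) (schur (Vhat V1 V2) nu))
    (\bigoplus_(k < n.+1) \bigoplus_(l < n.+1)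
      \bigoplus_(la : intpart k | (size la <= \dim {:V1})%N)
        \bigoplus_(mu : intpart l | (size mu <= \dim {:V2})%N)
          \bigoplus_(j < aguiar R[i] la mu nu)
            etens_rep (schur V1 la) (schur V2 mu))%rep.
Proof. by move=> _; apply: schur_branching. Qed.
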